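(* Assume that there exists $\gamma\in\mathbb{R}$ with $$\sum_{k=1}^{\infty} \frac{\sigma_k^2}{(1+\theta_k)^{\gamma}} \left(1+ \frac{1}{\theta_k} \right)^{2H} < \infty .$$ Fix $n\in\mathbb{N}$ and, for $N\in\mathbb{N}$, define $$Y_N := \frac{\sum_{k=1}^{N} \frac{\theta_k^{2H}}{\sigma_k^2} \frac{1}{n} \sum_{t=1}^{n} z_k(t)^2}{N H \Gamma(2H)},\qquad \alpha^{*}_N := (Y_N)^{-\frac{1}{2H}} .$$ Then $\alpha^*_N$ is strongly consistent in space, i.e. $\alpha^*_N\to\alpha$ almost surely as $N\to\infty$, and it is asymptotically normal in space, i.e. $$\frac{\alpha^{*}_N - \alpha}{\frac{\alpha^{1+2H}}{2H}\sqrt{\mathrm{var}(Y_N)}} \longrightarrow U \sim \mathcal{N}(0,1)\quad\text{in distribution as } N\to\infty,$$ with $\mathrm{var}(Y_N)\asymp\frac1N$ for $N\to\infty$. If, in addition, $\lim_{k\to\infty}\theta_k=\infty$, then $$\sqrt{N}\left(\alpha^{*}_N - \alpha\right) \longrightarrow \tilde{U} \sim \mathcal{N}\Big(0,\frac{\alpha^{2}}{2n H^2}\Big)\quad\text{in distribution as } N\to\infty.$$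
   Context: $\mathcal{V}$ is a separable Hilbert space, $\alpha>0$ is the (unknown) parameter, $H\in(0,1)$. Consider the linear stochastic evolution equation $dX(t)=\alpha AX(t)\,dt+\Phi\,dB^H(t)$ in $\mathcal{V}$, where $A$ and $\Phi$ are densely defined self-adjoint linear operators with a common orthonormal basis of eigenvectors $\{e_k\}_{k\in\mathbb{N}}$: $Ae_k=-\theta_ke_k$, $\theta_k>0$, and $\Phi e_k=\sigma_ke_k$, $\sigma_k>0$, and $B^H$ is a standard two-sided cylindrical fractional Brownian motion with Hurst parameter $H$, i.e. $\langle B^H(t),e_k\rangle=\beta^H_k(t)$ with $(\beta_k^H(t),t\in\mathbb{R})$, $k\in\mathbb{N}$, mutually independent real-valued standard two-sided fractional Brownian motions with Hurst parameter $H$. The stationary solution is $Z(t)=\sum_{k=1}^\infty z_k(t)e_k$, $t\ge0$, where $z_k$ are the stationary fractional Ornstein-Uhlenbeck processes $$z_k(t)=z_k(0)e^{-\alpha\theta_kt}+\int_0^te^{-\alpha\theta_k(t-s)}\sigma_k\,d\beta^H_k(s),\qquad z_k(0)=\int_{-\infty}^0e^{\alpha\theta_ks}\sigma_k\,d\beta^H_k(s).$$ The summability assumption in the claim guarantees that this series converges in $L_2(\Omega,\mathcal{V}^{2H-\gamma})$, where $\mathcal{V}^\rho=\{\sum_kv_ke_k:\sum_k(1+\theta_k)^\rho v_k^2<\infty\}$. The coordinates $z_1,\ldots,z_N$ are observed at times $t=1,\ldots,n$. $\Gamma$ is the gamma function. $a_N\asymp b_N$ means that there are constants $0<c\le C<\infty$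 with $cb_N\le a_N\le Cb_N$ for all $N$. *)

(* Defs.v *)
From HB Require Import structures.
From mathcomp Require Import all_boot all_order all_algebra sesquilinear.
From mathcomp Require Import all_classical all_reals all_analysis.

Set Implicit Arguments.
Unset Strict Implicit.
Unset Printing Implicit Defensive.

Import Order.TTheory GRing.Theory Num.Theory.
Import numFieldNormedType.Exports.

Local Open Scope classical_set_scope.
Local Open Scope ring_scope.

Section hilbert.
Context {R : realType} {V : completeNormedModType R}.
Implicit Types dot : {dot V for idfun}.

(* Together with the completeness of [V], this makes [V] a real Hilbert
   space with inner product [dot]. *)
Definition hilbert dot := forall v : V, dot v v = `|v| ^+ 2.

(* Being indexed by [nat], such a basis makes [V] separable. *)
Definition orthonormal_basis dot (e : nat -> V) :=
  (forall i j, dot (e i) (e j) = (i == j)%:R) /\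
  (forall v, \sum_(k < m) dot v (e k) *: e k @[m --> \oo] --> v).

(* A possibly unbounded operator is a total function [A] of which only the
   restriction to the domain [D] matters. *)
Definition linear_on (D : set V) (A : V -> V) :=
  D 0 /\ forall (c : R) u v, D u -> D v ->
    D (c *: u + v) /\ A (c *: u + v) = c *: A u + A v.

(* The right-hand side of the equivalence says that [u] lies in the domain of
   the adjoint of [A] and that the adjoint maps [u] to [w]: the graphs of [A]
   and of its adjoint coincide. *)
Definition self_adjoint dot (D : set V) (A : V -> V) :=
  [/\ linear_on D A, dense D &
      forall u w, (D u /\ A u = w) <->
                  (forall v, D v -> dot (A v) u = dot v w)].

Definition eigenvector (D : set V) (A : V -> V) (l : R) (v : V) :=
  D v /\ A v = l *: v.

End hilbert.

(* Euler's Gamma function (on positive reals) *)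
Definition Gamma {R : realType} (x : R) : R :=
  (\int[lebesgue_measure]_(t in `]0, +oo[) (t `^ (x - 1) * expR (- t)))%R.

Section probability.
Context d {T : measurableType d} {R : realType} (P : probability T R).

Definition mean_square_dist (X Y : T -> R) : \bar R :=
  ('E_P[(fun w => (X w - Y w) ^+ 2)%R])%E.

(* The case split is needed because the library's [normal_prob m 0] is an
   arbitrary default and not the Dirac measure at [m]. *)
Definition is_gaussian (X : T -> R) :=
  exists m s : R, 0 <= s /\
    forall A : set R, measurable A ->
      P (X @^-1` A) = if s == 0 then dirac m A else normal_prob m s A.

Definition gaussian_process (X : R -> T -> R) :=
  forall (m : nat) (c t : 'I_m -> R),
    is_gaussian (fun w => \sum_(i < m) c i * X (t i) w).

Definition fractional_brownian_motion (H : R) (X : R -> {RV P >-> R}) :=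
  [/\ gaussian_process X,
      forall t, ('E_P[X t] = 0)%E &
      forall s t, covariance P (X s) (X t) =
        (2^-1 * (`|s| `^ (2 * H) + `|t| `^ (2 * H) - `|t - s| `^ (2 * H)))%:E].

Definition process_sigma_algebra (X : R -> T -> R) : set (set T) :=
  <<s [set A | exists t, exists2 B : set R, measurable B & A = X t @^-1` B] >>.

Definition independent_processes (X : nat -> R -> T -> R) :=
  forall (s : seq nat) (E : nat -> set T), uniq s ->
    (forall k, k \in s -> process_sigma_algebra (X k) (E k)) ->
    P (\bigcap_(k in [set` s]) E k) = (\prod_(k <- s) fine (P (E k)))%:E.

(* [B t v] is the pairing <B(t), v>; as B(t) is not a random element of [V],
   B is given by these pairings. The last clause says that
   B(t) = \sum_k <B(t), e_k> e_k, in mean square after pairing with [v]. *)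
Definition cylindrical_fBm (V : completeNormedModType R)
    (dot : {dot V for idfun}) (e : nat -> V) (H : R)
    (B : R -> V -> {RV P >-> R}) :=
  [/\ forall k, fractional_brownian_motion H (fun t => B t (e k)),
      independent_processes (fun k t => B t (e k)) &
      forall t v,
        mean_square_dist (B t v)
            (fun w => \sum_(k < m) dot v (e k) * B t (e k) w)
          @[m --> \oo] --> 0%E].

(* [a :: s] lists the endpoints of the subintervals, [xi i] is the tag of the
   [i]-th one. *)
Definition tagged_partition (a b : R) (s : seq R) (xi : nat -> R) :=
  itv_partition a b s /\
  forall i, (i < size s)%N -> nth b (a :: s) i <= xi i <= nth b (a :: s) i.+1.

Definition mesh_lt (a b : R) (s : seq R) (delta : R) :=
  forall i, (i < size s)%N -> nth b (a :: s) i.+1 - nth b (a :: s) i < delta.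

Definition RS_sum (f g : R -> R) (a b : R) (s : seq R) (xi : nat -> R) :=
  \sum_(0 <= i < size s)
    f (xi i) * (g (nth b (a :: s) i.+1) - g (nth b (a :: s) i)).

(* Wiener integral [I] of a (continuously differentiable) deterministic [f]
   against [X] over [[a, b]]: the limit in mean square of the
   Riemann-Stieltjes sums as the mesh tends to 0. *)
Definition wiener_integral (f : R -> R) (X : R -> T -> R) (a b : R)
    (I : T -> R) :=
  forall eps : R, 0 < eps -> exists2 delta : R, 0 < delta &
    forall s xi, tagged_partition a b s xi -> mesh_lt a b s delta ->
      (mean_square_dist I (fun w => RS_sum f (fun t => X t w) a b s xi)
        <= eps%:E)%E.

Definition wiener_integral_ninfty (f : R -> R) (X : R -> T -> R) (b : R)
    (I : T -> R) :=
  exists2 J : R -> {RV P >-> R},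
    forall a, a <= b -> wiener_integral f X a b (J a) &
    mean_square_dist I (J a) @[a --> -oo] --> 0%E.

Definition stationary_fOU (lambda sigma : R) (X z : R -> {RV P >-> R}) :=
  wiener_integral_ninfty (fun s => expR (lambda * s) * sigma) X 0 (z 0) /\
  forall t : R, 0 <= t -> exists2 I : {RV P >-> R},
    wiener_integral (fun s => expR (- lambda * (t - s)) * sigma) X 0 t I &
    {ae P, forall w, z t w = z 0 w * expR (- lambda * t) + I w}.

(* The points [x] without mass are the continuity points of the distribution
   function of [mu]. *)
Definition cvg_in_distribution (X : nat -> T -> R)
    (mu : {measure set (measurableTypeR R) -> \bar R}) :=
  forall x : R, mu [set x] = 0%E ->
    P [set w | X N w <= x] @[N --> \oo] --> mu [set` `]-oo, x]].

(* The coordinates are indexed from 0: the sum over k = 1, ..., N of the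
   mathematics is the sum over k < N here. *)
Definition Y_stat (H : R) (theta sigma : nat -> R) (z : nat -> R -> T -> R)
    (n N : nat) (w : T) : R :=
  (\sum_(k < N) (theta k `^ (2 * H) / sigma k ^+ 2)
     * (n%:R^-1 * \sum_(1 <= t < n.+1) z k t%:R w ^+ 2))
  / (N%:R * H * Gamma (2 * H)).

Definition alpha_star (H : R) (theta sigma : nat -> R) (z : nat -> R -> T -> R)
    (n N : nat) (w : T) : R :=
  Y_stat H theta sigma z n N w `^ (- (2 * H)^-1).

End probability.

(* Main.v *)
(** Let p = 2H, and let v_k = sigma_k^2 (alpha theta_k)^(-p) H Gamma(p) be the
    variance of z_k(t). Then Y_N is the arithmetic mean, over k < N, of the
    variables W_k = alpha^(-p) (1/n) sum_t z_k(t)^2 / v_k, which are independent,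
    nonnegative, of mean alpha^(-p), with variances between two positive
    constants and with bounded third central moments. The strong law of large
    numbers gives the consistency. Lindeberg's replacement method gives the
    central limit theorem for Y_N with an error that is uniform in the threshold.
    As y |-> y^(-1/p) is decreasing, alpha*_N lies below a threshold exactly when
    Y_N lies above another one, so that the delta method reduces to the
    convergence of these thresholds.

    The moments of z = z_k come from its mean square approximation by the sums
    S = sum_(i < m) e^(-i lambda h) sigma (B(t - ih) - B(t - (i+1)h)), with
    lambda = alpha theta_k. By the covariance of B, E S^2 is a sum with geometric
    weights, squeezed between Riemann sums for
    int_0^oo p u^(p-1) e^(-u) du = p Gamma(p). As S is centered Gaussian,
    E S^4 = 3 (E S^2)^2; this passes to the limit since E S^6 is bounded, and by
    polarization E z(s)^2 z(t)^2 = v^2 + 2 r^2 with r = E z(s) z(t). Finally,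
    summation by parts makes S an average of increments sigma (B(t) - B(t - x)),
    x > 0, whose covariances at two different times yield
    |r| <= C sigma^2 / lambda^2, and this is negligible with respect to v when
    theta_k tends to infinity. *)

Require Import Defs.
From HB Require Import structures.
From mathcomp Require Import all_boot all_order all_algebra sesquilinear.
From mathcomp Require Import all_classical all_reals all_analysis.
From mathcomp Require Import measurable_realfun ring lra.

Set Implicit Arguments.
Unset Strict Implicit.
Unset Printing Implicit Defensive.

Import Order.TTheory GRing.Theory Num.Theory.
Import numFieldNormedType.Exports.

Local Open Scope classical_set_scope.
Local Open Scope ring_scope.

(** * Normal distributions *)

(** By definition [z] is known only through mean square limits of sums over its driving motion, so
    every property is first shown for these sums and then has to survive the limit. The
    approximations at the times up to [n] share one step [1/q], which keeps their joint covariances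
    computable, and their squared errors [(j+1)^-2] are summable, which makes the convergence almost
    sure as well. The almost sure limit serves twice: Fatou's lemma bounds the sixth moments, and
    [z] agrees almost surely with a variable that is measurable for the sigma-algebra of its own
    motion, which is where the independence of the [W_k] comes from. The variance computation uses
    only that [(j lambda h)^p] increases with [j], never the sign of its second differences, so that
    [H < 1/2] and [H > 1/2] are treated alike. The lower bound on the variances of the [W_k] is the
    contribution of the pairs of equal times, the upper bound is the Cauchy-Schwarz inequality.
    Uniformity in the threshold is indispensable: the thresholds produced by the monotone change of
    variable move with [N], and the passage to the scale [sqrt N] moves them once more. *)

Section density.
Context d (T : measurableType d) (R : realType).
Variables (nu mu : {measure set T -> \bar R}) (g : T -> R).
Hypotheses (mg : measurable_fun setT g) (g0 : forall x, 0 <= g x).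
Hypothesis nuE : forall A, measurable A -> nu A = (\int[mu]_(x in A) (g x)%:E)%E.
Import HBNNSimple.

(** Linearity reduces the claim to the indicator of a level set, where it is [nuE]; the level sets
    of negative values are empty. *)
Lemma integral_density_nnsfun (f : {nnsfun T >-> R}) :
  (\int[nu]_x (f x)%:E = \int[mu]_x ((f x)%:E * (g x)%:E))%E.
Proof.
under [LHS]eq_integral do rewrite fimfunE -fsumEFin//.
rewrite [LHS]ge0_integral_fsum//; last 2 first.
  - by move=> r; exact/measurable_EFinP/measurableT_comp.
  - by move=> n x _; rewrite EFinM nnfun_muleindic_ge0.
under [RHS]eq_integral.
  move=> x xD; rewrite fimfunE -fsumEFin// ge0_mule_fsuml; last first.
    by move=> r; rewrite EFinM nnfun_muleindic_ge0.
  over.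
rewrite [RHS]ge0_integral_fsum//; last 2 first.
  - move=> r; apply: emeasurable_funM; last exact/measurable_EFinP.
    exact/measurable_EFinP/measurableT_comp.
  - by move=> n x _; apply: mule_ge0; rewrite ?lee_fin// -lee_fin EFinM nnfun_muleindic_ge0.
apply: eq_fsbigr => r _; have [r0|r0] := leP 0 r; last first.
  rewrite preimage_nnfun0// !integral0_eq//.
    by move=> x _; rewrite indic0 mulr0 mul0e.
  by move=> x _; rewrite indic0 mulr0.
have mA : measurable (f @^-1` [set r]) by [].
under eq_integral do rewrite EFinM.
rewrite ge0_integralZl//; last exact/measurable_EFinP/measurable_indic.
rewrite integral_indic// setIT nuE//.
under [RHS]eq_integral do rewrite EFinM -muleA.
rewrite ge0_integralZl//; last 2 first.
  - apply: emeasurable_funM; last exact/measurable_EFinP.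
    exact/measurable_EFinP/measurable_indic.
  - by move=> x _; rewrite mule_ge0 ?lee_fin.
congr (_ * _)%E; rewrite integral_mkcond; apply: eq_integral => x _.
by rewrite patchE indicE; case: ifPn; rewrite ?mul1e ?mul0e.
Qed.

Lemma ge0_integral_density (f : T -> \bar R) :
  measurable_fun setT f -> (forall x, 0 <= f x)%E ->
  (\int[nu]_x f x = \int[mu]_x (f x * (g x)%:E))%E.
Proof.
move=> mf f0; pose f_ := nnsfun_approx measurableT mf.
transitivity (lim (\int[nu]_x (f_ n x)%:E @[n --> \oo])%E).
  rewrite -monotone_convergence//=.
  - apply: eq_integral => ? /[!inE] xD; apply/esym/cvg_lim => //=.
    exact: cvg_nnsfun_approx.
  - by move=> n; exact/measurable_EFinP/measurable_funTS.
  - by move=> n ? _; rewrite lee_fin.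
  - by move=> ? _ ? ? mn; rewrite lee_fin; exact/lefP/nd_nnsfun_approx.
rewrite [RHS](_ : _ = lim
    (\int[mu]_x ((f_ n x)%:E * (g x)%:E) @[n --> \oo])%E); last first.
  rewrite -monotone_convergence//=.
  - apply: eq_integral => x /[!inE] xD; apply/esym/cvg_lim => //=.
    apply: cvgeZr => //; exact: cvg_nnsfun_approx.
  - move=> n; apply: emeasurable_funM; last exact/measurable_EFinP.
    exact/measurable_EFinP.
  - by move=> n x _; rewrite mule_ge0// lee_fin.
  - move=> x _ i j ij; rewrite lee_wpmul2r// lee_fin//.
    exact/lefP/nd_nnsfun_approx.
by apply: congr_lim; apply/funext => n /=; exact: integral_density_nnsfun.
Qed.
End density.

Section normal.
Context {R : realType}.
Local Notation mu := (@lebesgue_measure R).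
Implicit Types m s t x : R.

Lemma ge0_integral_normal_prob m s (f : R -> \bar R) :
  measurable_fun setT f -> (forall x, 0 <= f x)%E ->
  (\int[normal_prob m s]_x f x = \int[mu]_x (f x * (normal_pdf m s x)%:E))%E.
Proof.
move=> mf f0; apply: (ge0_integral_density (nu := normal_prob m s)) => //.
- exact: measurable_normal_pdf.
- by move=> x; exact: normal_pdf_ge0.
Qed.

Lemma normal_pdf_scale m s x : 0 < s ->
  normal_pdf m s (m + s * x) * s = normal_pdf 0 1 x.
Proof.
move=> s0; rewrite !normal_pdfE ?gt_eqF// /normal_peak /normal_fun.
rewrite (addrC m) addrK subr0 expr1n mul1r -mulrnAr sqrtrM ?sqr_ge0//.
rewrite sqrtr_sqr gtr0_norm// invfM mulrAC -[X in X * _]mulrA mulrC.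
have -> : (- (s * x) ^+ 2 / (s ^+ 2 *+ 2)) = - x ^+ 2 / (1 *+ 2).
  by rewrite -mulr_natr; field; rewrite gt_eqF.
by rewrite (mulrC _ s) mulKf ?gt_eqF// mulrC.
Qed.

Lemma derive1_affine m s : (fun x : R => m + s * x)^`()%classic = cst s.
Proof.
apply/funext => x; rewrite derive1E deriveD// derive_cst add0r deriveM//.
by rewrite derive_cst scaler0 addr0 derive_id scaler1.
Qed.

Lemma derivable_affine m s x : derivable (fun x : R => m + s * x) x 1.
Proof. exact: derivableD. Qed.

(** The substitution [y = m + s * x] turns every nondegenerate normal law into the standard one, the
    only law whose moments are computed below. *)
Lemma ge0_integral_normal_scale m s (f : R -> R) : 0 < s ->
  continuous f -> (forall x, 0 <= f x) ->
  (\int[normal_prob m s]_x (f x)%:E = \int[normal_prob 0 1]_x (f (m + s * x)%R)%:E)%E.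
Proof.
move=> s0 cf f0.
have ca : continuous (fun x : R => m + s * x).
  by move=> x; apply: cvgD; [exact: cvg_cst|apply: cvgM; [exact: cvg_cst|exact: cvg_id]].
rewrite ge0_integral_normal_prob//; last first.
  by apply/measurable_EFinP; apply: continuous_measurable_fun.
have mfa : measurable_fun setT (EFin \o (fun x => f (m + s * x))).
  apply/measurable_EFinP; apply: continuous_measurable_fun => x.
  exact: (continuous_comp (ca x) (cf _)).
have fa0 x : (0 <= (EFin \o (fun y => f (m + s * y)%R)) x)%E by rewrite lee_fin.
rewrite [RHS](ge0_integral_normal_prob 0 1 mfa fa0).
under eq_integral do rewrite -EFinM.
rewrite (@increasing_ge0_integration_by_substitutionT _ (fun x : R => m + s * x)
  (fun x => f x * normal_pdf m s x)).
- apply: eq_integral => x _; rewrite derive1_affine /= -EFinM; congr EFin.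
  by rewrite !fctE /= -mulrA normal_pdf_scale.
- by move=> x y xy; rewrite ltrD2l ltr_pM2l.
- by rewrite derive1_affine => x; exact: cvg_cst.
- by rewrite derive1_affine; exact: is_cvg_cst.
- by rewrite derive1_affine; exact: is_cvg_cst.
- exact: derivable_affine.
- rewrite (_ : (fun x => _) = +%R m \o *%R s)//.
  apply: cvg_comp; last exact: cvg_addrl_Ny.
  exact: gt0_cvgMrNy.
- apply: cvg_comp; last exact: cvg_addrl.
  exact: gt0_cvgMry.
- move=> x; apply: cvgM; first exact: cf.
  by apply: continuous_normal_pdf; rewrite gt_eqF.
- by move=> x; rewrite mulr_ge0// normal_pdf_ge0.
Qed.

(** Bayes' formula: the joint density of a standard normal [z] and of [w = m + s z + t y] is
    factored in both orders. On the right stand the density of [w] and the conditional density of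
    [z] given [w]. *)
Lemma normal_pdf_conv m s t z w : 0 < s -> 0 < t ->
  let r := Num.sqrt (s ^+ 2 + t ^+ 2) in
  normal_pdf 0 1 z * normal_pdf (m + s * z) t w =
  normal_pdf m r w *
    normal_pdf (s * (w - m) / r ^+ 2) (t / r) z.
Proof.
move=> s0 t0 r.
have st0 : 0 < s ^+ 2 + t ^+ 2 by rewrite addr_gt0// exprn_gt0.
have r0 : 0 < r by rewrite sqrtr_gt0.
have r2 : r ^+ 2 = s ^+ 2 + t ^+ 2 by rewrite sqr_sqrtr// ltW.
clearbody r.
rewrite !normal_pdfE ?gt_eqF ?divr_gt0// /normal_peak /normal_fun.
rewrite mulrACA [in RHS]mulrACA; congr (_ * _).
  rewrite -!invfM -!sqrtrM; last 2 first.
    by rewrite mulrn_wge0// mulr_ge0 ?pi_ge0// sqr_ge0.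
    by rewrite mulrn_wge0// mulr_ge0 ?pi_ge0// sqr_ge0.
  apply: (congr1 (fun u => (Num.sqrt u)^-1)); rewrite exprMn exprVn r2 !mulr2n.
  by field; rewrite gt_eqF.
rewrite -!expRD exprMn exprVn r2; congr expR.
field; rewrite !gt_eqF ?exprn_gt0//=.
Qed.

(* The sum of independent normal variables is normal: complete the square in [z]. *)
Lemma ge0_integral_normal_conv m s t (f : R -> R) : 0 < s -> 0 < t ->
  continuous f -> (forall x, 0 <= f x) ->
  (\int[normal_prob 0 1]_z \int[normal_prob 0 1]_y (f (m + s * z + t * y)%R)%:E =
   \int[normal_prob 0 1]_x (f (m + Num.sqrt (s ^+ 2 + t ^+ 2) * x)%R)%:E)%E.
Proof.
move=> s0 t0 cf f0; set r := Num.sqrt _.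
have st0 : 0 < s ^+ 2 + t ^+ 2 by rewrite addr_gt0// exprn_gt0.
have r0 : 0 < r by rewrite sqrtr_gt0.
have mf : measurable_fun setT f by exact: continuous_measurable_fun.
have mpdf : measurable_fun setT (fun x : R * R => normal_pdf (m + s * x.1) t x.2).
  rewrite /normal_pdf gt_eqF//; apply: measurable_funM => //.
  apply: measurableT_comp => //; apply: measurable_funM => //.
  apply: measurableT_comp => //; apply: measurable_funX.
  apply: measurable_funB => //; apply: measurable_funD => //.
  exact: measurable_funM.
have E1 z : (\int[normal_prob 0 1]_y (f (m + s * z + t * y)%R)%:E =
   \int[mu]_w (f w * normal_pdf (m + s * z) t w)%:E)%E.
  rewrite -ge0_integral_normal_scale// ge0_integral_normal_prob//.
  exact/measurable_EFinP.
under eq_integral do rewrite E1.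
have mF : measurable_fun setT (fun x : R * R =>
    (f x.2 * normal_pdf (m + s * x.1) t x.2)%:E).
  apply/measurable_EFinP; apply: measurable_funM => //.
  exact: measurableT_comp.
rewrite [LHS]ge0_integral_normal_prob//; last 2 first.
  - apply: (measurable_fun_fubini_tonelli_F (m2 := mu) _ mF) => x.
    by rewrite lee_fin mulr_ge0// normal_pdf_ge0.
  - by move=> z; apply: integral_ge0 => w _; rewrite lee_fin mulr_ge0// normal_pdf_ge0.
transitivity (\int[mu]_z \int[mu]_w
   (f w * normal_pdf (m + s * z) t w * normal_pdf 0 1 z)%:E)%E.
  apply: eq_integral => z _; rewrite -ge0_integralZr//.
  - apply/measurable_EFinP; apply: measurable_funM => //.
    exact: measurable_normal_pdf.
  - by move=> w _; rewrite lee_fin mulr_ge0// normal_pdf_ge0.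
  - by rewrite lee_fin normal_pdf_ge0.
rewrite (fubini_tonelli (m1 := mu) (m2 := mu) (fun x : R * R =>
   (f x.2 * normal_pdf (m + s * x.1) t x.2 * normal_pdf 0 1 x.1)%:E))/=; last 2 first.
  - apply/measurable_EFinP; apply: measurable_funM; first exact/measurable_EFinP.
    by apply: measurableT_comp => //; exact: measurable_normal_pdf.
  - by move=> x; rewrite lee_fin !mulr_ge0// normal_pdf_ge0.
rewrite -[RHS]ge0_integral_normal_scale// ge0_integral_normal_prob//; last first.
  exact/measurable_EFinP.
apply: eq_integral => w _.
under eq_integral do rewrite -mulrA [X in _ * X]mulrC normal_pdf_conv// mulrA EFinM.
rewrite ge0_integralZl//.
- by rewrite integral_normal_pdf mule1 EFinM.
- by apply/measurable_EFinP; exact: measurable_normal_pdf.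
- by move=> z _; rewrite lee_fin normal_pdf_ge0.
- by rewrite lee_fin mulr_ge0// normal_pdf_ge0.
Qed.

Lemma normal_prob_itv_le m s a b : 0 < s -> a <= b ->
  (normal_prob m s `]a, b] <= (normal_peak s * (b - a))%:E)%E.
Proof.
move=> s0 ab; rewrite /normal_prob.
apply: (@le_trans _ _ (\int[mu]_(x in `]a, b]) (normal_peak s)%:E)%E).
  apply: ge0_le_integral => //.
  - by move=> x _; rewrite lee_fin normal_pdf_ge0.
  - by apply/measurable_EFinP/measurable_funTS; exact: measurable_normal_pdf.
  - by move=> x _; rewrite lee_fin normal_pdf_ub// gt_eqF.
rewrite integral_cst//= lebesgue_measure_itv/= lte_fin.
case: ifPn => // /negbTE ba; rewrite mule0 lee_fin mulr_ge0 ?normal_peak_ge0//.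
by rewrite subr_ge0.
Qed.

End normal.

(** * Moments of the standard normal law *)

Section normal_moments.
Context {R : realType}.
Local Notation mu := (@lebesgue_measure R).
Local Notation N01 := (@normal_prob R 0 1).
Implicit Types x : R.

(** With [y = |x|^k] one has [y <= 1 + y^2], and [y^2] is controlled by the term of degree [k] of
    the exponential series at [c x^2]. For [c = 1/4] the bound is still integrable against the
    normal density. *)
Lemma expr_le_expR (c x : R) k : 0 < c ->
  `|x| ^+ k <= 1 + c ^- k * k`!%:R * expR (c * x ^+ 2).
Proof.
move=> c0.
have [->|k0] := posnP k.
  by rewrite expr0 lerDl mulr_ge0 ?expR_ge0// mulr_ge0// invr_ge0 exprn_ge0// ltW.
have x2 : 0 <= c * x ^+ 2 by rewrite mulr_ge0 ?sqr_ge0 ?ltW.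
apply: (@le_trans _ _ (1 + (x ^+ 2) ^+ k)).
  rewrite -(real_normK (num_real x)) -exprM mulnC exprM; set y := `|x| ^+ k.
  have : 0 <= (y - 1) ^+ 2 by apply: sqr_ge0.
  have : 0 <= y by apply: exprn_ge0.
  by nra.
rewrite lerD2l; case: k k0 => // k _.
have := expR_ge1Dxn k x2; rewrite exprMn => h.
have ck : 0 < c ^+ k.+1 by rewrite exprn_gt0.
have fk : 0 < k.+1`!%:R :> R by rewrite ltr0n fact_gt0.
move: h; set u := (x ^+ 2) ^+ _; set e := expR _ => h.
have : c ^+ k.+1 * u / (k.+1)`!%:R <= e by lra.
rewrite ler_pdivrMr// -ler_pdivlMl// => /le_trans; apply.
by rewrite [e * _]mulrC mulrA.
Qed.

Lemma is_derive_normal_pdf x :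
  is_derive x (1 : R) (normal_pdf 0 1 : R -> R) (- x * normal_pdf 0 1 x).
Proof.
have E : normal_pdf 0 1 = fun x => normal_peak 1 * expR (- 2^-1 * x ^+ 2) :> R.
  apply/funext => y; rewrite normal_pdfE ?oner_neq0// /normal_fun; congr (_ * expR _).
  by rewrite subr0 expr1n; field.
rewrite E; apply: is_derive_eq; rewrite /GRing.scale/=.
by field.
Qed.

Lemma normal_prob_integrable (f : R -> R) : measurable_fun setT f ->
  (forall x, 0 <= f x) ->
  N01.-integrable setT (EFin \o f) <->
  mu.-integrable setT (EFin \o (fun x => f x * normal_pdf 0 1 x)).
Proof.
move=> mf f0.
have E : (\int[N01]_x `|(f x)%:E| = \int[mu]_x `|(f x * normal_pdf 0 1 x)%:E|)%E.
  transitivity (\int[N01]_x (f x)%:E)%E.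
    by apply: eq_integral => x _ /=; rewrite ger0_norm.
  rewrite ge0_integral_normal_prob//; last exact/measurable_EFinP.
  by apply: eq_integral => x _ /=; rewrite ger0_norm ?EFinM// mulr_ge0 ?normal_pdf_ge0.
split=> /integrableP[m h]; apply/integrableP; split.
- apply/measurable_EFinP; apply: measurable_funM => //; exact: measurable_normal_pdf.
- by rewrite -E.
- exact/measurable_EFinP.
- by rewrite E.
Qed.

Lemma normal_prob_Rintegral (f : R -> R) : measurable_fun setT f ->
  (\int[N01]_x f x = \int[mu]_x (f x * normal_pdf 0 1 x))%R.
Proof.
move=> mf; have mE : measurable_fun setT (EFin \o f) by exact/measurable_EFinP.
rewrite /Rintegral [in LHS]integralE [in RHS]integralE.
rewrite !ge0_integral_normal_prob//; last 2 first.
  exact: measurable_funeneg.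
  exact: measurable_funepos.
congr (fine (_ - _)%E); apply: eq_integral => x _.
  by rewrite !funepos.unlock /= -!EFin_max -EFinM maxr_pMl ?mul0r// normal_pdf_ge0.
by rewrite !funeneg.unlock /= -!EFin_max -EFinM maxr_pMl ?mul0r ?mulNr// normal_pdf_ge0.
Qed.

(** The product of [exp (x^2 / 4)] with the standard normal density is a multiple of the density of
    variance 2. *)
Lemma integrable_expR_normal :
  N01.-integrable setT (EFin \o (fun x => expR (4^-1 * x ^+ 2))).
Proof.
have mf : measurable_fun setT (fun x : R => expR (4^-1 * x ^+ 2)).
  by apply: measurableT_comp => //; apply: measurable_funM.
apply/normal_prob_integrable => //.
have s2 : Num.sqrt 2 != 0 :> R by rewrite gt_eqF// sqrtr_gt0.
have E : (fun x => expR (4^-1 * x ^+ 2) * normal_pdf 0 1 x) =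
   fun x => normal_peak 1 / normal_peak (Num.sqrt 2) * normal_pdf 0 (Num.sqrt 2) x :> R.
  apply/funext => x; rewrite !normal_pdfE ?oner_neq0// /normal_fun.
  rewrite mulrA [_^-1 * _]mulrC mulrA mulfVK ?gt_eqF ?normal_peak_gt0//.
  rewrite -mulrA mulrCA; congr (_ * _); rewrite -expRD; congr expR.
  by rewrite sqr_sqrtr// !subr0 expr1n; field.
rewrite E; under [X in _.-integrable _ X]eq_fun do rewrite /= EFinM.
by apply: integrableZl => //; exact: integrable_normal_pdf.
Qed.

Lemma integrable_expr_normal k :
  N01.-integrable setT (EFin \o (fun x => x ^+ k)).
Proof.
have ig : N01.-integrable setT
    (fun x : R => (1 + 4^-1 ^- k * k`!%:R * expR (4^-1 * x ^+ 2))%:E).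
  under eq_fun do rewrite EFinD EFinM.
  apply: integrableD => //.
    by apply: (finite_measure_integrable_cst _ 1).
  by apply: integrableZl => //; exact: integrable_expR_normal.
apply: (le_integrable _ _ _ ig) => //.
- exact/measurable_EFinP.
- move=> x _; rewrite /= lee_fin normrX.
  by apply: (le_trans (expr_le_expR x k (c := 4^-1) _)); rewrite ?invr_gt0 ?ler_norm.
Qed.

Lemma integrable_normr_normal k :
  N01.-integrable setT (EFin \o (fun x => `|x| ^+ k)).
Proof.
under [X in _.-integrable _ X]eq_fun do rewrite -normrX.
exact: (integrable_norm (integrable_expr_normal k)).
Qed.

Definition normal_moment k : R := (\int[N01]_x (x ^+ k))%R.

(** Applied with [k + 1] in place of [k], it shows that [x^k] times the density is [O(1/x)], which
    disposes of the boundary terms in the integrations by parts. *)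
Lemma expr_normal_pdf_le (x : R) k :
  `|x| ^+ k * normal_pdf 0 1 x <= normal_peak 1 * (1 + 4^-1 ^- k * k`!%:R).
Proof.
rewrite normal_pdfE ?oner_neq0// mulrCA ler_wpM2l ?normal_peak_ge0//.
rewrite /normal_fun subr0 expr1n.
have q : 0 <= x ^+ 2 by exact: sqr_ge0.
have e1 : expR (- x ^+ 2 / (1 *+ 2)) <= 1.
  by rewrite -expR0 ler_expR mulNr oppr_le0 mulr_ge0.
have e2 : expR (4^-1 * x ^+ 2) * expR (- x ^+ 2 / (1 *+ 2)) <= 1.
  rewrite -expRD expR_le1 mulr2n.
  have -> : - x ^+ 2 / (1 + 1) = - 2^-1 * x ^+ 2 :> R by field.
  lra.
have := expr_le_expR x k (c := 4^-1) _.
rewrite invr_gt0 ltr0n => /(_ isT); set a := _ * k`!%:R => h.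
have a0 : 0 <= a by rewrite mulr_ge0// invr_ge0 exprn_ge0.
apply: (le_trans (ler_wpM2r (expR_ge0 _) h)); rewrite mulrDl mul1r lerD//.
by rewrite -mulrA ler_piMr.
Qed.

Lemma expr_normal_pdf_cvg0 k :
  (fun n : nat => n.+1%:R ^+ k * normal_pdf 0 1 n.+1%:R : R) @ \oo --> (0 : R).
Proof.
set C := normal_peak 1 * (1 + 4^-1 ^- k.+1 * k.+1`!%:R) : R.
apply: (@squeeze_cvgr _ _ _ _ (cst 0) (fun n : nat => harmonic n * C)).
- near=> n.
  rewrite mulr_ge0 ?exprn_ge0 ?normal_pdf_ge0//= ler_pdivlMl ?ltr0n//.
  rewrite mulrA -exprS; have := expr_normal_pdf_le n.+1%:R k.+1.
  by rewrite ger0_norm.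
- exact: cvg_cst.
- rewrite -[X in _ --> X](mul0r C).
  by apply: cvgM; [exact: cvg_harmonic|exact: cvg_cst].
Unshelve. all: end_near. Qed.

(** Fundamental theorem of calculus on symmetric intervals, then dominated convergence. Only the
    difference of the two boundary values has to vanish, which is automatic for an even [F]. *)
Lemma integral_derive_eq0 (F g : R -> R) : (forall x, is_derive x (1 : R) F (g x)) ->
  continuous g -> mu.-integrable setT (EFin \o g) ->
  (fun n : nat => F n.+1%:R - F (- n.+1%:R)) @ \oo --> (0 : R) ->
  \int[mu]_x g x = 0.
Proof.
move=> dF cg ig F0.
pose gn (n : nat) : R -> \bar R := (EFin \o g) \_ `[(- n.+1%:R), n.+1%:R].
have E n : (\int[mu]_x gn n x = (F n.+1%:R - F (- n.+1%:R))%:E)%E.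
  rewrite /gn -integral_mkcond EFinB -(continuous_FTC2 (f := g))//.
  - by rewrite gtrN ?ltr0n.
  - exact: continuous_subspaceT.
  - split; [by move=> x _; case: (dF x)| |].
    + apply: cvg_at_right_filter; apply: differentiable_continuous.
      by apply/derivable1_diffP; case: (dF (- n.+1%:R)).
    + apply: cvg_at_left_filter; apply: differentiable_continuous.
      by apply/derivable1_diffP; case: (dF (n.+1%:R)).
  - by move=> x _; rewrite derive1E; case: (dF x).
have lim0 : (fun n => \int[mu]_x gn n x)%E @ \oo --> 0%E.
  under eq_fun do rewrite E.
  by rewrite -[0%E]/((0 : R)%:E); apply/cvg_EFin; first by near=> n.
suff : (\int[mu]_x (g x)%:E = 0)%E by rewrite /Rintegral => ->.
apply: cvg_unique lim0 => //.
apply: (@dominated_cvg _ _ _ mu setT measurableT gn (EFin \o g) (abse \o (EFin \o g))) => //.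
- move=> n; apply: (iffLR (measurable_restrictT (EFin \o g) _)) => //.
  by apply/measurable_EFinP/measurable_funTS; exact: continuous_measurable_fun.
- move=> x _; apply: cvg_near_cst.
  near=> n; rewrite /gn patchE mem_set//= in_itv/= -ler_norml.
  near: n; apply: filterS (nbhs_infty_ger `|x|) => n /le_trans; apply.
  by rewrite ler_nat.
- exact: integrable_abse.
- move=> n x _; rewrite /gn patchE; case: ifPn => _; [exact: lexx|rewrite abse0].
  exact: abse_ge0.
Unshelve. all: end_near. Qed.

Lemma integrable_expr_pdf k :
  mu.-integrable setT (EFin \o (fun x => x ^+ k * normal_pdf 0 1 x)).
Proof.
have mX : measurable_fun setT (fun x : R => `|x| ^+ k * normal_pdf 0 1 x).
  apply: measurable_funM; last exact: measurable_normal_pdf.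
  by apply: measurable_funX; exact: normr_measurable.
have i : mu.-integrable setT (EFin \o (fun x => `|x| ^+ k * normal_pdf 0 1 x)).
  apply/(normal_prob_integrable _ _) => //; last exact: integrable_normr_normal.
  by apply: measurable_funX; exact: normr_measurable.
apply: (le_integrable _ _ _ i) => //.
- apply/measurable_EFinP; apply: measurable_funM => //; exact: measurable_normal_pdf.
- move=> x _; rewrite lee_fin !normrM normrX.
  by rewrite [`| `|x| ^+ k|]ger0_norm// exprn_ge0.
Qed.

Lemma normal_pdfN x : normal_pdf 0 1 (- x) = normal_pdf 0 1 x.
Proof. by rewrite !normal_pdfE ?oner_neq0// /normal_fun !subr0 sqrrN. Qed.

(* Integration by parts, with [(- x^(k+1) phi)' = (x^(k+2) - (k+1) x^k) phi]. *)
Lemma normal_moment_even j :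
  normal_moment (2 * j).+2 = (2 * j).+1%:R * normal_moment (2 * j).
Proof.
set k := (2 * j)%N.
pose phi : R -> R := normal_pdf 0 1.
pose g x := (x ^+ k.+2 - k.+1%:R * x ^+ k) * phi x.
pose F x := - (x ^+ k.+1 * phi x).
have pE l (x : R) : 0 <= x ^+ (2 * l) by rewrite exprM exprn_ge0// sqr_ge0.
have ge0k2 x : 0 <= x ^+ k.+2 by rewrite (_ : k.+2 = (2 * j.+1)%N) ?pE// mulnS.
have ge0k x : 0 <= x ^+ k by rewrite pE.
have cphi : continuous phi by apply: continuous_normal_pdf; rewrite oner_neq0.
have cX l : continuous (fun x : R => x ^+ l) by move=> x; exact: exprn_continuous.
have cg : continuous g.
  move=> x; apply: cvgM; last exact: cphi.
  by apply: cvgB; [exact: cX|apply: cvgM; [exact: cvg_cst|exact: cX]].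
have dF x : is_derive x (1 : R) F (g x).
  have := is_derive_normal_pdf x => dphi.
  have dX : is_derive x (1 : R) (fun x : R => x ^+ k.+1) (k.+1%:R * x ^+ k).
    rewrite (_ : (fun x : R => _) = (id : R -> R) ^+ k.+1); last by apply/funext => y; rewrite exprfctE.
    apply: is_derive_eq.
    by rewrite /GRing.scale/= mulr1.
  apply: (is_derive_eq (is_deriveN (is_deriveM dX dphi))).
  by rewrite /GRing.scale/= /g /phi !exprS; ring.
have gE : g = fun x => x ^+ k.+2 * phi x - k.+1%:R * (x ^+ k * phi x).
  by apply/funext => x; rewrite /g mulrBl mulrA.
have i0 : mu.-integrable setT (EFin \o (fun x => k.+1%:R * (x ^+ k * phi x))).
  rewrite -[X in _.-integrable _ X]/(fun x => k.+1%:R%:E * (x ^+ k * phi x)%:E)%E.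
  by apply: integrableZl => //; exact: integrable_expr_pdf.
have ig : mu.-integrable setT (EFin \o g).
  rewrite gE -[X in _.-integrable _ X]/(fun x => (x ^+ k.+2 * phi x)%:E -
    (k.+1%:R * (x ^+ k * phi x))%:E)%E.
  by apply: integrableB => //; exact: integrable_expr_pdf.
have Fodd x : F (- x) = - F x.
  rewrite /F opprK /phi normal_pdfN.
  by rewrite !exprS /k !exprM sqrrN; ring.
have := integral_derive_eq0 dF cg ig _.
have F0 : (fun n : nat => F n.+1%:R - F (- n.+1%:R)) @ \oo --> (0 : R).
  rewrite [X in X @ _ --> _](_ : _ = fun n => - 2 * (n.+1%:R ^+ k.+1 * phi n.+1%:R)).
    rewrite -[X in _ --> X](mulr0 (-2)).
    by apply: cvgM; [exact: cvg_cst|exact: expr_normal_pdf_cvg0].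
  by apply/funext => n; rewrite Fodd /F /=; ring.
move=> /(_ F0); rewrite /normal_moment !normal_prob_Rintegral//.
rewrite gE RintegralB//; last exact: integrable_expr_pdf.
rewrite RintegralZl//; last exact: integrable_expr_pdf.
by move=> /eqP; rewrite subr_eq0 => /eqP.
Qed.

Lemma normal_moment0 : normal_moment 0 = 1.
Proof.
rewrite /normal_moment (_ : (fun x : R => x ^+ 0) = cst 1); last first.
  by apply/funext => x; rewrite expr0.
by rewrite Rintegral_cst// mul1r [X in fine X]probability_setT.
Qed.

Lemma normal_moment2 : normal_moment 2 = 1.
Proof. by rewrite (normal_moment_even 0) normal_moment0 mulr1. Qed.

Lemma normal_moment4 : normal_moment 4 = 3.
Proof. by rewrite (normal_moment_even 1) normal_moment2 mulr1. Qed.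

Lemma normal_moment6 : normal_moment 6 = 15.
Proof. by rewrite (normal_moment_even 2) normal_moment4 -natrM. Qed.

Lemma normal_moment1 : normal_moment 1 = 0.
Proof.
pose g (x : R) := x * normal_pdf 0 1 x.
have i1 := @integrable_expr_pdf 1.
have dF x : is_derive x (1 : R) (fun x => - normal_pdf 0 1 x) (g x).
  apply: (is_derive_eq (is_deriveN (is_derive_normal_pdf x))).
  by rewrite /g mulNr opprK.
have cg : continuous g.
  move=> x; apply: cvgM; first exact: cvg_id.
  by apply: continuous_normal_pdf; rewrite oner_neq0.
have := integral_derive_eq0 dF cg i1 _.
under eq_fun do rewrite normal_pdfN subrr.
by move=> /(_ (cvg_cst _)) <-; rewrite /normal_moment normal_prob_Rintegral.
Qed.

End normal_moments.

(** * The central limit theorem *)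

Section integrable_EFin.
Context d (T : measurableType d) (R : realType) (mu : {measure set T -> \bar R}).
Variables (D : set T) (mD : measurable D).
Implicit Types f g : T -> R.

Lemma integrableD_EFin f g : mu.-integrable D (EFin \o f) ->
  mu.-integrable D (EFin \o g) -> mu.-integrable D (EFin \o (fun x => f x + g x)).
Proof.
move=> fi gi; rewrite -[X in _.-integrable _ X]/((EFin \o f) \+ (EFin \o g))%E.
exact: integrableD.
Qed.

Lemma integrableB_EFin f g : mu.-integrable D (EFin \o f) ->
  mu.-integrable D (EFin \o g) -> mu.-integrable D (EFin \o (fun x => f x - g x)).
Proof.
move=> fi gi; rewrite -[X in _.-integrable _ X]/(fun x => (EFin \o f) x - (EFin \o g) x)%E.
exact: integrableB.
Qed.

Lemma integrableZl_EFin (k : R) f : mu.-integrable D (EFin \o f) ->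
  mu.-integrable D (EFin \o (fun x => k * f x)).
Proof.
move=> fi; rewrite -[X in _.-integrable _ X]/(fun x => k%:E * (EFin \o f) x)%E.
exact: integrableZl.
Qed.

Lemma integrable_sum_EFin (I : Type) (s : seq I) (Q : pred I) (h : I -> T -> R) :
  (forall i, Q i -> mu.-integrable D (EFin \o h i)) ->
  mu.-integrable D (EFin \o (fun x => \sum_(i <- s | Q i) h i x)).
Proof.
move=> ih; have := @integrable_sum _ _ _ mu D mD I s Q (fun i => EFin \o h i) ih.
by apply: eq_integrable => // x _ /=; rewrite sumEFin.
Qed.

Lemma Rintegral_sum (I : Type) (s : seq I) (Q : pred I) (h : I -> T -> R) :
  (forall i, Q i -> mu.-integrable D (EFin \o h i)) ->
  \int[mu]_(x in D) (\sum_(i <- s | Q i) h i x) =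
  \sum_(i <- s | Q i) \int[mu]_(x in D) h i x.
Proof.
move=> ih; elim: s => [|i s IH].
  rewrite big_nil; under eq_Rintegral do rewrite big_nil.
  by rewrite Rintegral_cst// mul0r.
under eq_Rintegral do rewrite big_cons.
rewrite big_cons; case: ifPn => [Qi|_]; last exact: IH.
by rewrite RintegralD ?IH//; [exact: ih|exact: integrable_sum_EFin].
Qed.

End integrable_EFin.

Section independent_pair.
Context d (T : measurableType d) (R : realType) (P : probability T R).
Variables (S X : T -> R).
Hypotheses (mS : measurable_fun setT S) (mX : measurable_fun setT X).
Hypothesis indep : forall A B : set R, measurable A -> measurable B ->
  P (S @^-1` A `&` X @^-1` B) = (P (S @^-1` A) * P (X @^-1` B))%E.

(** By uniqueness on rectangles, the law of the pair [(S, X)] is the product of the two laws, and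
    Tonelli's theorem applies. *)
Lemma ge0_integral_indep (f : R * R -> \bar R) : measurable_fun setT f ->
  (forall x, 0 <= f x)%E ->
  (\int[P]_w f (S w, X w) = \int[P]_w \int[P]_w' f (S w, X w'))%E.
Proof.
move=> mf f0.
have mSX : measurable_fun setT (fun w => (S w, X w)).
  exact: measurable_fun_pair.
pose S' : {RV P >-> R} := mfun_Sub (mem_set mS).
pose X' : {RV P >-> R} := mfun_Sub (mem_set mX).
pose SX : {RV P >-> (R * R)%type} := mfun_Sub (mem_set mSX).
have E A : measurable A ->
    (distribution P S' \x distribution P X')%E A = distribution P SX A.
  apply: product_measure_unique => {}A B mA mB.
  by rewrite /distribution /pushforward /= -indep//; congr (P _).
rewrite -(ge0_integral_distribution SX mf f0).
rewrite (eq_measure_integral (distribution P S' \x distribution P X')%E); last first.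
  by move=> A mA _; exact/esym/E.
rewrite (fubini_tonelli1 _ mf f0) /fubini_F.
rewrite ge0_integral_distribution//; last 2 first.
- exact: (measurable_fun_fubini_tonelli_F (m2 := distribution P X') _ mf).
- by move=> x; exact: integral_ge0.
apply: eq_integral => w _ /=; rewrite ge0_integral_distribution//.
exact: measurableT_comp.
Qed.

End independent_pair.

Section taylor.
Context d (T : measurableType d) (R : realType) (P : probability T R).

Lemma integrable_le3 (X : T -> R) k : measurable_fun setT X -> (k <= 3)%N ->
  P.-integrable setT (EFin \o (fun w => `|X w| ^+ 3)) ->
  P.-integrable setT (EFin \o (fun w => X w ^+ k)).
Proof.
move=> mX k3 i3.
have i : P.-integrable setT (fun w => (1 + `|X w| ^+ 3)%:E).
  under eq_fun do rewrite EFinD.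
  by apply: integrableD => //; exact: (finite_measure_integrable_cst P 1).
apply: (le_integrable _ _ _ i) => //.
- by apply/measurable_EFinP; exact: measurable_funX.
- move=> w _; rewrite /= lee_fin normrX [leRHS]ger0_norm ?addr_ge0 ?exprn_ge0//.
  set y : R := `|X w|; have y0 : 0 <= y by exact: normr_ge0.
  have [y1|y1] := leP y 1.
    by apply: (@le_trans _ _ 1); [exact: exprn_ile1|rewrite lerDl exprn_ge0].
  by rewrite (le_trans (ler_weXn2l (ltW y1) k3))// lerDr.
Qed.

(** The approximate value depends on the law of [X] only through its variance. A summand and a
    normal variable of the same variance can therefore be exchanged at the cost of their third
    moments. *)
Lemma Rintegral_taylor (g : R -> R) (X : T -> R) (x a b K v : R) :
  measurable_fun setT g -> (forall y, 0 <= g y <= 1) ->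
  (forall y, `|g (x + y) - g x - a * y - b * y ^+ 2| <= K * `|y| ^+ 3) ->
  measurable_fun setT X ->
  P.-integrable setT (EFin \o (fun w => `|X w| ^+ 3)) ->
  \int[P]_w X w = 0 -> \int[P]_w (X w ^+ 2) = v ->
  `|\int[P]_w g (x + X w) - (g x + b * v)| <= K * \int[P]_w (`|X w| ^+ 3).
Proof.
move=> mg g01 taylor mX i3 EX EX2.
have i1 : P.-integrable setT (EFin \o X).
  have := integrable_le3 (k := 1) mX isT i3.
  by apply: eq_integrable => // w _ /=; rewrite expr1.
have i2 := integrable_le3 (k := 2) mX isT i3.
have mgX : measurable_fun setT (fun w => g (x + X w)).
  by apply: measurableT_comp => //; exact: measurable_funD.
have ig : P.-integrable setT (EFin \o (fun w => g (x + X w))).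
  apply: measurable_bounded_integrable => //.
    by rewrite [X in (X < _)%E]probability_setT ltry.
  exists 1; split => // M M1 w _ /=.
  by have /andP[g0 g1] := g01 (x + X w); rewrite ger0_norm// (le_trans g1)// ltW.
have ic : P.-integrable setT (EFin \o (fun=> g x)) by exact: finite_measure_integrable_cst.
have iaX : P.-integrable setT (EFin \o (fun w => a * X w)).
  exact: integrableZl_EFin.
have ibX : P.-integrable setT (EFin \o (fun w => b * X w ^+ 2)).
  exact: integrableZl_EFin.
have iB1 : P.-integrable setT (EFin \o (fun w => g (x + X w) - g x)).
  exact: integrableB_EFin.
have iB2 : P.-integrable setT (EFin \o (fun w => g (x + X w) - g x - a * X w)).
  exact: integrableB_EFin.
have iB3 : P.-integrable setT (EFin \o (fun w => g (x + X w) - g x - a * X w - b * X w ^+ 2)).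
  exact: integrableB_EFin.
have <- : \int[P]_w (g (x + X w) - g x - a * X w - b * X w ^+ 2) =
    \int[P]_w g (x + X w) - (g x + b * v).
  rewrite !RintegralB// !RintegralZl// EX EX2 Rintegral_cst//.
  by rewrite [X in fine X]probability_setT mulr1 mulr0 subr0 opprD addrA.
apply: (le_trans (le_normr_Rintegral _ iB3)) => //.
rewrite -RintegralZl//; apply: le_Rintegral => //.
- exact: integrable_norm.
- exact: integrableZl_EFin.
Qed.

End taylor.

(** * A smooth step function *)

Section spline.
Context {R : realType}.
Implicit Types x y : R.

Definition cube_pos x : R := Num.max x 0 ^+ 3.

(** The coefficients are the first derivative of the truncated cube and half of the second one. The
    constant is 1 because the third derivative takes only the values 0 and 6, and [6 / 3! = 1]. *)
Lemma cube_pos_taylor x y :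
  `|cube_pos (x + y) - cube_pos x - 3 * Num.max x 0 ^+ 2 * y
    - 3 * Num.max x 0 * y ^+ 2| <= `|y| ^+ 3.
Proof.
rewrite /cube_pos; have [x0|x0] := leP x 0.
  rewrite expr0n /= expr0n/= !mulr0 !mul0r !subr0.
  have [xy|xy] := leP (x + y) 0; first by rewrite expr0n/= normr0 exprn_ge0.
  have y0 : 0 < y by lra.
  rewrite (gtr0_norm y0) ger0_norm ?exprn_ge0 ?(ltW xy)//.
  by rewrite lerXn2r ?nnegrE ?(ltW xy) ?(ltW y0)//; lra.
have [xy|xy] := leP (x + y) 0; last first.
  rewrite -normrX (_ : (x + y) ^+ 3 - _ - _ - _ = y ^+ 3)//; ring.
have y0 : y < 0 by lra.
rewrite -normrX.
have -> : 0 ^+ 3 - x ^+ 3 - 3 * x ^+ 2 * y - 3 * x * y ^+ 2 = - ((x + y) ^+ 3 - y ^+ 3) by ring.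
rewrite normrN -[leRHS]normrN.
have h1 : (x + y) ^+ 3 <= 0 by rewrite exprS mulr_le0_ge0 ?sqr_ge0.
have h2 : y ^+ 3 <= (x + y) ^+ 3.
  rewrite -subr_ge0 (_ : _ - _ = x * (3 * y ^+ 2 + 3 * x * y + x ^+ 2)); last by ring.
  by apply: mulr_ge0; [lra|nra].
by rewrite ger0_norm ?subr_ge0// ger0_norm; lra.
Qed.

(* A step from 0 to 1 with a Lipschitz second derivative, as Lindeberg's
   method requires. *)
Definition spline x : R :=
  6^-1 * (cube_pos x - 3 * cube_pos (x - 1) + 3 * cube_pos (x - 2) - cube_pos (x - 3)).

Lemma spline_le0 x : x <= 0 -> spline x = 0.
Proof.
move=> x0; rewrite /spline /cube_pos !max_r; [|lra..].
by rewrite expr0n /= !mulr0 !subr0 addr0 mulr0.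
Qed.

Lemma spline_ge3 x : 3 <= x -> spline x = 1.
Proof. by move=> x3; rewrite /spline /cube_pos !max_l; [field|lra..]. Qed.

(** The spline is the distribution function of a sum of three independent uniform variables on
    [[0, 1]]. The bounds are checked on each unit interval; on the last one the spline equals
    [1 - (3 - x)^3 / 6]. *)
Lemma spline_ge0_le1 x : 0 <= spline x <= 1.
Proof.
have [x0|x0] := leP x 0; first by rewrite spline_le0// lexx ler01.
have [x3|x3] := leP 3 x; first by rewrite spline_ge3// lexx ler01.
rewrite /spline /cube_pos (max_l (ltW x0)) (max_r (_ : x - 3 <= 0)); last lra.
rewrite !exprS !expr0 !mulr1.
have [x1|x1] := leP (x - 1) 0.
  have [x2|x2] := leP (x - 2) 0; last lra.
  have : 0 <= x * x * x by rewrite !mulr_ge0// ltW.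
  have : x * x <= 1 by nra.
  by move=> ? ?; apply/andP; split; nra.
have [x2|x2] := leP (x - 2) 0.
  pose u := x - 1; have xu : x = u + 1 by rewrite /u; lra.
  have u0 : 0 < u by rewrite /u.
  have u1 : u <= 1 by rewrite /u; lra.
  rewrite xu addrK.
  have u2 : u * u <= u by nra.
  have u3 : 0 <= u * u * u by rewrite !mulr_ge0// ltW.
  have u4 : u * u * u <= u * u by rewrite ger_pMr// mulr_gt0.
  have u5 : 0 <= u * u by rewrite mulr_ge0// ltW.
  by apply/andP; split; nra.
pose u := 3 - x; have xu : x = 3 - u by rewrite /u; lra.
have u0 : 0 < u by rewrite /u; lra.
have u1 : u <= 1 by rewrite /u; lra.
have u3 : 0 <= u * u * u by rewrite !mulr_ge0// ltW.
have u4 : u * u * u <= 1 by rewrite -expr2 -exprSr exprn_ile1// ltW.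
rewrite (_ : 6^-1 * _ = 1 - 6^-1 * (u * u * u)); first by apply/andP; split; lra.
by rewrite xu; field.
Qed.

Lemma continuous_cube_pos : continuous cube_pos.
Proof.
move=> x; apply: (continuous_comp (f := fun x => Num.max x 0) (g := fun x => x ^+ 3)).
  by apply: continuous_max; [exact: cvg_id|exact: cvg_cst].
exact: exprn_continuous.
Qed.

Lemma continuous_spline : continuous spline.
Proof.
have c s : continuous (fun x => cube_pos (x - s)).
  move=> x; apply: (continuous_comp (f := fun x => x - s)); last exact: continuous_cube_pos.
  by apply: cvgB; [exact: cvg_id|exact: cvg_cst].
move=> x; apply: cvgM; first exact: cvg_cst.
apply: cvgB; last exact: c.
apply: cvgD; last by apply: cvgM; [exact: cvg_cst|exact: c].
by apply: cvgB; [exact: continuous_cube_pos|apply: cvgM; [exact: cvg_cst|exact: c]].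
Qed.

(** The four truncated cubes contribute errors with total weight [(1 + 3 + 3 + 1) / 6 = 4/3],
    rounded up to 2. The affine argument allows for any threshold and any steepness. *)
Lemma spline_taylor p q x : exists a b, forall y,
  `|spline (p + q * (x + y)) - spline (p + q * x) - a * y - b * y ^+ 2|
    <= 2 * `|q| ^+ 3 * `|y| ^+ 3.
Proof.
pose u := p + q * x.
pose c1 s := 3 * Num.max (u - s) 0 ^+ 2 : R.
pose c2 s := 3 * Num.max (u - s) 0 : R.
exists (6^-1 * (c1 0 - 3 * c1 1 + 3 * c1 2 - c1 3) * q),
       (6^-1 * (c2 0 - 3 * c2 1 + 3 * c2 2 - c2 3) * q ^+ 2) => y.
have -> : p + q * (x + y) = u + q * y by rewrite /u mulrDr addrA.
have h s := cube_pos_taylor (u - s) (q * y).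
have -> : 2 * `|q| ^+ 3 * `|y| ^+ 3 = 2 * `|q * y| ^+ 3 :> R by rewrite normrM; ring.
rewrite -/u.
have := h 0; have := h 1; have := h 2; have := h 3.
rewrite !subr0 -/(c1 1) -/(c1 2) -/(c1 3) -/(c2 1) -/(c2 2) -/(c2 3).
have -> : Num.max u 0 = Num.max (u - 0) 0 by rewrite subr0.
rewrite -/(c1 0) -/(c2 0).
have e s : u - s + q * y = u + q * y - s by lra.
rewrite !e.
rewrite !ler_norml => /andP[? ?] /andP[? ?] /andP[? ?] /andP[? ?].
rewrite /spline; apply/andP; split; lra.
Qed.

End spline.

Section lindeberg_step.
Context d (T : measurableType d) (R : realType) (P : probability T R).

Lemma ge0_le_integralD_cst (f g : T -> \bar R) (delta : R) :
  measurable_fun setT f -> measurable_fun setT g ->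
  (forall x, 0 <= f x)%E -> (forall x, 0 <= g x)%E -> 0 <= delta ->
  (forall x, f x <= g x + delta%:E)%E ->
  (\int[P]_x f x <= \int[P]_x g x + delta%:E)%E.
Proof.
move=> mf mg f0 g0 d0 fg.
apply: (@le_trans _ _ (\int[P]_x (g x + cst delta%:E x))%E).
  apply: ge0_le_integral => //; last exact: emeasurable_funD.
by rewrite ge0_integralD// integral_cst// [X in (_ * X)%E]probability_setT mule1.
Qed.

Lemma measurable_integral_shift (g : R -> \bar R) (X : T -> R) :
  measurable_fun setT g -> (forall x, 0 <= g x)%E -> measurable_fun setT X ->
  measurable_fun setT (fun x : R => \int[P]_w g (x + X w)%R)%E.
Proof.
move=> mg g0 mX.
have mF : measurable_fun setT (fun z : R * T => g (z.1 + X z.2)).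
  apply: measurableT_comp => //; apply: measurable_funD => //.
  exact: measurableT_comp.
by apply: (measurable_fun_fubini_tonelli_F (m2 := P) _ mF) => x.
Qed.

End lindeberg_step.

(** Pairs of inequalities replace differences, so that no intermediate term has to be shown
    finite. *)
Lemma ereal_telescope_close (R : realType) (a : nat -> \bar R) (D : nat -> R) N :
  (forall k, (k < N)%N -> (a k.+1 <= a k + (D k)%:E)%E /\ (a k <= a k.+1 + (D k)%:E)%E) ->
  forall j, (j <= N)%N -> (a j <= a 0%N + (\sum_(k < j) D k)%:E)%E /\
    (a 0%N <= a j + (\sum_(k < j) D k)%:E)%E.
Proof.
move=> aD; elim=> [_|j IH jN]; first by rewrite big_ord0 adde0.
have [h1 h2] := IH (ltnW jN); have [h3 h4] := aD _ jN.
rewrite big_ord_recr /= EFinD; split.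
  by rewrite addeA; apply: (le_trans h3); exact: leeD2r.
by rewrite addeCA addeC; apply: (le_trans h2); rewrite leeD2r// addeC.
Qed.

Section lindeberg.
Context d (T : measurableType d) (R : realType) (P : probability T R).
Local Notation N01 := (@normal_prob R 0 1).
Variables (X : nat -> T -> R) (v : nat -> R).
Hypothesis mX : forall k, measurable_fun setT (X k).
Hypothesis v0 : forall k, 0 < v k.
Hypothesis EX : forall k, \int[P]_w X k w = 0.
Hypothesis EX2 : forall k, \int[P]_w (X k w ^+ 2) = v k.
Hypothesis iX3 : forall k, P.-integrable setT (EFin \o (fun w => `|X k w| ^+ 3)).
Let S k w := \sum_(i < k) X i w.
Hypothesis indep : forall k (A B : set R), measurable A -> measurable B ->
  P (S k @^-1` A `&` X k @^-1` B) = (P (S k @^-1` A) * P (X k @^-1` B))%E.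

Variables (g : R -> R) (K : R).
Hypothesis cg : continuous g.
Hypothesis g01 : forall x, 0 <= g x <= 1.
Hypothesis taylor : forall x, exists a b, forall y,
  `|g (x + y) - g x - a * y - b * y ^+ 2| <= K * `|y| ^+ 3.

Let delta k := K * \int[P]_w (`|X k w| ^+ 3) +
  K * (Num.sqrt (v k) ^+ 3 * \int[N01]_z (`|z| ^+ 3)).

Let mg : measurable_fun setT g.
Proof. exact: continuous_measurable_fun. Qed.

Lemma normal_replacement k x :
  `|\int[P]_w g (x + X k w) - \int[N01]_z g (x + Num.sqrt (v k) * z)| <= delta k.
Proof.
have [a [b h]] := taylor x.
have h1 := Rintegral_taylor mg g01 h (mX k) (iX3 k) (EX k) (EX2 k).
have msz : measurable_fun setT (fun z : R => Num.sqrt (v k) * z).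
  exact: measurable_funM.
have E3 : (fun z : R => `|Num.sqrt (v k) * z| ^+ 3) =
   fun z => Num.sqrt (v k) ^+ 3 * `|z| ^+ 3.
  by apply/funext => z; rewrite normrM (ger0_norm (sqrtr_ge0 _)) exprMn.
have iz3 : N01.-integrable setT (EFin \o (fun z : R => `|Num.sqrt (v k) * z| ^+ 3)).
  by rewrite E3; apply: integrableZl_EFin => //; exact: integrable_normr_normal.
have Ez : (\int[N01]_z (Num.sqrt (v k) * z))%R = 0.
  rewrite RintegralZl//; last by have := @integrable_expr_normal R 1.
  have := @normal_moment1 R; rewrite /normal_moment.
  by under eq_Rintegral do rewrite expr1; move=> ->; rewrite mulr0.
have Ez2 : (\int[N01]_z ((Num.sqrt (v k) * z) ^+ 2))%R = v k.
  under eq_Rintegral do rewrite exprMn.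
  rewrite RintegralZl//; last exact: integrable_expr_normal.
  by rewrite [X in _ * X]normal_moment2 mulr1 sqr_sqrtr// ltW.
have := Rintegral_taylor (P := N01) mg g01 h msz iz3 Ez Ez2.
rewrite E3 RintegralZl//; last exact: integrable_normr_normal.
move: h1; rewrite !ler_norml /delta => /andP[? ?] /andP[? ?].
by apply/andP; split; lra.
Qed.

Let integrable_g (x : R) d' (T' : measurableType d') (Q : probability T' R) (Y : T' -> R) :
  measurable_fun setT Y -> Q.-integrable setT (EFin \o (fun w => g (x + Y w))).
Proof.
move=> mY; apply: measurable_bounded_integrable => //.
- by rewrite [X in (X < _)%E]probability_setT ltry.
- by apply: measurableT_comp => //; exact: measurable_funD.
- exists 1; split => // M M1 w _ /=.
  by have /andP[g0 g1] := g01 (x + Y w); rewrite ger0_norm// (le_trans g1)// ltW.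
Qed.

Let g0 x : (0 <= (g x)%:E)%E.
Proof. by rewrite lee_fin; case/andP: (g01 x). Qed.

Let delta_ge0 k : 0 <= delta k.
Proof. exact: (le_trans (normr_ge0 _) (normal_replacement k 0)). Qed.

(** [A N k] is the hybrid expectation in which the first [k] summands are kept and all the others
    are merged into one independent normal variable carrying the remaining variance. This variable
    lives in a separate integral, so no normal sequence has to be constructed on [T]. The operator
    [smooth] integrates out what remains after step [k]. *)
Let tau N k := Num.sqrt (\sum_(k <= i < N) v i).
Let A N k := (\int[P]_w \int[N01]_z (g (S k w + tau N k * z)%R)%:E)%E.
Let G1 k (x : R) := (\int[P]_w (g (x + X k w)%R)%:E)%E.
Let G2 k (x : R) := (\int[N01]_z (g (x + Num.sqrt (v k) * z)%R)%:E)%E.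
Let smooth N k (F : R -> \bar R) x := (\int[N01]_z (F (x + tau N k.+1 * z)%R))%E.

Let mG1 k : measurable_fun setT (G1 k).
Proof. by apply: (measurable_integral_shift P (g := EFin \o g)) => //; exact/measurable_EFinP. Qed.

Let mG2 k : measurable_fun setT (G2 k).
Proof.
apply: (measurable_integral_shift N01 (g := EFin \o g) (X := fun z => Num.sqrt (v k) * z)) => //.
- exact/measurable_EFinP.
- exact: measurable_funM.
Qed.

Let G10 k x : (0 <= G1 k x)%E. Proof. exact: integral_ge0. Qed.
Let G20 k x : (0 <= G2 k x)%E. Proof. exact: integral_ge0. Qed.

Let msmooth N k F : measurable_fun setT F -> (forall x, 0 <= F x)%E ->
  measurable_fun setT (smooth N k F).
Proof.
move=> mF F0.
apply: (measurable_integral_shift N01 (X := fun z => tau N k.+1 * z)) => //.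
exact: measurable_funM.
Qed.

Let G12 k x : (G1 k x <= G2 k x + (delta k)%:E)%E /\ (G2 k x <= G1 k x + (delta k)%:E)%E.
Proof.
have := normal_replacement k x.
have -> : G1 k x = (\int[P]_w g (x + X k w))%:E.
  by rewrite /Rintegral fineK//; apply: integrable_fin_num => //; exact: integrable_g.
have -> : G2 k x = (\int[N01]_z g (x + Num.sqrt (v k) * z))%:E.
  rewrite /Rintegral fineK//; apply: integrable_fin_num => //.
  by apply: (integrable_g _ N01 (Y := fun z => Num.sqrt (v k) * z)); exact: measurable_funM.
rewrite -!EFinD !lee_fin ler_norml => /andP[? ?]; split; lra.
Qed.

Let mS k : measurable_fun setT (S k).
Proof. by rewrite /S; exact: measurable_sum. Qed.

(** Independence separates [X k] from the partial sum, and Tonelli's theorem moves the normal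
    variable outside, so that [X k] is integrated first, at a frozen point. *)
Let A_succ N k : A N k.+1 = (\int[P]_w smooth N k (G1 k) (S k w))%E.
Proof.
rewrite /A /smooth.
transitivity (\int[P]_w \int[N01]_z (g (S k w + X k w + tau N k.+1 * z)%R)%:E)%E.
  apply: eq_integral => w _; apply: eq_integral => z _.
  by rewrite /S big_ord_recr.
have mh : measurable_fun setT (fun x : R * R => (\int[N01]_z (g (x.1 + x.2 + tau N k.+1 * z)%R)%:E)%E).
  have := @measurable_integral_shift _ _ _ N01 (EFin \o g) (fun z => tau N k.+1 * z) _ _ _.
  move=> /(_ _ _ _) mm.
  apply: (measurableT_comp (mm _ _ _)) => //.
  - exact/measurable_EFinP.
  - exact: measurable_funM.
  - exact: measurable_funD.
rewrite (ge0_integral_indep (mS k) (mX k) (indep k) mh); last first.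
  by move=> x; exact: integral_ge0.
apply: eq_integral => w _ /=.
rewrite (fubini_tonelli (m1 := P) (m2 := N01)
  (fun x : T * R => (g (S k w + X k x.1 + tau N k.+1 * x.2)%R)%:E))//=; last first.
  apply/measurable_EFinP/measurableT_comp => //; apply: measurable_funD.
    by apply: measurable_funD => //; exact: measurableT_comp.
  exact: measurable_funM.
apply: eq_integral => z _; rewrite /G1; apply: eq_integral => w' _.
by rewrite addrAC.
Qed.

(** The convolution identity splits the merged normal variable into a part of variance [v k] and the
    rest. The result differs from the expression of [A N k.+1] only by [G2] in place of [G1]. *)
Let A_eq N k : (k < N)%N -> A N k = (\int[P]_w smooth N k (G2 k) (S k w))%E.
Proof.
move=> kN; apply: eq_integral => w _; rewrite /smooth /G2.
have sv : 0 < Num.sqrt (v k) by rewrite sqrtr_gt0.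
have s0 : 0 <= \sum_(k.+1 <= i < N) v i by rewrite sumr_ge0// => i _; rewrite ltW.
have E : tau N k = Num.sqrt (tau N k.+1 ^+ 2 + Num.sqrt (v k) ^+ 2).
  by rewrite /tau big_ltn// !sqr_sqrtr ?(ltW (v0 k))// addrC.
(* The convolution identity asks for positive deviations; nothing remains after the last step
   [k.+1 = N], which is handled apart. *)
rewrite E; have [t0|] := ltP 0 (tau N k.+1).
  by rewrite (ge0_integral_normal_conv _ t0 sv)//; move=> x; case/andP: (g01 x).
rewrite le_eqVlt ltNge sqrtr_ge0 orbF => /eqP ->.
rewrite expr0n/= add0r sqrtr_sqr ger0_norm ?sqrtr_ge0//.
under [RHS]eq_integral do rewrite mul0r addr0.
by rewrite integral_cst// [X in (_ * X)%E]probability_setT mule1.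
Qed.

Let A_close N k : (k < N)%N ->
  (A N k.+1 <= A N k + (delta k)%:E)%E /\ (A N k <= A N k.+1 + (delta k)%:E)%E.
Proof.
move=> kN; rewrite A_succ (A_eq kN).
have ge0 F : (forall x, 0 <= F x)%E -> forall x, (0 <= smooth N k F x)%E.
  by move=> F0 x; exact: integral_ge0.
split; apply: ge0_le_integralD_cst => //.
- by apply: measurableT_comp => //; exact: msmooth.
- by apply: measurableT_comp => //; exact: msmooth.
- by move=> w; exact: ge0.
- by move=> w; exact: ge0.
- move=> w; apply: ge0_le_integralD_cst => //.
  + by apply: measurableT_comp => //; apply: measurable_funD => //; exact: measurable_funM.
  + by apply: measurableT_comp => //; apply: measurable_funD => //; exact: measurable_funM.
  + by move=> z; exact: (G12 _ _).1.
- by apply: measurableT_comp => //; exact: msmooth.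
- by apply: measurableT_comp => //; exact: msmooth.
- by move=> w; exact: ge0.
- by move=> w; exact: ge0.
- move=> w; apply: ge0_le_integralD_cst => //.
  + by apply: measurableT_comp => //; apply: measurable_funD => //; exact: measurable_funM.
  + by apply: measurableT_comp => //; apply: measurable_funD => //; exact: measurable_funM.
  + by move=> z; exact: (G12 _ _).2.
Qed.

(** The hybrid at [k = N] has no normal part, the one at [k = 0] has no summand, and the errors of
    the [N] exchanges add up. *)
Lemma lindeberg N :
  `|\int[P]_w g (\sum_(i < N) X i w)
    - \int[N01]_z g (Num.sqrt (\sum_(i < N) v i) * z)|
  <= \sum_(k < N) (K * \int[P]_w (`|X k w| ^+ 3) +
       K * (Num.sqrt (v k) ^+ 3 * \int[N01]_z (`|z| ^+ 3))).
Proof.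
have AN : A N N = (\int[P]_w g (S N w))%:E.
  rewrite /Rintegral fineK; last first.
    apply: integrable_fin_num => //.
    apply: eq_integrable (integrable_g 0 P (mS N)) => // w _.
    by rewrite /= add0r.
  apply: eq_integral => w _; rewrite /tau big_geq// sqrtr0.
  under eq_integral do rewrite mul0r addr0.
  by rewrite integral_cst// [X in (_ * X)%E]probability_setT mule1.
have A0 : A N 0 = (\int[N01]_z g (Num.sqrt (\sum_(i < N) v i) * z))%:E.
  rewrite /Rintegral fineK; last first.
    apply: integrable_fin_num => //.
    have mz : measurable_fun setT (fun z : R => Num.sqrt (\sum_(i < N) v i) * z).
      exact: measurable_funM.
    by apply: eq_integrable (integrable_g 0 N01 mz) => // z _; rewrite /= add0r.
  transitivity (\int[P]_w cst (\int[N01]_z (g (Num.sqrt (\sum_(i < N) v i) * z)%R)%:E)%E w)%E.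
    apply: eq_integral => w _; apply: eq_integral => z _.
    by rewrite /S big_ord0 add0r /tau big_mkord.
  by rewrite integral_cst// [X in (_ * X)%E]probability_setT mule1.
have [] := ereal_telescope_close (A_close (N := N)) (leqnn N).
rewrite AN A0 -!EFinD !lee_fin -/delta => h1 h2.
by rewrite ler_distl lerBlDr; apply/andP; split; [exact: h2|exact: h1].
Qed.

End lindeberg.

(** * From smooth test functions to distribution functions *)

Section spline_sandwich.
Context d (T : measurableType d) (R : realType) (P : probability T R).

Lemma fine_probabilityK (A : set T) : measurable A -> (fine (P A))%:E = P A.
Proof. by move=> mA; rewrite fineK// fin_num_measure. Qed.

(** The spline rises from 0 at 0 to 1 at 3, so its composite with [3 / h * (x + h - U)] is 1 where
    [U <= x] and 0 where [U >= x + h]. *)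
Lemma Rintegral_spline_sandwich (U : T -> R) (h x : R) : measurable_fun setT U -> 0 < h ->
  fine (P [set w | U w <= x]) <= \int[P]_w spline (3 / h * (x + h) - 3 / h * U w)
    <= fine (P [set w | U w <= x + h]).
Proof.
move=> mU h0.
have mle y : measurable [set w | U w <= y].
  rewrite -[X in measurable X]setTI [X in _ `&` X](_ : _ = U @^-1` `]-oo, y]); last first.
    by apply/seteqP; split => w /=; rewrite in_itv.
  exact: mU.
have EP y : fine (P [set w | U w <= y]) = \int[P]_w (\1_[set w | U w <= y] w).
  by rewrite /Rintegral integral_indic// setIT.
have i1 y : P.-integrable setT (EFin \o (\1_[set w | U w <= y] : T -> R)).
  exact: integrable_indic.
have isp : P.-integrable setT (EFin \o (fun w => spline (3 / h * (x + h) - 3 / h * U w))).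
  apply: measurable_bounded_integrable => //.
  - by rewrite [X in (X < _)%E]probability_setT ltry.
  - apply: measurableT_comp; first exact: continuous_measurable_fun continuous_spline.
    by apply: measurable_funB => //; exact: measurable_funM.
  - exists 1; split => // M M1 w _ /=.
    have /andP[g0 g1] := spline_ge0_le1 (3 / h * (x + h) - 3 / h * U w).
    by rewrite ger0_norm// (le_trans g1)// ltW.
have h3 : 0 < 3 / h by rewrite divr_gt0.
have h31 : 3 / h * h = 3 by rewrite divfK// gt_eqF.
rewrite !EP; apply/andP; split; apply: le_Rintegral => // w _.
- rewrite indicE; case: (boolP (w \in _)) => [|_]; last by case/andP: (spline_ge0_le1 (3 / h * (x + h) - 3 / h * U w)).
  rewrite inE /= => Uw; rewrite spline_ge3//.
  have : 0 <= 3 / h * (x - U w) by rewrite mulr_ge0 ?subr_ge0// ltW.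
  by move: h31; rewrite !mulrDr mulrN; lra.
- rewrite indicE; case: (boolP (w \in _)) => [_|]; first by case/andP: (spline_ge0_le1 (3 / h * (x + h) - 3 / h * U w)).
  rewrite notin_setE /= => /negP; rewrite -ltNge => Uw; rewrite spline_le0//.
  have : 0 <= 3 / h * (U w - (x + h)) by rewrite mulr_ge0 ?subr_ge0// ltW.
  by rewrite mulrBr; lra.
Qed.

End spline_sandwich.

Section clt.
Context d (T : measurableType d) (R : realType) (P : probability T R).
Local Notation N01 := (@normal_prob R 0 1).
Variables (X : nat -> T -> R) (v : nat -> R) (c C M : R).
Hypothesis mX : forall k, measurable_fun setT (X k).
Hypothesis c0 : 0 < c.
Hypothesis vcC : forall k, c <= v k <= C.
Hypothesis EX : forall k, \int[P]_w X k w = 0.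
Hypothesis EX2 : forall k, \int[P]_w (X k w ^+ 2) = v k.
Hypothesis iX3 : forall k, P.-integrable setT (EFin \o (fun w => `|X k w| ^+ 3)).
Hypothesis EX3 : forall k, \int[P]_w (`|X k w| ^+ 3) <= M.
Hypothesis indep : forall k (A B : set R), measurable A -> measurable B ->
  P ((fun w => \sum_(i < k) X i w) @^-1` A `&` X k @^-1` B) =
  (P ((fun w => \sum_(i < k) X i w)%R @^-1` A) * P (X k @^-1` B))%E.

Let v0 k : 0 < v k.
Proof. by case/andP: (vcC k) => cv _; exact: lt_le_trans cv. Qed.

Let V N := \sum_(i < N) v i.
Let U N w := (\sum_(i < N) X i w) / Num.sqrt (V N).

Let mU N : measurable_fun setT (U N).
Proof.
by apply: measurable_funM => //; exact: measurable_sum.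
Qed.

Let Vc N : c * N%:R <= V N.
Proof.
rewrite /V mulr_natr -[X in c *+ X]card_ord -sumr_const.
by apply: ler_sum => i _; case/andP: (vcC i).
Qed.

Lemma cdf_normal_lipschitz (x h : R) : 0 <= h ->
  fine (N01 `]-oo, x + h]) <= fine (N01 `]-oo, x]) + normal_peak 1 * h.
Proof.
move=> h0; have xh : x <= x + h by lra.
have := @normal_prob_itv_le R 0 1 x (x + h) ltr01 xh.
rewrite -(fine_probabilityK N01)// lee_fin (addrAC x) subrr add0r => le.
have E : N01 `]-oo, x + h] = (N01 `]-oo, x] + N01 `]x, (x + h)%R])%E.
  rewrite -measureU//.
    by congr (N01 _); rewrite -itv_bndbnd_setU// bnd_simp.
  apply/seteqP; split => // y [] /=; rewrite !in_itv /= => yx /andP[xy _].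
  by move: (le_lt_trans yx xy); rewrite ltxx.
by rewrite E fineD ?fin_num_measure// lerD2l.
Qed.

(** Each of the [N] exchanges costs at most a constant times [V N ^ (-3/2)], hence [(c N)^(-3/2)],
    which explains the rate [1 / sqrt N]. The bound does not depend on [x]. *)
Lemma lindeberg_spline N (h x : R) : (0 < N)%N -> 0 < h ->
  `|\int[P]_w spline (3 / h * x - 3 / h * U N w)
    - \int[N01]_z spline (3 / h * x - 3 / h * z)| <=
  2 * (3 / h) ^+ 3 * (M + Num.sqrt C ^+ 3 * \int[N01]_z (`|z| ^+ 3))
    / Num.sqrt c ^+ 3 / Num.sqrt N%:R.
Proof.
move=> N0 h0.
have N0' : 0 < N%:R :> R by rewrite ltr0n.
have VN0 : 0 < V N by apply: lt_le_trans (Vc N); rewrite mulr_gt0.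
have sV0 : 0 < Num.sqrt (V N) by rewrite sqrtr_gt0.
(* The normalization is moved into the slope of the test function, so that the replacement is
   carried out on the raw sums. *)
pose q := - (3 / h / Num.sqrt (V N)).
have h3 : 0 < 3 / h by rewrite divr_gt0.
have q3 : `|q| = 3 / h / Num.sqrt (V N) by rewrite normrN gtr0_norm// divr_gt0.
have cg : continuous (fun s => spline (3 / h * x + q * s)).
  move=> s; apply: (continuous_comp (f := fun s => 3 / h * x + q * s)); last exact: continuous_spline.
  by apply: cvgD; [exact: cvg_cst|apply: cvgM; [exact: cvg_cst|exact: cvg_id]].
have := lindeberg mX v0 EX EX2 iX3 indep cg (fun s => spline_ge0_le1 _) (spline_taylor (3 / h * x) q) N.
have -> : \int[P]_w spline (3 / h * x + q * (\sum_(i < N) X i w)) =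
   \int[P]_w spline (3 / h * x - 3 / h * U N w).
  apply: eq_Rintegral => w _; congr (spline (_ + _)).
  by rewrite /q /U; field; rewrite !gt_eqF.
have -> : \int[N01]_z spline (3 / h * x + q * (Num.sqrt (\sum_(i < N) v i) * z)) =
   \int[N01]_z spline (3 / h * x - 3 / h * z).
  apply: eq_Rintegral => z _; congr (spline (_ + _)).
  by rewrite /q -/(V N); field; rewrite !gt_eqF.
move=> /le_trans; apply.
set m3 := \int[N01]_z (`|z| ^+ 3); set D := M + _.
have m30 : 0 <= m3 by apply: Rintegral_ge0 => z _; exact: exprn_ge0.
apply: (@le_trans _ _ (\sum_(k < N) (2 * `|q| ^+ 3 * D))).
  apply: ler_sum => k _; rewrite -mulrDr ler_wpM2l ?mulr_ge0 ?exprn_ge0//.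
  rewrite lerD// ler_wpM2r// lerXn2r ?nnegrE ?sqrtr_ge0// ler_wsqrtr//.
  by case/andP: (vcC k).
rewrite sumr_const card_ord q3 expr_div_n -[leLHS]mulr_natr.
have D0 : 0 <= D.
  rewrite addr_ge0 ?mulr_ge0 ?exprn_ge0 ?sqrtr_ge0//.
  by apply: le_trans (EX3 0); apply: Rintegral_ge0 => z _; exact: exprn_ge0.
have sN0 : 0 < Num.sqrt N%:R :> R by rewrite sqrtr_gt0.
have sc0 : 0 < Num.sqrt c by rewrite sqrtr_gt0.
have sNN : Num.sqrt N%:R ^+ 2 = N%:R :> R by rewrite sqr_sqrtr// ltW.
have le3 : Num.sqrt c ^+ 3 * Num.sqrt N%:R ^+ 3 <= Num.sqrt (V N) ^+ 3.
  rewrite -exprMn -sqrtrM ?(ltW c0)// lerXn2r ?nnegrE ?sqrtr_ge0//.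
  by rewrite ler_wsqrtr.
rewrite -[X in _ * X <= _]sNN.
set a := (3 / h) ^+ 3; have a0 : 0 <= a by rewrite exprn_ge0// ltW.
rewrite (_ : 2 * a * D / Num.sqrt c ^+ 3 / Num.sqrt N%:R =
  2 * (a / (Num.sqrt c ^+ 3 * Num.sqrt N%:R ^+ 3)) * D * Num.sqrt N%:R ^+ 2); last first.
  by field; rewrite !gt_eqF.
rewrite ler_wpM2r ?exprn_ge0 ?sqrtr_ge0// ler_wpM2r// ler_wpM2l// ler_wpM2l//.
by rewrite lef_pV2 ?posrE ?mulr_gt0 ?exprn_gt0.
Qed.

(** Half of [eps] pays for the growth of the normal distribution function over the smoothing width
    [h], the other half for the replacement error once [N] is large. Neither depends on [x]. *)
Theorem clt (eps : R) : 0 < eps -> exists N0, forall N, (N0 <= N)%N -> forall x : R,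
  `|fine (P [set w | U N w <= x]) - fine (N01 `]-oo, x])| <= eps.
Proof.
move=> e0.
pose pk : R := normal_peak 1.
have pk0 : 0 < pk by apply: normal_peak_gt0; rewrite oner_neq0.
pose h := eps / 2 / pk.
have h0 : 0 < h by rewrite !divr_gt0.
have pkh : pk * h = eps / 2 by rewrite mulrC divfK// gt_eqF.
set B := 2 * (3 / h) ^+ 3 * (M + Num.sqrt C ^+ 3 * \int[N01]_z (`|z| ^+ 3)) / Num.sqrt c ^+ 3.
have [N0 _ HN0] := nbhs_infty_ger ((2 * `|B| / eps) ^+ 2).
exists (maxn 1 N0) => N; rewrite geq_max => /andP[N1 /HN0 /= BN] x.
have Bsmall : B / Num.sqrt N%:R <= eps / 2.
  have sN0 : 0 < Num.sqrt N%:R :> R by rewrite sqrtr_gt0 ltr0n.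
  rewrite ler_pdivrMr//.
  have : 2 * `|B| / eps <= Num.sqrt N%:R.
    rewrite -[leLHS]ger0_norm ?divr_ge0 ?mulr_ge0 ?(ltW e0)// -sqrtr_sqr.
    by rewrite ler_wsqrtr.
  rewrite ler_pdivrMr// => h1; have := ler_norm B; lra.
have mid y : `|\int[P]_w spline (3 / h * y - 3 / h * U N w)
    - \int[N01]_z spline (3 / h * y - 3 / h * z)| <= eps / 2.
  exact: le_trans (lindeberg_spline _ N1 h0) Bsmall.
have SP y := @Rintegral_spline_sandwich _ _ _ P (U N) h y (mU N) h0.
have SN m y := @Rintegral_spline_sandwich _ _ _ N01 (fun z : R => z) h y m h0.
have NE y : N01 `]-oo, y] = N01 [set z : R | z <= y].
  by congr (N01 _); apply/seteqP; split => z /=; rewrite in_itv.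
have NL y := @cdf_normal_lipschitz y h (ltW h0).
have mid1 := mid (x + h); have mid2 := mid x.
have /andP[sp1 sp2] := SP x; have /andP[sp3 sp4] := SP (x - h).
have mid' := @measurable_id _ (measurableTypeR R) setT.
have /andP[sn1 sn2] := SN mid' x; have /andP[sn3 sn4] := SN mid' (x - h).
have nl1 := NL x; have nl2 := NL (x - h).
move: nl1 nl2 sn1 sn2 sn3 sn4 sp1 sp2 sp3 sp4 mid1 mid2.
rewrite !NE !subrK !ler_distl -/pk pkh.
set i1 := \int[P]_w _; set i2 := \int[N01]_z _; set i3 := \int[P]_w _.
set i4 := \int[N01]_z _.
move: i1 i2 i3 i4 => i1 i2 i3 i4.
move=> nl1 nl2 sn1 sn2 sn3 sn4 sp1 sp2 sp3 sp4 /andP[a1 a2] /andP[a3 a4].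
by apply/andP; split; lra.
Qed.

End clt.

(** * Independent sequences and the strong law of large numbers *)

Section independence.
Context d (T : measurableType d) (R : realType) (P : probability T R).

(** Initial segments are enough: taking some [A i] to be the whole line recovers every finite family
    of indices. *)
Definition independent_seq (X : nat -> T -> R) :=
  forall N (A : nat -> set R), (forall i, measurable (A i)) ->
    P (\bigcap_(i < N) (X i @^-1` A i)) =
    (\prod_(i < N) fine (P (X i @^-1` A i)))%:E.

Variable X : nat -> T -> R.
Hypothesis mX : forall k, measurable_fun setT (X k).
Hypothesis indepX : independent_seq X.

Let mpre k (A : set R) : measurable A -> measurable (X k @^-1` A).
Proof. by move=> mA; rewrite -[X in measurable X]setTI; exact: mX. Qed.

(** As functions of the first event, both sides are finite measures. They agree on the cylinders
    over the first [k] variables, which are stable under intersection, hence on the sigma-algebra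
    they generate, for which the partial sum is measurable. *)
Lemma independent_seq_sum k (A B : set R) : measurable A -> measurable B ->
  P ((fun w => \sum_(i < k) X i w) @^-1` A `&` X k @^-1` B) =
  (P ((fun w => \sum_(i < k) X i w)%R @^-1` A) * P (X k @^-1` B))%E.
Proof.
move=> mA mB.
pose G := [set E : set T | exists2 F : nat -> set R, (forall i, measurable (F i)) &
  E = \bigcap_(i < k) (X i @^-1` F i)].
have mG : G `<=` measurable.
  by move=> _ [F mF ->]; rewrite bigcap_mkord; apply: bigsetI_measurable => i _; exact: mpre.
have GT : G setT.
  exists (fun=> setT) => //; rewrite (_ : (fun i => _) = fun=> setT) ?bigcapT//.
have GI : setI_closed G.
  move=> _ _ [F mF ->] [F' mF' ->]; exists (fun i => F i `&` F' i).
    by move=> i; exact: measurableI.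
  by rewrite -bigcapI.
have mXB := mpre k mB.
have p0 : (0 <= fine (P (X k @^-1` B)))%R by exact: fine_ge0.
pose m1 := mrestr P mXB.
pose m2 := mscale (NngNum p0) P.
have m12 E : <<s G >> E -> m1 E = m2 E.
  apply: (@g_sigma_algebra_measure_unique _ _ _ G mG (fun=> setT)) => //.
  - by rewrite bigcup_const.
  - move=> _ [F mF ->].
    rewrite -[LHS]/(P (\bigcap_(i < k) (X i @^-1` F i) `&` X k @^-1` B)).
    rewrite -[RHS]/((fine (P (X k @^-1` B)))%:E * P (\bigcap_(i < k) (X i @^-1` F i)))%E.
    pose F' i := if (i < k)%N then F i else B.
    have mF' i : measurable (F' i) by rewrite /F'; case: ifP.
    have -> : \bigcap_(i < k) (X i @^-1` F i) `&` X k @^-1` B =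
        \bigcap_(i < k.+1) (X i @^-1` F' i).
      apply/seteqP; split => [w [Fw Bw] i /=|w Fw]; rewrite /F'.
        by rewrite ltnS leq_eqVlt => /predU1P[->|ik]; rewrite ?ltnn// ik; exact: Fw.
      split=> [i ik|]; first by have := Fw i (ltnW ik); rewrite /F' /= ik.
      by have := Fw k (ltnSn k); rewrite /F' /= ltnn.
    rewrite indepX// big_ord_recr /= {2}/F' ltnn EFinM muleC; congr (_ * _)%E.
    rewrite indepX//; congr EFin; apply: eq_bigr => i _.
    by rewrite /F' ltn_ord.
  - move=> i; change (P ([set: T] `&` X k @^-1` B) < +oo)%E.
    by rewrite setTI (le_lt_trans (probability_le1 _ _))// ltry.
(* [T'] is [T] with the sigma-algebra generated by the cylinders; measurability on [T'] is
   membership of the preimages in it. *)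
pose T' := g_sigma_algebraType G.
have mS : measurable_fun (setT : set T') (fun w : T' => \sum_(i < k) X i w).
  apply: measurable_sum => i _ Y mY; apply: sub_sigma_algebra; rewrite setTI.
  exists (fun j => if j == i :> nat then Y else setT); first by move=> j; case: ifP.
  apply/seteqP; split => w /= => [Xw j _|/(_ _ (ltn_ord i))]; last by rewrite eqxx.
  by case: eqP => [->|].
have := m12 ((fun w => \sum_(i < k) X i w) @^-1` A).
rewrite /m1 /m2 /mrestr /mscale /= => ->.
  by rewrite muleC fineK ?fin_num_measure.
by have := mS measurableT A mA; rewrite setTI.
Qed.

End independence.

(** * Almost sure convergence from second moments *)

Section as_convergence.
Context d (T : measurableType d) (R : realType) (P : probability T R).

(** The series of the squares has a finite expectation, so it converges almost surely and its terms
    tend to 0. *)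
Lemma ae_cvg0_of_summable (X : nat -> T -> R) : (forall k, measurable_fun setT (X k)) ->
  (\sum_(0 <= k <oo) \int[P]_w (X k w ^+ 2)%:E < +oo)%E ->
  {ae P, forall w, X k w @[k --> \oo] --> (0 : R)}.
Proof.
move=> mX Xoo.
have mX2 k : measurable_fun setT (fun w => (X k w ^+ 2)%:E).
  by apply/measurable_EFinP; exact: measurable_funX.
have X20 k w : setT w -> (0 <= (X k w ^+ 2)%:E)%E by rewrite lee_fin sqr_ge0.
have i : P.-integrable setT (fun w => \sum_(0 <= k <oo) (X k w ^+ 2)%:E)%E.
  apply/integrableP; split.
    exact: (@ge0_emeasurable_sum _ _ _ setT (fun k w => (X k w ^+ 2)%:E) xpredT
      (fun k w tw _ => X20 k w tw) (fun k _ => mX2 k)).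
  rewrite (eq_integral (fun w => \sum_(0 <= k <oo) (X k w ^+ 2)%:E)%E); last first.
    by move=> w _; rewrite gee0_abs// nneseries_ge0// => k _ _; rewrite lee_fin sqr_ge0.
  by rewrite integral_nneseries.
have := integrable_ae measurableT i; apply: filterS => w /(_ Logic.I) fin.
have sm : cvgn (series (fun k => X k w ^+ 2)).
  apply: nondecreasing_is_cvgn.
    by apply: nondecreasing_series => k _; rewrite sqr_ge0.
  exists (fine (\sum_(0 <= k <oo) (X k w ^+ 2)%:E)) => _ [n _ <-].
  rewrite -lee_fin fineK// /series /= -sumEFin.
  by apply: nneseries_lim_ge => k _ _; rewrite lee_fin sqr_ge0.
have := cvg_series_cvg_0 sm => X20w.
have : Num.sqrt (X k w ^+ 2) @[k --> \oo] --> Num.sqrt 0.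
  apply: (cvg_comp (fun k => X k w ^+ 2) Num.sqrt X20w).
  exact: (@sqrt_continuous R 0).
rewrite sqrtr0; under eq_fun do rewrite sqrtr_sqr.
by move/norm_cvg0P.
Qed.

End as_convergence.

Section uncorrelated.
Context d (T : measurableType d) (R : realType) (P : probability T R).

Lemma independent_seq_comp (X : nat -> T -> R) (g : nat -> R -> R) :
  (forall k, measurable_fun setT (g k)) -> independent_seq P X ->
  independent_seq P (fun k w => g k (X k w)).
Proof.
move=> mg iX N A mA.
have := iX N (fun i => g i @^-1` A i); apply => i.
by rewrite -[X in measurable X]setTI; exact: mg.
Qed.

Lemma Rintegral_indep_mul (Y Z : T -> R) :
  measurable_fun setT Y -> measurable_fun setT Z ->
  (forall w, 0 <= Y w) -> (forall w, 0 <= Z w) ->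
  P.-integrable setT (EFin \o Y) -> P.-integrable setT (EFin \o Z) ->
  (forall A B : set R, measurable A -> measurable B ->
     P (Y @^-1` A `&` Z @^-1` B) = (P (Y @^-1` A) * P (Z @^-1` B))%E) ->
  P.-integrable setT (EFin \o (fun w => Y w * Z w)) /\
  \int[P]_w (Y w * Z w) = \int[P]_w Y w * \int[P]_w Z w.
Proof.
move=> mY mZ Y0 Z0 iY iZ iYZ.
have E : (\int[P]_w (Y w * Z w)%:E = (\int[P]_w Y w * \int[P]_w Z w)%:E)%E.
  (* The absolute values make the integrand nonnegative on the whole plane and not merely on the
     range of [(Y, Z)]. *)
  have := @ge0_integral_indep _ _ _ P Y Z mY mZ iYZ (fun x => (`|x.1| * `|x.2|)%:E) _ _.
  have -> : (\int[P]_w (`|(Y w, Z w).1| * `|(Y w, Z w).2|)%:E = \int[P]_w (Y w * Z w)%:E)%E.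
    by apply: eq_integral => w _ /=; rewrite !ger0_norm.
  move=> ->; last 2 first.
  - apply/measurable_EFinP; apply: measurable_funM; exact: measurableT_comp.
  - by move=> x; rewrite lee_fin mulr_ge0.
  transitivity (\int[P]_w ((Y w)%:E * (\int[P]_w Z w)%:E))%E.
    apply: eq_integral => w _ /=.
    rewrite /Rintegral fineK ?integrable_fin_num// -ge0_integralZl ?lee_fin//.
    - by apply: eq_integral => w' _; rewrite !ger0_norm// EFinM.
    - exact/measurable_EFinP.
    - by move=> w' _; rewrite lee_fin.
  rewrite ge0_integralZr//.
  - by rewrite EFinM /Rintegral !fineK ?integrable_fin_num.
  - exact/measurable_EFinP.
  - by move=> w _; rewrite lee_fin.
  - by rewrite lee_fin Rintegral_ge0.
split; last by rewrite {1}/Rintegral E.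
apply/integrableP; split; first by apply/measurable_EFinP; exact: measurable_funM.
under eq_integral do rewrite /= ger0_norm ?mulr_ge0//.
by rewrite E ltry.
Qed.

Lemma integrable_sqr_expr1 (Y : T -> R) : measurable_fun setT Y ->
  P.-integrable setT (EFin \o (fun w => Y w ^+ 2)) -> P.-integrable setT (EFin \o Y).
Proof.
move=> mY i2.
have i : P.-integrable setT (EFin \o (fun w => 1 + Y w ^+ 2)).
  by apply: integrableD_EFin => //; exact: (finite_measure_integrable_cst P 1).
apply: (le_integrable _ _ _ i) => //; first exact/measurable_EFinP.
move=> w _; rewrite /= lee_fin [leRHS]ger0_norm ?addr_ge0 ?sqr_ge0//.
rewrite -(real_normK (num_real (Y w))); have : 0 <= (`|Y w| - 1) ^+ 2 by exact: sqr_ge0.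
have : 0 <= `|Y w| by []. nra.
Qed.

Lemma integrable_sqr_mul (Y Z : T -> R) : measurable_fun setT Y -> measurable_fun setT Z ->
  P.-integrable setT (EFin \o (fun w => Y w ^+ 2)) ->
  P.-integrable setT (EFin \o (fun w => Z w ^+ 2)) ->
  P.-integrable setT (EFin \o (fun w => Y w * Z w)).
Proof.
move=> mY mZ i1 i2.
apply: (le_integrable _ _ _ (integrableD_EFin _ i1 i2)) => //.
  by apply/measurable_EFinP; exact: measurable_funM.
move=> w _; rewrite /= lee_fin normrM [leRHS]ger0_norm ?addr_ge0 ?sqr_ge0//.
rewrite -(real_normK (num_real (Y w))) -(real_normK (num_real (Z w))).
have : 0 <= (`|Y w| - `|Z w|) ^+ 2 by exact: sqr_ge0.
have : 0 <= `|Y w| by []. have : 0 <= `|Z w| by []. nra.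
Qed.

Variables (W : nat -> T -> R) (m : R) (v : nat -> R).
Hypothesis mW : forall k, measurable_fun setT (W k).
Hypothesis W0 : forall k w, 0 <= W k w.
Hypothesis iW2 : forall k, P.-integrable setT (EFin \o (fun w => W k w ^+ 2)).
Hypothesis EW : forall k, \int[P]_w W k w = m.
Hypothesis VW : forall k, \int[P]_w ((W k w - m) ^+ 2) = v k.
Hypothesis indepW : independent_seq P W.

Let S k w := \sum_(i < k) W i w.

Let mS k : measurable_fun setT (S k).
Proof. exact: measurable_sum. Qed.

Let S_ge0 k w : 0 <= S k w. Proof. exact: sumr_ge0. Qed.

Let iW k : P.-integrable setT (EFin \o W k).
Proof. exact: integrable_sqr_expr1. Qed.

Let iS k : P.-integrable setT (EFin \o S k).
Proof. by apply: integrable_sum_EFin. Qed.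

Let ES k : \int[P]_w S k w = k%:R * m.
Proof.
rewrite Rintegral_sum//; under eq_bigr do rewrite EW.
by rewrite sumr_const card_ord mulr_natl.
Qed.

Let mul_SW k : P.-integrable setT (EFin \o (fun w => S k w * W k w)) /\
  \int[P]_w (S k w * W k w) = k%:R * m * m.
Proof.
have [] := @Rintegral_indep_mul (S k) (W k) (mS k) (mW k) (S_ge0 k) (W0 k) (iS k) (iW k) _.
  by move=> A B mA mB; exact: independent_seq_sum.
by move=> iSW ->; rewrite ES EW.
Qed.

Let icst (x : R) : P.-integrable setT (EFin \o (fun=> x)).
Proof. exact: finite_measure_integrable_cst. Qed.

Lemma Rintegral_cst1 (x : R) : \int[P]_w x = x.
Proof. by rewrite Rintegral_cst// [X in fine X]probability_setT mulr1. Qed.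

Lemma variance_sum k :
  P.-integrable setT (EFin \o (fun w => (S k w - k%:R * m) ^+ 2)) /\
  \int[P]_w ((S k w - k%:R * m) ^+ 2) = \sum_(i < k) v i.
Proof.
elim: k => [|k [IHi IH]].
  have E : (fun w => (S 0 w - 0%:R * m) ^+ 2) = fun=> 0.
    by apply/funext => w; rewrite /S big_ord0 mul0r subrr expr0n.
  by rewrite E big_ord0 Rintegral_cst1.
have [iSW ESW] := mul_SW k.
(* This is [(S k - k m) * (W k - m)], expanded because the product rule for expectations was shown
   for nonnegative variables only. *)
pose Q w := S k w * W k w + - m * S k w + - (k%:R * m) * W k w + k%:R * m * m.
have iQ : P.-integrable setT (EFin \o Q).
  apply: integrableD_EFin => //; apply: integrableD_EFin => //; last exact: integrableZl_EFin.
  by apply: integrableD_EFin => //; exact: integrableZl_EFin.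
have iV : P.-integrable setT (EFin \o (fun w => (W k w - m) ^+ 2)).
  rewrite (_ : (fun w => _) = fun w => W k w ^+ 2 + - (2 * m) * W k w + m ^+ 2); last first.
    by apply/funext => w; ring.
  apply: integrableD_EFin => //; apply: integrableD_EFin => //.
  exact: integrableZl_EFin.
have EQ : \int[P]_w Q w = 0.
  rewrite /Q RintegralD//; last first.
    apply: integrableD_EFin => //; last exact: integrableZl_EFin.
    by apply: integrableD_EFin => //; exact: integrableZl_EFin.
  rewrite RintegralD//; last 2 first.
  - by apply: integrableD_EFin => //; exact: integrableZl_EFin.
  - exact: integrableZl_EFin.
  rewrite RintegralD//; last exact: integrableZl_EFin.
  by rewrite !RintegralZl// Rintegral_cst1 ESW ES EW; ring.
have E : (fun w => (S k.+1 w - k.+1%:R * m) ^+ 2) =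
    fun w => (S k w - k%:R * m) ^+ 2 + (2 * Q w + (W k w - m) ^+ 2).
  apply/funext => w; rewrite /S big_ord_recr /= -/(S k w) /Q -natr1; ring.
have i2 : P.-integrable setT (EFin \o (fun w => 2 * Q w + (W k w - m) ^+ 2)).
  by apply: integrableD_EFin => //; exact: integrableZl_EFin.
rewrite E; split; first exact: integrableD_EFin.
rewrite RintegralD// RintegralD//; last exact: integrableZl_EFin.
by rewrite RintegralZl// EQ VW mulr0 add0r big_ord_recr /= IH.
Qed.

End uncorrelated.

Section slln.
Context (R : realType).

Lemma sqrtn_exists (N : nat) : exists j, (j ^ 2 <= N < j.+1 ^ 2)%N.
Proof.
elim: N => [|N [j /andP[jN Nj]]]; first by exists 0%N.
have [h|h] := ltnP N.+1 (j.+1 ^ 2)%N.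
  by exists j; rewrite h (leq_trans jN).
by exists j.+1; rewrite h (leq_ltn_trans Nj)// ltn_sqr.
Qed.

Lemma sum_inv_sqr_le2 n : \sum_(0 <= j < n) (j.+1%:R ^- 2) <= 2 :> R.
Proof.
(* The strengthened bound makes the induction telescope. *)
suff S k : \sum_(0 <= j < k.+1) (j.+1%:R ^- 2) <= 2 - k.+1%:R^-1 :> R.
  case: n => [|n]; first by rewrite big_nil.
  by rewrite (le_trans (S n))// lerBlDr lerDl invr_ge0.
elim: k => [|k IH]; first by rewrite big_nat1 expr1n invr1; lra.
rewrite big_nat_recr//=; apply: (le_trans (lerD IH (lexx _))).
have k0 : 0 < k.+1%:R :> R by rewrite ltr0n.
have -> : k.+2%:R = k.+1%:R + 1 :> R by rewrite -natr1.
move: (k.+1%:R : R) k0 => x x0; have x1 : 0 < x + 1 by lra.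
rewrite -subr_ge0 (_ : _ - _ = (x * (x + 1) ^+ 2)^-1); last by field; rewrite !gt_eqF.
by rewrite invr_ge0 mulr_ge0 ?exprn_ge0// ltW.
Qed.

(* Nonnegativity makes the partial sums monotone, so that the averages are
   squeezed between those at consecutive squares. *)
Lemma cvg_mean_of_squares (a : nat -> R) (m : R) : (forall k, 0 <= a k) ->
  (fun j : nat => (\sum_(k < j.+1 ^ 2) a k) / (j.+1 ^ 2)%:R) @ \oo --> m ->
  (fun N : nat => (\sum_(k < N) a k) / N%:R) @ \oo --> m.
Proof.
move=> a0; set b := (fun j : nat => _) => bm.
have [j hj] := choice sqrtn_exists.
have joo : (fun N => (j N).-1) @ \oo --> \oo.
  move=> A [M _ MA]; exists (M.+1 ^ 2)%N => // N /= MN.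
  apply: MA => /=; have /andP[_] := hj N => h.
  have : (M.+1 ^ 2 < (j N).+1 ^ 2)%N by exact: leq_ltn_trans h.
  by rewrite ltn_sqr ltnS; case: (j N).
pose S N := \sum_(k < N) a k.
have Sle x y : (x <= y)%N -> S x <= S y.
  move=> xy; rewrite /S -(subnKC xy) big_split_ord /= lerDl.
  by rewrite sumr_ge0.
have q1 : (fun i : nat => i.+2%:R / i.+1%:R : R) @ \oo --> (1 : R).
  rewrite (_ : (fun i : nat => _) = fun i => 1 + harmonic i); last first.
    apply/funext => i; rewrite /harmonic /= -[i.+2%:R]natr1 mulrDl divff ?pnatr_eq0//.
    by rewrite mul1r.
  by rewrite -[X in _ --> X]addr0; apply: cvgD; [exact: cvg_cst|exact: cvg_harmonic].
have q2 : (fun i : nat => i.+1%:R / i.+2%:R : R) @ \oo --> (1 : R).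
  rewrite (_ : (fun i : nat => _) = fun i => (i.+2%:R / i.+1%:R)^-1); last first.
    by apply/funext => i; rewrite invf_div.
  by rewrite -[X in _ --> X]invr1; apply: cvgV; first exact: oner_neq0.
have sq (u : nat -> R) : u @ \oo --> (1 : R) -> (fun i => u i ^+ 2) @ \oo --> (1 : R).
  by move=> u1; rewrite -[X in _ --> X](expr1n _ 2); exact: (cvg_comp _ _ u1 (@exprn_continuous R 2 1)).
have lo : (fun i => b i * (i.+1%:R / i.+2%:R) ^+ 2) @ \oo --> m.
  by rewrite -[X in _ --> X]mulr1; apply: cvgM => //; exact: sq.
have hi : (fun i => b i.+1 * (i.+2%:R / i.+1%:R) ^+ 2) @ \oo --> m.
  rewrite -[X in _ --> X]mulr1; apply: cvgM; last exact: sq.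
  by have := bm; rewrite -cvg_shiftS.
apply: squeeze_cvgr (cvg_comp _ _ joo lo) (cvg_comp _ _ joo hi).
near=> N.
have N0 : (0 < N)%N by near: N; exists 1%N.
have /andP[jN Nj] := hj N.
have j0 : (0 < j N)%N by rewrite lt0n; apply: contraTN Nj => /eqP ->; rewrite -leqNgt.
rewrite /=; set i := (j N).-1; have ji : j N = i.+1 by rewrite prednK.
move: jN Nj; rewrite ji => jN Nj; rewrite /b -!/(S _).
have N0' : 0 < N%:R :> R by rewrite ltr0n.
have S0 k : 0 <= S k by exact: sumr_ge0.
rewrite !natrX !expr_div_n; apply/andP; split.
  rewrite mulrA divfK ?expf_neq0 ?pnatr_eq0//.
  apply: ler_pM => //; rewrite ?invr_ge0 ?exprn_ge0 ?Sle//.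
  by rewrite lef_pV2 ?posrE ?exprn_gt0 ?ltr0n// -natrX ler_nat ltnW.
rewrite mulrA divfK ?expf_neq0 ?pnatr_eq0//.
apply: ler_pM => //; rewrite ?invr_ge0 ?exprn_ge0 ?Sle 1?ltnW//.
by rewrite lef_pV2 ?posrE ?exprn_gt0 ?ltr0n// -natrX ler_nat.
Unshelve. all: end_near. Qed.

End slln.

Section strong_law.
Context d (T : measurableType d) (R : realType) (P : probability T R).
Variables (W : nat -> T -> R) (m C : R) (v : nat -> R).
Hypothesis mW : forall k, measurable_fun setT (W k).
Hypothesis W0 : forall k w, 0 <= W k w.
Hypothesis iW2 : forall k, P.-integrable setT (EFin \o (fun w => W k w ^+ 2)).
Hypothesis EW : forall k, \int[P]_w W k w = m.
Hypothesis VW : forall k, \int[P]_w ((W k w - m) ^+ 2) = v k.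
Hypothesis vC : forall k, v k <= C.
Hypothesis indepW : independent_seq P W.

(** Along the squares [(j+1)^2] the average has variance at most [C / (j+1)^2], which is summable.
    Second moments thus suffice there, and nonnegativity fills the gaps between the squares. *)
Lemma strong_law :
  {ae P, forall w, (\sum_(k < N) W k w) / N%:R @[N --> \oo] --> m}.
Proof.
pose D j w := (\sum_(k < j.+1 ^ 2) W k w) / (j.+1 ^ 2)%:R - m.
have mD j : measurable_fun setT (D j).
  by apply: measurable_funB => //; apply: measurable_funM => //; exact: measurable_sum.
have C0 : 0 <= C.
  by apply: le_trans (vC 0); rewrite -VW Rintegral_ge0// => w _; rewrite sqr_ge0.
have ED j : (\int[P]_w (D j w ^+ 2)%:E <= (C * ((j.+1)%:R ^- 2))%:E)%E.
  have [i E] := variance_sum mW W0 iW2 EW VW indepW (j.+1 ^ 2).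
  have k0 : 0 < (j.+1 ^ 2)%:R :> R by rewrite ltr0n expn_gt0.
  have -> : (fun w => (D j w ^+ 2)%:E) =
      (fun w => ((j.+1 ^ 2)%:R ^- 2)%:E * ((\sum_(i < j.+1 ^ 2) W i w - (j.+1 ^ 2)%:R * m) ^+ 2)%:E)%E.
    apply/funext => w; rewrite -EFinM; congr EFin; rewrite /D; field.
    by rewrite gt_eqF.
  rewrite ge0_integralZl//; last 2 first.
  - by case/integrableP: i.
  - by move=> w _; rewrite lee_fin sqr_ge0.
  rewrite -[X in (_ * X)%E]fineK ?integrable_fin_num// -EFinM lee_fin.
  rewrite [X in _ * X]E mulrC ler_pdivrMr ?exprn_gt0//.
  apply: (@le_trans _ _ (C * (j.+1 ^ 2)%:R)).
    rewrite mulr_natr -[X in C *+ X]card_ord -sumr_const.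
    exact: ler_sum.
  rewrite -mulrA ler_wpM2l// natrX expr2 mulrA mulVf ?mul1r//.
have : {ae P, forall w, D j w @[j --> \oo] --> (0 : R)}.
  apply: ae_cvg0_of_summable => //.
  apply: (@le_lt_trans _ _ (\sum_(0 <= j <oo) (C * ((j.+1)%:R ^- 2))%:E)%E).
    by apply: lee_nneseries => // k *; apply: integral_ge0 => w _; rewrite lee_fin sqr_ge0.
  apply: (@le_lt_trans _ _ (C * 2)%:E); last by rewrite ltry.
  apply: lime_le; first by apply: is_cvg_nneseries => j _ _; rewrite lee_fin divr_ge0 ?exprn_ge0.
  by apply: nearW => n; rewrite sumEFin lee_fin -mulr_sumr ler_wpM2l// sum_inv_sqr_le2.
apply: filterS => w Dw; apply: (@cvg_mean_of_squares R (fun k => W k w)) => //.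
rewrite -[X in _ --> X]add0r -[X in X @ _ --> _](_ : (fun j => D j w + m) = _); last first.
  by apply/funext => j; rewrite /D subrK.
by apply: cvgD => //; exact: cvg_cst.
Qed.

End strong_law.

(** * Geometric weights and the Gamma function *)

Section geometric_weights.
Context {R : realType}.
Implicit Types (r : R) (c : nat -> R).

(** The convolution of [c] with the geometric sequence. The predecessor in the index makes it the
    solution of the one-step recursion [geom_convS]. *)
Definition geom_conv r c m : R := \sum_(i < m) r ^+ i * c (m.-1 - i)%N.

Lemma geom_convS r c m : geom_conv r c m.+1 = r * geom_conv r c m + c m.
Proof.
rewrite /geom_conv big_ord_recl /= expr0 mul1r subn0 addrC; congr (_ + _).
rewrite big_distrr /=; apply: eq_bigr => i _.
rewrite exprS mulrA; congr (_ * c _).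
by rewrite /bump /= add1n; case: m i => [[]//|m i]; rewrite subSS.
Qed.

(** Convolution commutes with shifts up to boundary terms; since [c 0 = 0], the only one left is
    [r ^+ m * c 1], added on the left. *)
Lemma geom_conv_second_difference r c m : c 0%N = 0 ->
  \sum_(i < m) r ^+ i * (c (m - i).+1 + c (m - i).-1 - 2 * c (m - i)%N)
    + r ^+ m * c 1%N =
  geom_conv r c m.+2 - 2 * geom_conv r c m.+1 + geom_conv r c m.
Proof.
move=> c0.
have E1 : geom_conv r c m.+1 = \sum_(i < m) r ^+ i * c (m - i)%N.
  by rewrite /geom_conv big_ord_recr /= subnn c0 mulr0 addr0.
have E2 : geom_conv r c m.+2 = \sum_(i < m) r ^+ i * c (m - i).+1 + r ^+ m * c 1%N.
  rewrite /geom_conv !big_ord_recr /= subnn c0 mulr0 addr0 subSn// subnn; congr (_ + _).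
  by apply: eq_bigr => i _; rewrite subSn// ltnW.
rewrite E2 E1.
have -> : \sum_(i < m) r ^+ i * (c (m - i).+1 + c (m - i).-1 - 2 * c (m - i)%N) =
   \sum_(i < m) r ^+ i * c (m - i).+1 + geom_conv r c m - 2 * \sum_(i < m) r ^+ i * c (m - i)%N.
  rewrite /geom_conv mulr_sumr -big_split /= -sumrB; apply: eq_bigr => i _.
  by rewrite (_ : m.-1 - i = (m - i).-1)%N ?predn_sub//; ring.
ring.
Qed.

Variables (r : R) (c : nat -> R).
Hypotheses (r0 : 0 < r) (r1 : r < 1) (c0 : c 0%N = 0) (cle : forall j, c j <= c j.+1).

Let c_ge0 j : 0 <= c j.
Proof. by elim: j => [|j IH]; [rewrite c0|exact: le_trans (cle j)]. Qed.

(** The weights [(1 - r) * r ^+ i] have total mass at most 1, and the values of [c] that they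
    average do not exceed [c m]. *)
Lemma geom_conv_le m : 0 <= (1 - r) * geom_conv r c m <= c m.
Proof.
elim: m => [|m /andP[IH1 IH2]]; first by rewrite /geom_conv big_ord0 mulr0 c0 lexx.
rewrite geom_convS; have := cle m; have := c_ge0 m => h1 h2.
have -> : (1 - r) * (r * geom_conv r c m + c m) =
  r * ((1 - r) * geom_conv r c m) + (1 - r) * c m by ring.
move: IH1 IH2; set q := (1 - r) * _ => q0 qc.
have rq0 : 0 <= r * q by rewrite mulr_ge0// ltW.
have rqc : r * q <= r * c m by rewrite ler_wpM2l// ltW.
have rc : 0 <= (1 - r) * c m by rewrite mulr_ge0// subr_ge0 ltW.
by apply/andP; split; lra.
Qed.

Variable V : nat -> R.
Hypothesis V0 : V 0%N = 0.
(* [V m] is the variance of [\sum_(i < m) r ^+ i * x i] for a stationary sequence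
   [x] whose sums of [j] consecutive terms have variance [c j]. *)
Hypothesis VS : forall m, V m.+1 = V m +
  r ^+ m * \sum_(i < m) r ^+ i * (c (m - i).+1 + c (m - i).-1 - 2 * c (m - i)%N)
  + r ^+ m * r ^+ m * c 1%N.

(** Two summations by parts in closed form: a double sum of covariances, given by second differences
    of [c], becomes a single sum of first differences. The boundary terms all carry the factor
    [r ^+ m]. *)
Lemma geom_variance_exact m :
  (1 + r) * r * V m = \sum_(j < m) (c j.+1 - c j) * r ^+ j.+1
    - (1 - r) * r ^+ m.+1 * geom_conv r c m + r * c m * r ^+ m.
Proof.
elim: m => [|m IH]; first by rewrite V0 c0 big_ord0 /geom_conv big_ord0; ring.
have h := geom_conv_second_difference r m c0.
have -> : V m.+1 = V m + r ^+ m * (geom_conv r c m.+2 - 2 * geom_conv r c m.+1 + geom_conv r c m).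
  by rewrite VS -h; ring.
rewrite mulrDr IH big_ord_recr /= !geom_convS !exprS; ring.
Qed.

(** Only the monotonicity of [c] enters, so convex and concave powers [c] are covered at once. *)
Lemma geom_variance_bounds m :
  \sum_(j < m) (c j.+1 - c j) * r ^+ j.+1 <= (1 + r) * r * V m
    <= \sum_(j < m) (c j.+1 - c j) * r ^+ j.+1 + r ^+ m.+1 * c m.
Proof.
have /andP[h1 h2] := geom_conv_le m.
have rm : 0 <= r ^+ m.+1 by rewrite exprn_ge0// ltW.
rewrite geom_variance_exact.
have -> : (1 - r) * r ^+ m.+1 * geom_conv r c m = r ^+ m.+1 * ((1 - r) * geom_conv r c m) by ring.
have -> : r * c m * r ^+ m = r ^+ m.+1 * c m by rewrite exprS; ring.
by apply/andP; split; nra.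
Qed.

End geometric_weights.

Section abel_weights.
Context {R : realType}.
Implicit Types (r : R).

(** The right-hand side is the mean of [b 0 - b j] when [j] is distributed as [min (G, m)], with [G]
    geometric on the positive integers: mass [(1 - r) * r ^+ i] at [i + 1], and the leftover mass
    [r ^+ m] at [m]. *)
Lemma geom_abel r (b : nat -> R) m :
  \sum_(i < m) r ^+ i * (b i - b i.+1) =
  r ^+ m * (b 0%N - b m) + \sum_(i < m) (1 - r) * r ^+ i * (b 0%N - b i.+1).
Proof.
elim: m => [|m IH]; first by rewrite !big_ord0 subrr mulr0 addr0.
by rewrite !big_ord_recr /= IH exprS; ring.
Qed.

Lemma geom_weights_sum1 r m : r ^+ m + \sum_(i < m) (1 - r) * r ^+ i = 1.
Proof.
elim: m => [|m IH]; first by rewrite big_ord0 addr0.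
by rewrite big_ord_recr /= -{}[RHS]IH exprS; ring.
Qed.

(** The second moment of that truncated law is the tail sum of [P (G > i) * ((i+1)^2 - i^2)], that
    is, of [r ^+ i * (2 i + 1)]. Its closed form is at most [(1 + r) / (1 - r)^2]. *)
Lemma geom_second_moment r m : 0 < r < 1 ->
  r ^+ m * m%:R ^+ 2 + \sum_(i < m) (1 - r) * r ^+ i * i.+1%:R ^+ 2 <= 2 / (1 - r) ^+ 2.
Proof.
move=> /andP[r0 r1].
have E1 : r ^+ m * m%:R ^+ 2 + \sum_(i < m) (1 - r) * r ^+ i * i.+1%:R ^+ 2 =
    \sum_(i < m) r ^+ i * (2 * i%:R + 1).
  elim: m => [|m IH]; first by rewrite !big_ord0 expr0n /= mulr0 addr0.
  by rewrite !big_ord_recr /= -IH exprS -!natr1; ring.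
have E2 : (1 - r) ^+ 2 * \sum_(i < m) r ^+ i * (2 * i%:R + 1) +
    r ^+ m * ((2 * m%:R + 1) * (1 - r) + 2 * r) = 1 + r.
  elim: m {E1} => [|m IH]; first by rewrite big_ord0; ring.
  rewrite big_ord_recr /= (exprS r m); move: IH; set S := \sum_(i < m) _ => IH.
  by rewrite -[RHS]IH -(natr1 m); ring.
rewrite E1 ler_pdivlMr ?exprn_gt0 ?subr_gt0// mulrC.
have : 0 <= r ^+ m * ((2 * m%:R + 1) * (1 - r) + 2 * r).
  have m0 : 0 <= m%:R :> R by [].
  by apply: mulr_ge0; [rewrite exprn_ge0// ltW|nra].
by lra.
Qed.

End abel_weights.

(** * Riemann sums for the Gamma integral *)

Section gamma_increments.
Context {R : realType}.
Local Notation mu := (@lebesgue_measure R).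
Variables (p : R).
Hypothesis p0 : 0 < p.

Lemma continuous_powR_gt0 (a x : R) : 0 < x -> {for x, continuous (fun u : R => u `^ a)}.
Proof.
move=> x0; apply: differentiable_continuous; apply/derivable1_diffP.
by apply: derivable_powR; rewrite in_itv /= x0.
Qed.

Lemma integral_powR_itv_gt0 (a b : R) : 0 < a -> a < b ->
  (\int[mu]_(u in `[a, b]) (p * u `^ (p - 1))%:E = (b `^ p - a `^ p)%:E)%E.
Proof.
move=> a0 ab; have b0 := lt_trans a0 ab.
rewrite EFinB (continuous_FTC2 (F := fun u => u `^ p))//.
- apply: continuous_in_subspaceT => x; rewrite inE/= in_itv/= => /andP[ax _].
  apply: cvgM; first exact: cvg_cst.
  by apply: continuous_powR_gt0; exact: lt_le_trans ax.
- split.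
  + by move=> x; rewrite in_itv/= => /andP[ax _]; apply: derivable_powR; rewrite in_itv/= (lt_trans a0).
  + exact/cvg_at_right_filter/continuous_powR_gt0.
  + exact/cvg_at_left_filter/continuous_powR_gt0.
- move=> x; rewrite in_itv/= => /andP[ax _]; rewrite derive1E.
  by case: (@is_derive1_powR R p x (lt_trans a0 ax)).
Qed.

Lemma measurable_powR_fun (a : R) D : measurable_fun D (fun u : R => u `^ a).
Proof. by apply: measurable_funTS; exact: measurable_powR. Qed.

(** At [a = 0] the integrand is unbounded when [p < 1], so the interval is exhausted from the right
    by the intervals from [b / (i + 2)] to [b]. *)
Lemma integral_powR_itv (a b : R) : 0 <= a -> a < b ->
  (\int[mu]_(u in `]a, b]) (p * u `^ (p - 1))%:E = (b `^ p - a `^ p)%:E)%E.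
Proof.
move=> a0 ab.
have mf D : measurable_fun D (fun u : R => (p * u `^ (p - 1))%:E).
  by apply/measurable_EFinP; apply: measurable_funM => //; exact: measurable_powR_fun.
move: a0; rewrite le_eqVlt => /predU1P[|a0]; last first.
  by rewrite integral_itv_obnd_cbnd ?integral_powR_itv_gt0//; exact/measurable_EFinP/mf.
move=> a0; rewrite -{a}a0 in ab *.
pose F i := `](b / i.+2%:R), b]%classic : set R.
have bi i : 0 < b / i.+2%:R < b.
  by rewrite divr_gt0//= gtr_pMr// invf_lt1// ltr1n.
have FE : `]0, b]%classic = \bigcup_i F i.
  apply/seteqP; split => x /=; rewrite in_itv/=; last first.
    move=> [i _]; rewrite /F /= in_itv/= => /andP[bx ->]; rewrite andbT.
    by apply: lt_trans bx; case/andP: (bi i).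
  move=> /andP[x0 xb].
  have [n _ Hn] := nbhs_infty_ger (b / x + 1).
  have := Hn n (leqnn n) => /= h.
  exists n => //; rewrite /F /= in_itv/= xb andbT.
  rewrite ltr_pdivrMr// mulrC -ltr_pdivrMr//.
  have : n%:R <= n.+2%:R :> R by rewrite ler_nat leqW.
  lra.
have : (\int[mu]_(u in F i) (p * u `^ (p - 1))%:E @[i --> \oo] -->
    \int[mu]_(u in \bigcup_i F i) (p * u `^ (p - 1))%:E)%E.
  apply: ge0_nondecreasing_set_cvg_integral => //.
  - apply/nondecreasing_seqP => i; apply/subsetPset => x; rewrite /F /= !in_itv/=.
    move=> /andP[bx ->]; rewrite andbT; apply: le_lt_trans bx.
    by rewrite ler_pM2l// lef_pV2 ?posrE// ler_nat.
  - by move=> i; exact: measurable_itv.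
  - by move=> i; exact: mf.
  - by move=> i x _; rewrite lee_fin mulr_ge0 ?powR_ge0// ltW.
rewrite -FE => /cvg_lim <- //.
apply/cvg_lim => //.
have -> : (fun i => \int[mu]_(u in F i) (p * u `^ (p - 1))%:E)%E =
    EFin \o (fun i : nat => b `^ p - (b / i.+2%:R) `^ p).
  apply/funext => i; have /andP[h1 h2] := bi i.
  by rewrite /F integral_itv_obnd_cbnd ?integral_powR_itv_gt0//; exact/measurable_EFinP/mf.
apply: cvg_EFin; first exact: nearW.
apply: cvgB; first exact: cvg_cst.
rewrite powR0 ?gt_eqF//.
have := @powR_cvg0 R p p0 => /cvg_at_rightP/(_ (fun i : nat => b / i.+2%:R)).
apply; split; first by move=> i; case/andP: (bi i).
rewrite -[X in _ --> X](mulr0 b); apply: cvgM; first exact: cvg_cst.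
by have := @cvg_harmonic R; rewrite -cvg_shiftS.
Qed.

Definition gamma_density (u : R) := u `^ (p - 1) * expR (- u).

Lemma measurable_gamma_density D : measurable_fun D (EFin \o gamma_density).
Proof.
apply/measurable_EFinP; apply: measurable_funM; first exact: measurable_powR_fun.
by apply: measurableT_comp => //; exact: measurable_funTS.
Qed.

Lemma gamma_density_ge0 u : 0 <= gamma_density u.
Proof. by rewrite mulr_ge0 ?powR_ge0 ?expR_ge0. Qed.

(** The power is integrated exactly and only the exponential is replaced by its extreme values, so
    the singularity at 0 costs nothing. *)
Lemma gamma_itv_bounds (a b : R) : 0 <= a -> a < b ->
  (((b `^ p - a `^ p) * expR (- b))%:E <= p%:E * \int[mu]_(u in `]a, b]) (gamma_density u)%:E
   <= ((b `^ p - a `^ p) * expR (- a))%:E)%E.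
Proof.
move=> a0 ab.
have mf D : measurable_fun D (fun u : R => (p * u `^ (p - 1))%:E).
  by apply/measurable_EFinP; apply: measurable_funM => //; exact: measurable_powR_fun.
have f0 u : 0 <= p * u `^ (p - 1) by rewrite mulr_ge0 ?powR_ge0// ltW.
rewrite -ge0_integralZl//; last 3 first.
- exact: measurable_gamma_density.
- by move=> u _; rewrite lee_fin gamma_density_ge0.
- by rewrite lee_fin ltW.
have E u : (p%:E * (gamma_density u)%:E = (p * u `^ (p - 1) * expR (- u))%:E)%E.
  by rewrite -EFinM /gamma_density mulrA.
rewrite !EFinM -integral_powR_itv//.
rewrite -!ge0_integralZr ?lee_fin ?expR_ge0//; last 2 first.
- exact: mf.
- by move=> u _; rewrite lee_fin.
apply/andP; split; apply: ge0_le_integral => //.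
- by move=> u _; rewrite mule_ge0 ?lee_fin ?expR_ge0.
- by apply: emeasurable_funM => //; exact: mf.
- apply: emeasurable_funM => //; exact: measurable_gamma_density.
- move=> u; rewrite /= in_itv/= => /andP[au ub].
  by rewrite E -EFinM lee_fin ler_wpM2l// ler_expR lerN2.
- by move=> u _; rewrite mule_ge0 ?lee_fin ?gamma_density_ge0// ltW.
- apply: emeasurable_funM => //; exact: measurable_gamma_density.
- by apply: emeasurable_funM => //; exact: mf.
- move=> u; rewrite /= in_itv/= => /andP[au ub].
  by rewrite E -EFinM lee_fin ler_wpM2l// ler_expR lerN2 ltW.
- exact: mf.
- by move=> u _; rewrite lee_fin.
Qed.

(** The lower Riemann-Stieltjes sum of [exp (- u)] against [u ^ p] with step [h]. With
    [c j = (j h)^p] and [r = exp (- h)] it is exactly the sum that bounds the variance in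
    [geom_variance_bounds]. *)
Definition gamma_riemann (h : R) m : R :=
  \sum_(j < m) ((j.+1%:R * h) `^ p - (j%:R * h) `^ p) * expR (- h) ^+ j.+1.

Lemma gamma_sum_bounds (h : R) m : 0 < h ->
  ((gamma_riemann h m)%:E <= p%:E * \int[mu]_(u in `]0%R, (m%:R * h)%R]) (gamma_density u)%:E
   <= (gamma_riemann h m / expR (- h))%:E)%E.
Proof.
move=> h0; rewrite /gamma_riemann; elim: m => [|m /andP[IH1 IH2]].
  by rewrite big_ord0 mul0r mul0r set_itvoc0 integral_set0 mule0 lexx.
have mh : 0 <= m%:R * h by rewrite mulr_ge0// ltW.
have mmh : m%:R * h < m.+1%:R * h by rewrite ltr_pM2r// ltr_nat.
have -> : `]0, m.+1%:R * h]%classic = `]0, m%:R * h]%classic `|` `]m%:R * h, m.+1%:R * h]%classic.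
  by rewrite -itv_bndbnd_setU// bnd_simp// ltW.
rewrite ge0_integral_setU//=; last 3 first.
- exact: measurable_gamma_density.
- by move=> u _; rewrite lee_fin gamma_density_ge0.
- apply/disj_setPS => u [] /=; rewrite !in_itv/= => /andP[_ um] /andP[mu _].
  by move: (le_lt_trans um mu); rewrite ltxx.
have /andP[b1 b2] := gamma_itv_bounds mh mmh.
have i0 D : (0 <= \int[mu]_(u in D) (gamma_density u)%:E)%E.
  by apply: integral_ge0 => u _; rewrite lee_fin gamma_density_ge0.
rewrite ge0_muleDr// big_ord_recr /=.
have eX (k : nat) : expR (- (k%:R * h)) = expR (- h) ^+ k.
  by rewrite -expRM_natl mulrN.
move: b1 b2; rewrite !eX => b1 b2.
apply/andP; split; first by rewrite EFinD; exact: leeD.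
rewrite mulrDl EFinD; apply: leeD => //; apply: (le_trans b2).
by rewrite exprS [expR (- h) * _]mulrC mulrA mulfK ?gt_eqF ?expR_gt0.
Qed.

Lemma gamma_density_lty : p <= 2 ->
  (\int[mu]_(u in `]0%R, +oo[) (gamma_density u)%:E < +oo)%E.
Proof.
move=> p2.
pose F m := `]0, m%:R]%classic : set R.
have FE : `]0, +oo[%classic = \bigcup_i F i.
  apply/seteqP; split => x /=; rewrite in_itv/= andbT; last first.
    by move=> [i _]; rewrite /F /= in_itv/= => /andP[].
  move=> x0; have [n _ Hn] := nbhs_infty_ger x.
  by exists n => //; rewrite /F /= in_itv/= x0; exact: (Hn n (leqnn n)).
have mF i : measurable (F i) by exact: measurable_itv.
have cv : (\int[mu]_(u in F i) (gamma_density u)%:E @[i --> \oo] -->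
    \int[mu]_(u in \bigcup_i F i) (gamma_density u)%:E)%E.
  apply: ge0_nondecreasing_set_cvg_integral => //.
  - apply/nondecreasing_seqP => i; apply/subsetPset => x; rewrite /F /= !in_itv/=.
    by move=> /andP[-> /le_trans]; apply; rewrite ler_nat.
  - by move=> i; exact: measurable_gamma_density.
  - by move=> i x _; rewrite lee_fin gamma_density_ge0.
rewrite FE -(cvg_lim _ cv)//.
(* The factor 24 is [4!], from [x^4 / 4! <= exp x] together with [x^p <= x^2]; the 2 bounds the sum
   of the inverse squares, and [exp (-1)] comes from the upper sum with step 1. *)
apply: (@le_lt_trans _ _ (p^-1 * (24 * 2 / expR (- 1)))%:E); last by rewrite ltry.
apply: lime_le; first by apply/cvg_ex; eexists; exact: cv.
apply: nearW => m; have := gamma_sum_bounds m ltr01 => /andP[_].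
rewrite mulr1 -/(F m) => h.
have -> : (\int[mu]_(u in F m) (gamma_density u)%:E =
    p^-1%:E * (p%:E * \int[mu]_(u in F m) (gamma_density u)%:E))%E.
  by rewrite muleA -EFinM mulVf ?gt_eqF// mul1e.
rewrite EFinM lee_wpmul2l ?lee_fin ?invr_ge0 ?(ltW p0)//.
apply: (le_trans h); rewrite lee_fin ler_wpM2r ?invr_ge0 ?expR_ge0//.
apply: (@le_trans _ _ (24 * \sum_(0 <= j < m) (j.+1%:R ^- 2))); last first.
  by rewrite ler_wpM2l// sum_inv_sqr_le2.
rewrite big_mkord mulr_sumr; apply: ler_sum => j _; rewrite !mulr1.
have x1 : 1 <= j.+1%:R :> R by rewrite ler1n.
have x0 : 0 < j.+1%:R :> R by rewrite ltr0n.
rewrite -expRM_natl mulrN mulr1.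
move: (j.+1%:R : R) x1 x0 => x x1 x0.
apply: (@le_trans _ _ (x ^+ 2 * expR (- x))).
  rewrite ler_wpM2r ?expR_ge0// lerBlDr (@le_trans _ _ (x `^ 2%:R))//.
    by rewrite ler_powR.
  by rewrite powR_mulrn ?(ltW x0)// lerDl powR_ge0.
have := @expR_ge1Dxn R x 3 (ltW x0) => e4.
have f4 : 4`!%:R = 24 :> R by [].
rewrite expRN ler_pdivrMr ?expR_gt0// mulrAC ler_pdivlMr ?exprn_gt0//.
by move: e4; rewrite f4 -exprD => e4; lra.
Qed.

End gamma_increments.

Section gamma_limit.
Context {R : realType}.
Local Notation mu := (@lebesgue_measure R).
Variables (p : R).
Hypotheses (p0 : 0 < p) (p2 : p <= 2).

Let I L : R := fine (\int[mu]_(u in `]0%R, L]) (gamma_density p u)%:E)%E.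

Let i0 D : (0 <= \int[mu]_(u in D) (gamma_density p u)%:E)%E.
Proof. by apply: integral_ge0 => u _; rewrite lee_fin gamma_density_ge0. Qed.

Let le_int A B : measurable A -> measurable B -> A `<=` B ->
  (\int[mu]_(u in A) (gamma_density p u)%:E <= \int[mu]_(u in B) (gamma_density p u)%:E)%E.
Proof.
move=> mA mB AB; apply: ge0_subset_integral => //.
- exact: measurable_gamma_density.
- by move=> u _; rewrite lee_fin gamma_density_ge0.
Qed.

Let subL (L : R) : (`]0, L]%classic : set R) `<=` `]0, +oo[%classic.
Proof. by move=> x /=; rewrite !in_itv/= andbT => /andP[]. Qed.

Let fin_I (L : R) : (\int[mu]_(u in `]0%R, L]) (gamma_density p u)%:E)%E \is a fin_num.
Proof.
rewrite ge0_fin_numE//; apply: le_lt_trans (gamma_density_lty p0 p2).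
by apply: le_int => //; exact: subL.
Qed.

Let fin_Gamma : (\int[mu]_(u in `]0%R, +oo[) (gamma_density p u)%:E)%E \is a fin_num.
Proof. by rewrite ge0_fin_numE//; exact: gamma_density_lty. Qed.

Let GammaE : Gamma p = fine (\int[mu]_(u in `]0%R, +oo[) (gamma_density p u)%:E)%E.
Proof. by []. Qed.

Let I_le_Gamma L : I L <= Gamma p.
Proof. by rewrite GammaE fine_le// le_int//; exact: subL. Qed.

Let I_le L L' : L <= L' -> I L <= I L'.
Proof.
move=> LL'; rewrite fine_le// le_int// => x /=; rewrite !in_itv/= => /andP[-> xL].
exact: le_trans LL'.
Qed.

Let I_natcvg : I n%:R @[n --> \oo] --> Gamma p.
Proof.
pose F m := `]0, m%:R]%classic : set R.
have FE : `]0, +oo[%classic = \bigcup_i F i.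
  apply/seteqP; split => x /=; rewrite in_itv/= andbT; last first.
    by move=> [i _]; rewrite /F /= in_itv/= => /andP[].
  move=> x0; have [n _ Hn] := nbhs_infty_ger x.
  by exists n => //; rewrite /F /= in_itv/= x0; exact: (Hn n (leqnn n)).
have cv : (\int[mu]_(u in F i) (gamma_density p u)%:E @[i --> \oo] -->
    \int[mu]_(u in \bigcup_i F i) (gamma_density p u)%:E)%E.
  apply: ge0_nondecreasing_set_cvg_integral => //.
  - apply/nondecreasing_seqP => i; apply/subsetPset => x; rewrite /F /= !in_itv/=.
    by move=> /andP[-> /le_trans]; apply; rewrite ler_nat.
  - by move=> i; exact: measurable_itv.
  - by move=> i; exact: measurable_gamma_density.
  - by move=> i x _; rewrite lee_fin gamma_density_ge0.
move: cv; rewrite -FE -[X in _ --> X -> _]fineK//.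
by move=> /fine_cvg.
Qed.

Lemma gamma_itv_cvg (L : nat -> R) : L @ \oo --> +oo -> I (L j) @[j --> \oo] --> Gamma p.
Proof.
move=> Loo; apply/cvgrPdist_le => e e0.
have [n Hn] : exists n : nat, Gamma p - e <= I n%:R.
  have /cvgrPdist_le/(_ e e0)[n _ Hn] := I_natcvg.
  exists n; have := Hn n (leqnn n) => /=; rewrite ler_distl => /andP[_].
  by rewrite lerBlDr.
near=> j; rewrite ger0_norm ?subr_ge0//.
have : I n%:R <= I (L j) by apply: I_le; near: j; move/cvgryPge : Loo; exact.
lra.
Unshelve. all: end_near. Qed.

Lemma Gamma_gt0 : 0 < Gamma p.
Proof.
have := I_le_Gamma 1; apply: lt_le_trans.
have := gamma_sum_bounds p0 1 (@ltr01 R) => /andP[+ _].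
rewrite /gamma_riemann big_ord1 !mul1r mul0r powR1 powR0 ?gt_eqF// subr0 mul1r expr1.
rewrite -[X in (_ <= _ * X)%E]fineK// -EFinM lee_fin -/(I 1) => h.
by rewrite -(pmulr_rgt0 _ p0); apply: lt_le_trans h; rewrite expR_gt0.
Qed.

Lemma powR_expRN_cvg0 (L : nat -> R) : L @ \oo --> +oo ->
  (L j) `^ p * expR (- L j) @[j --> \oo] --> (0 : R).
Proof.
move=> Loo.
(* The bound combines [x^p <= x^2] for [x >= 1] with [x^3 / 3! <= exp x]. *)
apply: (@squeeze_cvgr _ _ _ _ (cst 0) (fun j => 6 * (L j)^-1)).
- near=> j; have L1 : 1 <= L j by near: j; move/cvgryPge : Loo; exact.
  rewrite mulr_ge0 ?powR_ge0 ?expR_ge0//=.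
  have L0 : 0 < L j by exact: lt_le_trans L1.
  move: (L j) L1 L0 => x x1 x0.
  have := @expR_ge1Dxn R x 2 (ltW x0).
  rewrite (_ : 3`!%:R = 6 :> R)// => e3.
  rewrite expRN ler_pdivrMr ?expR_gt0// mulrAC ler_pdivlMr//.
  apply: (@le_trans _ _ (x ^+ 2 * x)); last by rewrite -exprSr; lra.
  by rewrite ler_wpM2r ?(ltW x0)// -(powR_mulrn 2 (ltW x0)) ler_powR.
- exact: cvg_cst.
- rewrite -[X in _ --> X](mulr0 6); apply: cvgM; first exact: cvg_cst.
  by apply/gtr0_cvgV0 => //; near=> j; near: j; move/cvgryPgt : Loo; exact.
Unshelve. all: end_near. Qed.

(** The step tends to 0 while the horizon [m h] tends to infinity. The lower and upper sums differ
    by the factor [exp (- h)], the excess term decays exponentially in the horizon, and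
    [(1 + exp (- h)) * exp (- h)] tends to 2, whence the division by 2. *)
Lemma gamma_variance_cvg (h : nat -> R) (m : nat -> nat) (v : nat -> R) :
  (forall j, 0 < h j) -> h @ \oo --> (0 : R) ->
  (fun j => (m j)%:R * h j) @ \oo --> +oo ->
  (forall j, gamma_riemann p (h j) (m j) <=
     (1 + expR (- h j)) * expR (- h j) * v j <=
     gamma_riemann p (h j) (m j) +
     expR (- h j) ^+ (m j).+1 * ((m j)%:R * h j) `^ p) ->
  v @ \oo --> p / 2 * Gamma p.
Proof.
move=> h0 hcvg Lcvg hv.
pose L j := (m j)%:R * h j.
have rcvg : expR (- h j) @[j --> \oo] --> (1 : R).
  rewrite -[X in _ --> X]expR0; apply: (cvg_comp (fun j => - h j) expR); last exact: continuous_expR.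
  by rewrite -[X in _ `=>` nbhs X]oppr0; exact: cvgN.
have r1cvg : 1 + expR (- h j) @[j --> \oo] --> (2 : R).
  by rewrite (_ : 2 = 1 + 1 :> R)//; apply: cvgD => //; exact: cvg_cst.
have Icvg := gamma_itv_cvg Lcvg.
have lo : p * I (L j) / (1 + expR (- h j)) @[j --> \oo] --> p / 2 * Gamma p.
  rewrite (mulrAC p); apply: cvgM; first by apply: cvgM => //; exact: cvg_cst.
  by apply: cvgV.
have hi : (p * I (L j) + expR (- h j) * ((L j) `^ p * expR (- L j))) /
    ((1 + expR (- h j)) * expR (- h j)) @[j --> \oo] --> p / 2 * Gamma p.
  rewrite (mulrAC p) (_ : p * Gamma p / 2 = (p * Gamma p + 1 * 0) / (2 * 1)); last by field.
  apply: cvgM.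
    apply: cvgD; first by apply: cvgM => //; exact: cvg_cst.
    by apply: cvgM => //; exact: powR_expRN_cvg0.
  by apply: cvgV; [rewrite mulr1|exact: cvgM].
apply: squeeze_cvgr lo hi; near=> j.
have /andP[hv1 hv2] := hv j.
have := gamma_sum_bounds p0 (m j) (h0 j) => /andP[].
rewrite -[X in (p%:E * X)%E]fineK// -EFinM !lee_fin -/(I _) -/(L j) => g1 g2.
have r0 : 0 < expR (- h j) by exact: expR_gt0.
have rm : expR (- h j) ^+ (m j) = expR (- L j).
  by rewrite -expRM_natl mulrN.
move: hv1 hv2; rewrite exprS rm -/(L j).
move: g2; rewrite ler_pdivlMr// => g2 hv1 hv2.
apply/andP; split.
  rewrite ler_pdivrMr ?addr_gt0//.
  rewrite -(ler_pM2r r0); apply: (le_trans g2); apply: (le_trans hv1).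
  by rewrite le_eqVlt; apply/orP; left; apply/eqP; ring.
rewrite ler_pdivlMr ?mulr_gt0 ?addr_gt0// mulrC.
apply: (le_trans hv2); rewrite lerD//.
by rewrite le_eqVlt; apply/orP; left; apply/eqP; ring.
Unshelve. all: end_near. Qed.

End gamma_limit.

(** * Mixed differences of powers *)

Section power_difference.
Context {R : realType}.
Variable p : R.
Hypotheses (p0 : 0 < p) (p2 : p < 2).

Lemma powR_MVT (a x y : R) : 0 < x -> 0 <= y ->
  exists2 z, x <= z <= x + y & (x + y) `^ a - x `^ a = y * (a * z `^ (a - 1)).
Proof.
move=> x0; rewrite le_eqVlt => /predU1P[<-|y0].
  by exists x; rewrite ?addr0 ?lexx// subrr mul0r.
have [|||z] := @MVT R (fun u => u `^ a) (fun u => a * u `^ (a - 1)) x (x + y).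
- by rewrite ltrDl.
- move=> z; rewrite in_itv/= => /andP[xz _]; apply: is_derive1_powR.
  exact: lt_trans xz.
- apply: continuous_in_subspaceT => z; rewrite inE/= in_itv/= => /andP[xz _].
  by apply: continuous_powR_gt0; exact: lt_le_trans xz.
rewrite in_itv/= => /andP[xz zy] ->; exists z; first by rewrite !ltW.
by rewrite addrAC subrr add0r mulrC.
Qed.

(* With [p = 2 H], the left-hand side is twice the covariance of the increments of
   a fractional Brownian motion over [s - x, s] and [t - y, t], where
   [tau = t - s]. *)
Lemma powR_mixed_difference (tau : R) : 0 < tau -> exists2 C, 0 < C & forall x y,
  0 <= x -> 0 <= y ->
  `| `|tau + x| `^ p + `|tau - y| `^ p - `|tau| `^ p - `|tau + x - y| `^ p |
    <= C * (x ^+ 2 + y ^+ 2).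
Proof.
move=> t0; pose K := (tau / 2) `^ (p - 2).
have K0 : 0 < K by rewrite powR_gt0// divr_gt0.
have leK u : tau / 2 <= u -> u `^ (p - 2) <= K.
  move=> tu; have tau20 : 0 < tau / 2 by rewrite divr_gt0.
  have u0 : 0 < u by exact: lt_le_trans tu.
  rewrite /K -(opprB 2 p) !powRN lef_pV2 ?posrE ?powR_gt0//.
  by rewrite ge0_ler_powR ?nnegrE ?(ltW u0) ?(ltW tau20)// subr_ge0 ltW.
exists (64 * K) => [|x y x0 y0]; first by rewrite mulr_gt0.
have txp : 0 < tau + x by rewrite ltr_pwDl.
(* If [y <= tau / 2], all arguments stay away from the singularity at 0, and two mean value theorems
   give [x y p (p - 1) z^(p - 2)] with [z >= tau / 2]. *)
have [yt|ty] := leP y (tau / 2).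
- have ty0 : tau / 2 <= tau - y by lra.
  have ty1 : 0 < tau - y by apply: lt_le_trans ty0; rewrite divr_gt0.
  have ty2 : 0 < tau + x - y by lra.
  rewrite (gtr0_norm txp) (gtr0_norm ty1) (gtr0_norm t0) (gtr0_norm ty2).
  have [z [zlo e]] : exists z, tau / 2 <= z /\ (tau + x) `^ p + (tau - y) `^ p - tau `^ p -
      (tau + x - y) `^ p = y * (p * (x * ((p - 1) * z `^ (p - 2)))).
    move: y0; rewrite le_eqVlt => /predU1P[<-|y0].
      by exists tau; split; [lra|rewrite !subr0 mul0r; ring].
    have [|||z] := @MVT R (fun u => (u + x) `^ p - u `^ p)
        (fun u => p * (u + x) `^ (p - 1) - p * u `^ (p - 1)) (tau - y) tau.
    + by rewrite gtrBl.
    + move=> z; rewrite in_itv/= => /andP[xz _].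
      have z0 : 0 < z by exact: lt_trans xz.
      have h1 := @is_derive1_powR R p z z0.
      have h2 : is_derive z 1 (fun u => (u + x) `^ p) (p * (z + x) `^ (p - 1)).
        have -> : p * (z + x) `^ (p - 1) = (p * (z + x) `^ (p - 1)) * (1 + 0).
          by rewrite addr0 mulr1.
        apply: (@is_derive1_comp R (fun u => u `^ p) (fun u => u + x)).
        by apply: is_derive1_powR; rewrite ltr_pwDl.
      exact: is_deriveB.
    + apply: continuous_in_subspaceT => z; rewrite inE/= in_itv/= => /andP[xz _].
      have z0 : 0 < z by exact: lt_le_trans xz.
      apply: cvgB; last exact: continuous_powR_gt0.
      apply: (@cvg_comp _ _ _ (fun u => u + x) (fun u => u `^ p)).
        by apply: cvgD; [exact: cvg_id|exact: cvg_cst].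
      by apply: continuous_powR_gt0; rewrite ltr_pwDl.
    rewrite in_itv/= => /andP[xz zy] E.
    have z0 : 0 < z by exact: lt_trans xz.
    have [w /andP[zw _] Ew] := powR_MVT (p - 1) z0 x0.
    exists w; split; first by apply: (le_trans ty0); apply: le_trans zw; exact: ltW.
    rewrite (_ : p - 2 = p - 1 - 1); last by ring.
    rewrite -Ew; move: E; rewrite (_ : tau - y + x = tau + x - y); last by ring.
    by move=> E; lra.
  rewrite e !normrM !(ger0_norm x0) (ger0_norm y0) (gtr0_norm p0) (ger0_norm (powR_ge0 _ _)).
  have p1 : `|p - 1| <= 1.
    by rewrite ler_norml lerBrDr addNr (ltW p0) lerBlDr (ltW p2).
  have A1 : `|p - 1| * z `^ (p - 2) <= 1 * K.
    by rewrite ler_pM ?powR_ge0// leK.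
  have A2 : y * (p * (x * (`|p - 1| * z `^ (p - 2)))) <= y * (2 * (x * (1 * K))).
    rewrite ler_wpM2l// ler_pM ?(ltW p0) ?(ltW p2) ?mulr_ge0 ?powR_ge0//.
    by rewrite ler_wpM2l.
  apply: (le_trans A2).
  have : 0 <= K * (x - y) ^+ 2 by rewrite mulr_ge0 ?sqr_ge0// ltW.
  have : 0 <= K * x ^+ 2 by rewrite mulr_ge0 ?sqr_ge0// ltW.
  have : 0 <= K * y ^+ 2 by rewrite mulr_ge0 ?sqr_ge0// ltW.
  by lra.
(* Here [x + y > tau / 2], so a crude estimate is enough: each power is at most [16 M^2 K], two of
   them enter with each sign, and [M^2 <= 2 (x^2 + y^2)]; together [2 * 16 * 2 = 64]. *)
- pose M := x + y.
  have tM : tau / 2 < M by rewrite /M; lra.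
  have M0 : 0 < M by apply: lt_trans tM; rewrite divr_gt0.
  have bnd (u : R) : `|u| <= 4 * M -> `|u| `^ p <= 16 * M ^+ 2 * K.
    move=> uM; apply: (@le_trans _ _ ((4 * M) `^ p)).
      by rewrite ge0_ler_powR ?nnegrE// ?mulr_ge0 ?(ltW M0) ?(ltW p0).
    rewrite (_ : p = 2 + (p - 2)); last by ring.
    rewrite powRD; last by apply/implyP => _; rewrite mulf_neq0// gt_eqF.
    rewrite powR_mulrn ?mulr_ge0 ?(ltW M0)// exprMn (_ : 4 ^+ 2 = 16 :> R); last by ring.
    by apply: ler_wpM2l; [rewrite mulr_ge0 ?sqr_ge0|apply: leK; lra].
  have b1 := bnd (tau + x); have b2 := bnd (tau - y); have b3 := bnd tau; have b4 := bnd (tau + x - y).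
  have D1 : `|tau + x| `^ p <= 16 * M ^+ 2 * K.
    by apply: b1; rewrite gtr0_norm// /M; lra.
  have D2 : `|tau - y| `^ p <= 16 * M ^+ 2 * K.
    by apply: b2; rewrite ler_norml /M; apply/andP; split; lra.
  have D3 : `|tau| `^ p <= 16 * M ^+ 2 * K.
    by apply: b3; rewrite gtr0_norm// /M; lra.
  have D4 : `|tau + x - y| `^ p <= 16 * M ^+ 2 * K.
    by apply: b4; rewrite ler_norml /M; apply/andP; split; lra.
  have E1 := powR_ge0 `|tau + x| p; have E2 := powR_ge0 `|tau - y| p.
  have E3 := powR_ge0 `|tau| p; have E4 := powR_ge0 `|tau + x - y| p.
  have M2 : M ^+ 2 * K <= 2 * (x ^+ 2 + y ^+ 2) * K.
    rewrite ler_wpM2r ?(ltW K0)// /M.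
    by have := sqr_ge0 (x - y); lra.
  rewrite ler_norml; apply/andP; split; lra.
Qed.

End power_difference.

(** * Moments of the stationary fractional Ornstein-Uhlenbeck process *)

Section square_integrable.
Context d {T : measurableType d} {R : realType} (P : probability T R).
Implicit Types (X Y Z : T -> R).

Definition square_integrable X :=
  measurable_fun setT X /\ P.-integrable setT (EFin \o (fun w => X w ^+ 2)).

Definition inner X Y : R := \int[P]_w (X w * Y w).

Lemma integrable_inner X Y : square_integrable X -> square_integrable Y ->
  P.-integrable setT (EFin \o (fun w => X w * Y w)).
Proof. by move=> [mX iX] [mY iY]; exact: integrable_sqr_mul. Qed.

Lemma square_integrableD X Y : square_integrable X -> square_integrable Y ->
  square_integrable (fun w => X w + Y w).
Proof.
move=> sX sY; have [[mX iX] [mY iY]] := (sX, sY).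
split; first exact: measurable_funD.
rewrite (_ : (fun w => _) = fun w => X w ^+ 2 + (2 * (X w * Y w) + Y w ^+ 2)); last first.
  by apply/funext => w; ring.
apply: integrableD_EFin => //; apply: integrableD_EFin => //.
by apply: integrableZl_EFin => //; exact: integrable_inner.
Qed.

Lemma square_integrableZ (k : R) X : square_integrable X ->
  square_integrable (fun w => k * X w).
Proof.
move=> [mX iX]; split; first exact: measurable_funM.
under eq_fun do rewrite exprMn.
exact: integrableZl_EFin.
Qed.

Lemma square_integrableB X Y : square_integrable X -> square_integrable Y ->
  square_integrable (fun w => X w - Y w).
Proof.
move=> sX sY; have := square_integrableD sX (square_integrableZ (-1) sY).
by congr square_integrable; apply/funext => w; rewrite mulN1r.
Qed.

Lemma square_integrable0 : square_integrable (fun=> 0).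
Proof.
split; first exact: measurable_cst.
by under eq_fun do rewrite expr0n; exact: (finite_measure_integrable_cst P 0).
Qed.

Lemma square_integrable_sum m (X : nat -> T -> R) :
  (forall i, (i < m)%N -> square_integrable (X i)) ->
  square_integrable (fun w => \sum_(i < m) X i w).
Proof.
elim: m => [|m IH] sX.
  by under eq_fun do rewrite big_ord0; exact: square_integrable0.
under eq_fun do rewrite big_ord_recr /=.
by apply: square_integrableD; [apply: IH => i im; exact/sX/ltnW|exact: sX].
Qed.

Lemma innerC X Y : inner X Y = inner Y X.
Proof. by apply: eq_Rintegral => w _; rewrite mulrC. Qed.

Lemma innerDl X Y Z : square_integrable X -> square_integrable Y -> square_integrable Z ->
  inner (fun w => X w + Y w) Z = inner X Z + inner Y Z.
Proof.
move=> sX sY sZ; rewrite /inner.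
under eq_Rintegral do rewrite mulrDl.
by rewrite RintegralD//; exact: integrable_inner.
Qed.

Lemma innerZl (k : R) X Y : square_integrable X -> square_integrable Y ->
  inner (fun w => k * X w) Y = k * inner X Y.
Proof.
move=> sX sY; rewrite /inner.
under eq_Rintegral do rewrite -mulrA.
by rewrite RintegralZl//; exact: integrable_inner.
Qed.

Lemma innerBl X Y Z : square_integrable X -> square_integrable Y -> square_integrable Z ->
  inner (fun w => X w - Y w) Z = inner X Z - inner Y Z.
Proof.
move=> sX sY sZ; rewrite /inner.
under eq_Rintegral do rewrite mulrBl.
by rewrite RintegralB//; exact: integrable_inner.
Qed.

Lemma innerDr X Y Z : square_integrable X -> square_integrable Y -> square_integrable Z ->
  inner Z (fun w => X w + Y w) = inner Z X + inner Z Y.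
Proof. by move=> sX sY sZ; rewrite innerC innerDl// !(innerC Z). Qed.

Lemma innerZr (k : R) X Y : square_integrable X -> square_integrable Y ->
  inner Y (fun w => k * X w) = k * inner Y X.
Proof. by move=> sX sY; rewrite innerC innerZl// (innerC Y). Qed.

Lemma innerBr X Y Z : square_integrable X -> square_integrable Y -> square_integrable Z ->
  inner Z (fun w => X w - Y w) = inner Z X - inner Z Y.
Proof. by move=> sX sY sZ; rewrite innerC innerBl// !(innerC Z). Qed.

Lemma inner0l Y : inner (fun=> 0) Y = 0.
Proof.
rewrite /inner; under eq_Rintegral do rewrite mul0r.
exact: Rintegral_cst1.
Qed.

Lemma inner_suml m (X : nat -> T -> R) Y :
  (forall i, (i < m)%N -> square_integrable (X i)) -> square_integrable Y ->
  inner (fun w => \sum_(i < m) X i w) Y = \sum_(i < m) inner (X i) Y.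
Proof.
move=> + sY; elim: m => [|m IH] sX.
  by rewrite big_ord0 -[RHS](inner0l Y); congr inner; apply/funext => w; rewrite big_ord0.
rewrite big_ord_recr /= -IH; last by move=> i im; exact/sX/ltnW.
rewrite -innerDl//; last 2 first.
- by apply: square_integrable_sum => i im; exact/sX/ltnW.
- exact: sX.
by congr inner; apply/funext => w; rewrite big_ord_recr.
Qed.

Lemma inner_sumr m (X : nat -> T -> R) Y :
  (forall i, (i < m)%N -> square_integrable (X i)) -> square_integrable Y ->
  inner Y (fun w => \sum_(i < m) X i w) = \sum_(i < m) inner Y (X i).
Proof.
by move=> sX sY; rewrite innerC inner_suml//; apply: eq_bigr => i _; rewrite innerC.
Qed.

Lemma inner_ge0 X : 0 <= inner X X.
Proof. by apply: Rintegral_ge0 => w _; rewrite -expr2 sqr_ge0. Qed.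

Lemma inner_cauchy_schwarz X Y : square_integrable X -> square_integrable Y ->
  inner X Y ^+ 2 <= inner X X * inner Y Y.
Proof.
move=> sX sY.
have Q (t u : R) : 0 <= t ^+ 2 * inner X X + 2 * t * u * inner X Y + u ^+ 2 * inner Y Y.
  have sXY : square_integrable (fun w => t * X w + u * Y w).
    by apply: square_integrableD; exact: square_integrableZ.
  have sX' := square_integrableZ t sX; have sY' := square_integrableZ u sY.
  have := inner_ge0 (fun w => t * X w + u * Y w).
  rewrite innerDl// !innerDr// !innerZl// !innerZr// (innerC Y X).
  by congr (_ <= _); ring.
have X0 := inner_ge0 X; have Y0 := inner_ge0 Y.
(* These two choices give the claim multiplied by [inner Y Y] and by [inner X X]; the choice
   [(1, - inner X Y)] settles the case where both are zero. *)
have := Q (inner Y Y) (- inner X Y); have := Q (inner X Y) (- inner X X).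
have := Q 1 1; have := Q 1 (-1); have := Q 1 (- inner X Y).
move: (inner X X) (inner Y Y) (inner X Y) X0 Y0 => a b c a0 b0 h1 h2 h3 h4 h5.
move: a0; rewrite le_eqVlt => /predU1P[a0|a0]; last first.
  rewrite -subr_ge0 -(pmulr_rge0 _ a0); apply: le_trans h4 _.
  by rewrite le_eqVlt; apply/orP; left; apply/eqP; ring.
move: b0; rewrite le_eqVlt => /predU1P[b0|b0]; last first.
  rewrite -subr_ge0 -(pmulr_rge0 _ b0); apply: le_trans h5 _.
  by rewrite le_eqVlt; apply/orP; left; apply/eqP; ring.
have : c ^+ 2 <= 0 by move: h1; rewrite -a0 -b0; lra.
by rewrite -a0 mul0r.
Qed.

Lemma inner_norm_le X Y : square_integrable X -> square_integrable Y ->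
  `|inner X Y| <= Num.sqrt (inner X X) * Num.sqrt (inner Y Y).
Proof.
move=> sX sY; rewrite -sqrtrM ?inner_ge0// -sqrtr_sqr ler_sqrt ?inner_cauchy_schwarz//.
by rewrite mulr_ge0// inner_ge0.
Qed.

Lemma inner_cvg0 (X : nat -> T -> R) Y :
  (forall j, square_integrable (X j)) -> square_integrable Y ->
  (fun j => inner (X j) (X j)) @ \oo --> (0 : R) ->
  (fun j => inner (X j) Y) @ \oo --> (0 : R).
Proof.
move=> sX sY X0.
apply/norm_cvg0P; apply: (@squeeze_cvgr _ _ _ _ (cst 0)
  (fun j => Num.sqrt (inner (X j) (X j)) * Num.sqrt (inner Y Y))).
- by near=> j; rewrite normr_ge0 inner_norm_le.
- exact: cvg_cst.
- rewrite -[X in _ --> X](mul0r (Num.sqrt (inner Y Y))); apply: cvgM; last exact: cvg_cst.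
  rewrite -[X in _ --> X]sqrtr0.
  exact: (cvg_comp (fun j => inner (X j) (X j)) Num.sqrt X0 (@sqrt_continuous R 0)).
Unshelve. all: end_near. Qed.

Lemma inner_cvg (X Y : nat -> T -> R) X' Y' :
  (forall j, square_integrable (X j)) -> (forall j, square_integrable (Y j)) ->
  square_integrable X' -> square_integrable Y' ->
  (fun j => inner (fun w => X j w - X' w) (fun w => X j w - X' w)) @ \oo --> (0 : R) ->
  (fun j => inner (fun w => Y j w - Y' w) (fun w => Y j w - Y' w)) @ \oo --> (0 : R) ->
  (fun j => inner (X j) (Y j)) @ \oo --> inner X' Y'.
Proof.
move=> sX sY sX' sY' cX cY.
have sXB j := square_integrableB (sX j) sX'; have sYB j := square_integrableB (sY j) sY'.
have c1 := inner_cvg0 sXB sY' cX.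
have c2 := inner_cvg0 sYB sX' cY.
have c3 : (fun j => inner (fun w => X j w - X' w) (fun w => Y j w - Y' w)) @ \oo --> (0 : R).
  apply/norm_cvg0P; apply: (@squeeze_cvgr _ _ _ _ (cst 0)
    (fun j => Num.sqrt (inner (fun w => X j w - X' w) (fun w => X j w - X' w)) *
      Num.sqrt (inner (fun w => Y j w - Y' w) (fun w => Y j w - Y' w)))).
  - by near=> j; rewrite normr_ge0 inner_norm_le.
  - exact: cvg_cst.
  - have s0 (u : nat -> R) : u @ \oo --> (0 : R) -> (fun j => Num.sqrt (u j)) @ \oo --> (0 : R).
      move=> u0; rewrite -[X in _ --> X]sqrtr0.
      exact: (cvg_comp u Num.sqrt u0 (@sqrt_continuous R 0)).
    by rewrite -[X in _ --> X](mul0r 0); apply: cvgM; exact: s0.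
have -> : (fun j => inner (X j) (Y j)) = fun j =>
    inner (fun w => X j w - X' w) (fun w => Y j w - Y' w) +
    (inner (fun w => X j w - X' w) Y' + (inner (fun w => Y j w - Y' w) X' + inner X' Y')).
  apply/funext => j; rewrite innerBr// !innerBl// (innerC X' Y') (innerC (Y j) X').
  by rewrite (innerC Y' X'); ring.
rewrite -[X in _ --> X]add0r; apply: cvgD => //.
rewrite -[X in _ --> X]add0r; apply: cvgD => //.
by rewrite -[X in _ --> X]add0r; apply: cvgD => //; exact: cvg_cst.
Unshelve. all: end_near. Qed.

Lemma integral_sqr_inner X : square_integrable X ->
  (\int[P]_w (X w ^+ 2)%:E)%E = (inner X X)%:E.
Proof.
move=> [mX iX]; rewrite /inner /Rintegral fineK.
  by apply: eq_integral => w _; rewrite expr2.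
exact: (integrable_fin_num measurableT iX).
Qed.

(** This is how [z] gets a second moment: it lies at finite mean square distance from a finite
    sum. *)
Lemma square_integrable_near X Y : measurable_fun setT X -> square_integrable Y ->
  (\int[P]_w ((X w - Y w) ^+ 2)%:E < +oo)%E -> square_integrable X.
Proof.
move=> mX sY fi; have [mY iY] := sY.
have sXY : square_integrable (fun w => X w - Y w).
  split; first exact: measurable_funB.
  apply/integrableP; split.
    by apply/measurable_EFinP/measurable_funX; exact: measurable_funB.
  apply: le_lt_trans fi; rewrite le_eqVlt; apply/orP; left; apply/eqP.
  by apply: eq_integral => w _; rewrite /= ger0_norm// sqr_ge0.
have := square_integrableD sXY sY.
by congr square_integrable; apply/funext => w; rewrite subrK.
Qed.

End square_integrable.

(** * Approximation of the stationary process by sums *)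

Section fOU_approximation.
Context d {T : measurableType d} {R : realType} (P : probability T R).
Implicit Types (X Y Z : T -> R).

Lemma mean_square_distE X Y :
  mean_square_dist P X Y = (\int[P]_w ((X w - Y w) ^+ 2)%:E)%E.
Proof. by rewrite /mean_square_dist expectation.unlock. Qed.

(** From [(a + b)^2 <= 2 a^2 + 2 b^2]. As the distance may be infinite, measurability is enough. *)
Lemma mean_square_dist_triangle X Y Z : measurable_fun setT X -> measurable_fun setT Y ->
  measurable_fun setT Z ->
  (mean_square_dist P X Z <= 2%:E * mean_square_dist P X Y + 2%:E * mean_square_dist P Y Z)%E.
Proof.
move=> mX mY mZ; rewrite !mean_square_distE.
have m2 (U V : T -> R) : measurable_fun setT U -> measurable_fun setT V ->
    measurable_fun setT (fun w => ((U w - V w) ^+ 2)%:E : \bar R).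
  by move=> mU mV; apply/measurable_EFinP/measurable_funX; exact: measurable_funB.
rewrite -!ge0_integralZl//; try exact: m2; try by move=> w _; rewrite lee_fin sqr_ge0.
rewrite -ge0_integralD//; last 4 first.
- by move=> w _; rewrite -EFinM lee_fin mulr_ge0// sqr_ge0.
- by apply: measurable_funeM; exact: m2.
- by move=> w _; rewrite -EFinM lee_fin mulr_ge0// sqr_ge0.
- by apply: measurable_funeM; exact: m2.
apply: ge0_le_integral => //; last 1 first.
- move=> w _; rewrite -!EFinM -EFinD lee_fin.
  by have := sqr_ge0 (X w - 2 * Y w + Z w); move: (X w) (Y w) (Z w) => x y z; nra.
- by move=> w _; rewrite lee_fin sqr_ge0.
- exact: m2.
- by apply: emeasurable_funD; apply: measurable_funeM; exact: m2.
Qed.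

Definition uniform_partition (a h : R) m : seq R := [seq a + i.+1%:R * h | i <- iota 0 m].

Lemma nth_uniform_partition (a b h : R) m i : (i <= m)%N ->
  nth b (a :: uniform_partition a h m) i = a + i%:R * h.
Proof.
case: i => [|i] im /=; first by rewrite mul0r addr0.
by rewrite (nth_map 0%N) ?size_iota// nth_iota.
Qed.

Lemma size_uniform_partition (a h : R) m : size (uniform_partition a h m) = m.
Proof. by rewrite size_map size_iota. Qed.

(** The steps are numbered backwards from [b], so that an exponential kernel becomes a power of
    index [i]. *)
Definition right_sum (f : R -> R) (X : R -> T -> R) (b h : R) m w :=
  \sum_(i < m) f (b - i%:R * h) * (X (b - i%:R * h) w - X (b - i.+1%:R * h) w).

Lemma wiener_integral_uniform (f : R -> R) (X : R -> T -> R) a b I :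
  wiener_integral P f X a b I ->
  forall eps : R, 0 < eps -> exists2 delta : R, 0 < delta & forall h m,
    0 < h < delta -> b = a + m%:R * h ->
    (mean_square_dist P I (right_sum f X b h m) <= eps%:E)%E.
Proof.
move=> wI eps e0; have [delta d0 hd] := wI _ e0; exists delta => // h m /andP[h0 hdelta] bE.
have := hd (uniform_partition a h m) (fun i => a + i.+1%:R * h).
have nE := @nth_uniform_partition a b h m.
have p1 : tagged_partition a b (uniform_partition a h m) (fun i => a + i.+1%:R * h).
  split; last first.
    move=> i; rewrite size_uniform_partition => im.
    by rewrite !nE// 1?ltnW// lexx andbT lerD2l ler_pM2r// ler_nat.
  split.
    apply/(pathP b) => i; rewrite size_uniform_partition => im.
    have := nE i.+1 im => /= ->; rewrite (nE i) 1?ltnW//.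
    by rewrite ltrD2l ltr_pM2r// ltr_nat.
  rewrite (last_nth b) size_uniform_partition.
  by rewrite nE// bE.
have p2 : mesh_lt a b (uniform_partition a h m) delta.
  move=> i; rewrite size_uniform_partition => im; rewrite !nE// 1?ltnW//.
  by rewrite opprD addrACA subrr add0r -mulrBl -natrB// subSnn mul1r.
move=> /(_ p1 p2); congr (mean_square_dist P _ _ <= _)%E.
apply/funext => w; rewrite /RS_sum /right_sum size_uniform_partition big_mkord.
rewrite (reindex_inj rev_ord_inj) /=; apply: eq_bigr => i _.
have im : (i < m)%N by [].
have E1 : (m - i.+1).+1 = (m - i)%N by rewrite subnSK.
have := nE (m - i.+1).+1; rewrite /= => ->; last by rewrite E1 leq_subr.
rewrite nE ?leq_subr// E1.
have Eb k : (k <= m)%N -> a + (m - k)%:R * h = b - k%:R * h.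
  by move=> km; rewrite bE natrB//; ring.
by rewrite !Eb// ltnW.
Qed.

(* Sum with [m] terms and step [h] for the moving average
   [\int_(-oo)^t exp (- lambda (t - s)) sigma dB(s)]. *)
Definition fOU_sum (lambda sigma : R) (B : R -> T -> R) (t h : R) m w : R :=
  \sum_(i < m) expR (- (lambda * h)) ^+ i * sigma *
    (B (t - i%:R * h) w - B (t - i.+1%:R * h) w).

Lemma measurable_fOU_sum lambda sigma (B : R -> {RV P >-> R}) t h m :
  measurable_fun setT (fOU_sum lambda sigma B t h m).
Proof.
rewrite /fOU_sum; apply: measurable_sum => i; apply: measurable_funM => //.
exact: measurable_funB.
Qed.

(** Since [t] is an integer and the step is [1/q], the time 0 is a grid point: the first [t q] steps
    cover [[0, t]], the last [L q] cover [[-L, 0]] and are damped by [exp (- lambda t)]. *)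
Lemma fOU_sum_split lambda sigma (B : R -> T -> R) (t L q : nat) w : (0 < q)%N ->
  fOU_sum lambda sigma B t%:R q%:R^-1 ((L + t) * q) w =
  expR (- (lambda * t%:R)) *
    right_sum (fun s => expR (lambda * s) * sigma) B 0 q%:R^-1 (L * q) w +
  right_sum (fun s => expR (- lambda * (t%:R - s)) * sigma) B t%:R q%:R^-1 (t * q) w.
Proof.
move=> q0; have qn0 : q%:R != 0 :> R by rewrite pnatr_eq0 -lt0n.
rewrite /fOU_sum /right_sum mulnDl addnC big_split_ord /= addrC; congr (_ + _).
- rewrite big_distrr /=; apply: eq_bigr => i _.
  have E j : t%:R - (t * q + j)%:R / q%:R = 0 - j%:R / q%:R :> R.
    by rewrite natrD natrM; field.
  rewrite -addnS !E !mulrA; congr (_ * sigma * _).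
  rewrite -expRM_natr -expRD; congr expR.
  by rewrite natrD natrM; field.
- apply: eq_bigr => i _; congr (_ * sigma * _).
  by rewrite -expRM_natr; congr expR; field.
Qed.

(** One pair [(L, q)] serves all times up to [n]: the sums at different times then have the same
    step and start at the same point [-L]. *)
Lemma stationary_fOU_approx lambda sigma (B z : R -> {RV P >-> R}) :
  0 < lambda -> stationary_fOU lambda sigma B z ->
  forall (n L0 : nat) (eps : R), 0 < eps -> exists L q : nat,
    [/\ (L0 <= L)%N, (L0 < q)%N & forall t, (t <= n)%N ->
      (mean_square_dist P (z t%:R)
        (fOU_sum lambda sigma B t%:R q%:R^-1 ((L + t) * q)) <= eps%:E)%E].
Proof.
move=> l0 [[J wJ Jcvg] wz] n L0 eps e0.
(* The triangle inequality doubles errors: the part before time 0 uses it once for the cut at [-L]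
   and the Riemann sum, at cost [4 e1], and adding the part after 0 gives [2 * 4 e1 + 2 * e1]. *)
pose e1 := eps / 10; have e10 : 0 < e1 by rewrite divr_gt0.
have [L L0L hL] : exists2 L : nat, (L0 <= L)%N &
    (mean_square_dist P (z 0%R) (J (- L%:R)%R) <= e1%:E)%E.
  have : \forall a \near -oo, (mean_square_dist P (z 0%R) (J a) < e1%:E)%E.
    have := Jcvg [set x | (x < e1%:E)%E]; apply; apply: open_nbhs_nbhs.
    by split; [exact: open_ereal_lt_ereal|rewrite /= lte_fin].
  move=> [M [Mreal hM]].
  have [k _ hk] := nbhs_infty_ger (- M + 1).
  exists (maxn L0 k); first exact: leq_maxl.
  apply/ltW/hM; have := hk _ (leq_maxr L0 k) => /=; lra.
have [d0 d00 hd0] := wiener_integral_uniform (wJ (- L%:R) (ltac:(by rewrite oppr_le0)) ) e10.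
have wz' (t : nat) : exists W : {RV P >-> R},
    wiener_integral P (fun s => expR (- lambda * (t%:R - s)) * sigma) B 0 t%:R W /\
    {ae P, forall w, z t%:R w = z 0 w * expR (- lambda * t%:R) + W w}.
  by have [W h1 h2] := wz t%:R (ler0n _ t); exists W.
have [I hI] := choice wz'.
(* The minimum, built by induction, of the mesh bounds for the finitely many times. *)
have [d1 d10 hd1] : exists2 d1 : R, 0 < d1 & forall t, (t <= n)%N -> forall h m,
    0 < h < d1 -> t%:R = 0 + m%:R * h ->
    (mean_square_dist P (I t) (right_sum (fun s => expR (- lambda * (t%:R - s)) * sigma)%R
      B t%:R h m) <= e1%:E)%E.
  elim: n => [|n [d1 d10 IH]].
    have [d1 d10 hd] := wiener_integral_uniform (proj1 (hI 0%N)) e10.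
    by exists d1 => // t; rewrite leqn0 => /eqP ->.
  have [d2 d20 hd] := wiener_integral_uniform (proj1 (hI n.+1)) e10.
  exists (Num.min d1 d2); first by rewrite lt_min d10.
  move=> t; rewrite leq_eqVlt => /predU1P[->|tn] h m; rewrite lt_min => /andP[h0 /andP[h1 h2]].
    by apply: hd; rewrite h0.
  by apply: IH => //; rewrite h0.
have [q qL qd] : exists2 q : nat, (L0 < q)%N & q%:R^-1 < Num.min d0 d1.
  have m0 : 0 < Num.min d0 d1 by rewrite lt_min d00.
  have [k _ hk] := nbhs_infty_gtr (Num.min d0 d1)^-1.
  exists (maxn L0.+1 k); first exact: leq_maxl.
  have := hk _ (leq_maxr L0.+1 k) => /= h.
  by rewrite invf_plt ?posrE// ltr0n leq_max.
have q0 : (0 < q)%N by exact: leq_ltn_trans qL.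
have qn0 : q%:R != 0 :> R by rewrite pnatr_eq0 -lt0n.
have h0 : 0 < q%:R^-1 :> R by rewrite invr_gt0 ltr0n.
move: qd; rewrite lt_min => /andP[qd0 qd1].
exists L, q; split => // t tn.
set S0 := right_sum (fun s => expR (lambda * s) * sigma) B 0 q%:R^-1 (L * q).
set S1 := right_sum (fun s => expR (- lambda * (t%:R - s)) * sigma) B t%:R q%:R^-1 (t * q).
have mR f b h m : measurable_fun setT (right_sum f B b h m).
  by apply: measurable_sum => i; apply: measurable_funM => //; exact: measurable_funB.
have h1 : (mean_square_dist P (z 0%R) S0 <= (4 * e1)%:E)%E.
  have mz := @measurable_funPT _ _ _ _ (z 0); have mJ := @measurable_funPT _ _ _ _ (J (- L%:R)).
  apply: (le_trans (mean_square_dist_triangle mz mJ (mR _ _ _ _))).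
  rewrite (_ : (4 * e1)%:E = 2%:E * e1%:E + 2%:E * e1%:E)%E; last first.
    by rewrite -!EFinM -EFinD; congr EFin; ring.
  apply: leeD; rewrite lee_pmul2l//.
  by apply: hd0; rewrite ?h0// natrM; field.
have h2 : (mean_square_dist P (I t) S1 <= e1%:E)%E.
  by apply: hd1 => //; rewrite ?h0// natrM add0r; field.
pose e := expR (- (lambda * t%:R)).
have e_le1 : e <= 1 by rewrite -expR0 ler_expR oppr_le0 mulr_ge0// ltW.
have eE w : fOU_sum lambda sigma B t%:R q%:R^-1 ((L + t) * q) w = e * S0 w + S1 w.
  exact: fOU_sum_split.
have msz := @measurable_funPT _ _ _ _ (z 0); have mI := @measurable_funPT _ _ _ _ (I t).
have mS0 : measurable_fun setT S0 by exact: mR.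
have mS1 : measurable_fun setT S1 by exact: mR.
have -> : mean_square_dist P (z t%:R)
    (fOU_sum lambda sigma B t%:R q%:R^-1 ((L + t) * q)) =
    mean_square_dist P (fun w => e * z 0 w + I t w) (fun w => e * S0 w + S1 w).
  rewrite !mean_square_distE; apply: ae_eq_integral => //.
  - apply/measurable_EFinP/measurable_funX/measurable_funB => //.
    exact: measurable_fOU_sum.
  - apply/measurable_EFinP/measurable_funX/measurable_funB => //.
      by apply: measurable_funD => //; exact: measurable_funM.
    by apply: measurable_funD => //; exact: measurable_funM.
  - have := proj2 (hI t); apply: filterS => w hw _.
    by rewrite hw eE mulNr -/e (mulrC (z 0 w)).
have mid : measurable_fun setT (fun w => e * S0 w + I t w).
  by apply: measurable_funD => //; exact: measurable_funM.
apply: le_trans (mean_square_dist_triangle _ mid _) _ => //.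
- by apply: measurable_funD => //; exact: measurable_funM.
- by apply: measurable_funD => //; exact: measurable_funM.
rewrite (_ : eps%:E = 2%:E * (4 * e1)%:E + 2%:E * e1%:E)%E; last first.
  by rewrite -!EFinM -EFinD; congr EFin; rewrite /e1; field.
apply: leeD; rewrite lee_pmul2l//.
- apply: le_trans h1; rewrite !mean_square_distE; apply: ge0_le_integral => //.
  + by move=> w _; rewrite lee_fin sqr_ge0.
  + apply/measurable_EFinP/measurable_funX/measurable_funB => //.
    by apply: measurable_funD => //; exact: measurable_funM.
  + by apply/measurable_EFinP/measurable_funX/measurable_funB.
  + move=> w _; rewrite lee_fin (_ : _ - _ = e * (z 0 w - S0 w)); last by ring.
    by rewrite exprMn ler_piMl ?sqr_ge0// exprn_ile1// expR_ge0.
- apply: le_trans h2; rewrite !mean_square_distE le_eqVlt; apply/orP; left; apply/eqP.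
  by apply: eq_integral => w _; congr ((_ ^+ 2)%:E); ring.
Qed.

End fOU_approximation.

(** * Variances and covariances of the approximating sums *)

Section fBm_moments.
Context d {T : measurableType d} {R : realType} (P : probability T R).
Variables (H : R) (B : R -> {RV P >-> R}).
Hypotheses (H0 : 0 < H) (H1 : H < 1) (hB : fractional_brownian_motion H B).
Local Notation p := (2 * H).
Local Notation inner := (inner P).
Local Notation square_integrable := (square_integrable P).

Let p0 : 0 < p. Proof. by rewrite mulr_gt0. Qed.

Lemma covariance_centered (X Y : T -> R) : ('E_P[X] = 0)%E -> ('E_P[Y] = 0)%E ->
  covariance P X Y = (\int[P]_w (X w * Y w)%:E)%E.
Proof.
move=> X0 Y0; rewrite covariance.unlock expectation.unlock.
apply: eq_integral => w _ /=.
move: X0 Y0; rewrite expectation.unlock => -> ->.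
by rewrite /GRing.mul /= !subr0.
Qed.

Lemma fBm_square_integrable t : square_integrable (B t).
Proof.
have [_ E0 cov] := hB.
split; first exact: measurable_funPT.
apply/integrableP; split; first exact/measurable_EFinP/measurable_funX/measurable_funPT.
have := cov t t; rewrite covariance_centered//.
rewrite (_ : (fun w => _) = fun w => `|((B t w) ^+ 2)%:E|%E).
  by move=> ->; rewrite ltry.
by apply/funext => w; rewrite /= -expr2 ger0_norm// sqr_ge0.
Qed.

Lemma fBm_inner s t :
  inner (B s) (B t) = 2^-1 * (`|s| `^ p + `|t| `^ p - `|t - s| `^ p).
Proof.
have [_ E0 cov] := hB.
by have := cov s t; rewrite covariance_centered// /inner /Rintegral => ->.
Qed.

Lemma fBm_increment_inner a b c e :
  inner (fun w => B a w - B b w) (fun w => B c w - B e w) =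
  2^-1 * (`|a - e| `^ p + `|b - c| `^ p - `|a - c| `^ p - `|b - e| `^ p).
Proof.
have sB := fBm_square_integrable.
rewrite innerBl ?innerBr//; last exact: square_integrableB.
rewrite !fBm_inner (distrC e a) (distrC c b) (distrC c a) (distrC e b).
move: (_ `^ p) (_ `^ p) (_ `^ p) => x1 x2 x3; move: (_ `^ p) (_ `^ p) (_ `^ p) => x4 x5 x6.
move: (_ `^ p) (_ `^ p) => x7 x8; by field.
Qed.

Variables (lambda sigma : R).
Hypotheses (l0 : 0 < lambda) (s0 : 0 < sigma).
Local Notation S := (fOU_sum lambda sigma B).

Lemma fOU_sumS t h m w : S t h m.+1 w = S t h m w +
  expR (- (lambda * h)) ^+ m * sigma * (B (t - m%:R * h) w - B (t - m.+1%:R * h) w).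
Proof. by rewrite /fOU_sum big_ord_recr. Qed.

Lemma square_integrable_fOU_sum t h m : square_integrable (S t h m).
Proof.
apply: (@square_integrable_sum _ _ _ _ _ (fun i w => expR (- (lambda * h)) ^+ i * sigma *
    (B (t - i%:R * h) w - B (t - i.+1%:R * h) w))) => i _.
apply: square_integrableZ.
by apply: square_integrableB; exact: fBm_square_integrable.
Qed.

Lemma fBm_grid_inner t h (i j : nat) : 0 < h -> (i <= j)%N ->
  inner (fun w => B (t - i%:R * h) w - B (t - i.+1%:R * h) w)
        (fun w => B (t - j%:R * h) w - B (t - j.+1%:R * h) w) =
  2^-1 * (((j - i).+1%:R * h) `^ p + `|((j - i)%:R - 1) * h| `^ p
    - 2 * ((j - i)%:R * h) `^ p).
Proof.
move=> h0 ij; rewrite fBm_increment_inner; congr (_ * _).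
have nn (k : nat) : 0 <= k%:R * h by rewrite mulr_ge0// ltW.
have jiE : (j - i)%:R = j%:R - i%:R :> R by rewrite natrB.
have -> : t - i%:R * h - (t - j.+1%:R * h) = (j - i).+1%:R * h.
  by rewrite -(natr1 j) -(natr1 (j - i)) jiE; ring.
have -> : t - i.+1%:R * h - (t - j%:R * h) = ((j - i)%:R - 1) * h.
  by rewrite -(natr1 i) jiE; ring.
have -> : t - i%:R * h - (t - j%:R * h) = (j - i)%:R * h by rewrite jiE; ring.
have -> : t - i.+1%:R * h - (t - j.+1%:R * h) = (j - i)%:R * h.
  by rewrite -(natr1 i) -(natr1 j) jiE; ring.
by rewrite !(ger0_norm (nn _)); ring.
Qed.

(** Appending one step to the sum adds its own variance and its covariances with the previous steps.
    After scaling by [lambda^p / sigma^2] this is the recursion of [geom_variance_bounds] with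
    [c j = (j lambda h)^p]. *)
Lemma fOU_sum_variance_bounds t h m : 0 < h ->
  gamma_riemann p (lambda * h) m <=
    (1 + expR (- (lambda * h))) * expR (- (lambda * h)) *
      (lambda `^ p / sigma ^+ 2 * inner (S t h m) (S t h m))
    <= gamma_riemann p (lambda * h) m +
      expR (- (lambda * h)) ^+ m.+1 * (m%:R * (lambda * h)) `^ p.
Proof.
move=> h0; pose c j := (j%:R * (lambda * h)) `^ p.
have lh0 : 0 < lambda * h by rewrite mulr_gt0.
have lp0 : 0 < lambda `^ p by rewrite powR_gt0.
apply: (@geom_variance_bounds R (expR (- (lambda * h))) c _ _ _ _
  (fun m => lambda `^ p / sigma ^+ 2 * inner (S t h m) (S t h m))).
- exact: expR_gt0.
- by rewrite expR_lt1 oppr_lt0.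
- by rewrite /c mul0r powR0// gt_eqF.
- move=> j; rewrite /c ge0_ler_powR ?nnegrE// ?(ltW p0) ?mulr_ge0 ?(ltW l0) ?(ltW h0)//.
  by rewrite ler_wpM2r ?(ltW lh0)// ler_nat.
- rewrite (_ : S t h 0 = fun=> 0) ?inner0l ?mulr0//.
  by apply/funext => w; rewrite /fOU_sum big_ord0.
- move=> {}m; set r := expR _.
  pose x i w := B (t - i%:R * h) w - B (t - i.+1%:R * h) w.
  have sx i : square_integrable (x i).
    by apply: square_integrableB; exact: fBm_square_integrable.
  have -> : S t h m.+1 = fun w => S t h m w + r ^+ m * sigma * x m w.
    by apply/funext => w; rewrite fOU_sumS.
  have sS := square_integrable_fOU_sum t h m.
  have sxm := square_integrableZ (r ^+ m * sigma) (sx m).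
  rewrite innerDl ?innerDr//; last exact: square_integrableD.
  rewrite (innerC P (fun w => r ^+ m * sigma * x m w)) !innerZr//.
  rewrite innerZl// (_ : inner (S t h m) (x m) =
      \sum_(i < m) r ^+ i * sigma * inner (x i) (x m)); last first.
    rewrite [LHS](@inner_suml _ _ _ P m (fun i w => r ^+ i * sigma * x i w))//.
      by apply: eq_bigr => i _; rewrite innerZl.
    by move=> i _; exact: square_integrableZ.
  have cE k : c k = lambda `^ p * (k%:R * h) `^ p.
    by rewrite /c mulrCA powRM// ?(ltW l0)// mulr_ge0// ltW.
  have -> : inner (x m) (x m) = (1%:R * h) `^ p.
    rewrite fBm_grid_inner// subnn sub0r mulN1r normrN (gtr0_norm h0) !mul0r.
    by rewrite powR0 ?gt_eqF// mul1r; field.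
  rewrite cE.
  have -> : \sum_(i < m) r ^+ i * sigma * inner (x i) (x m) = 2^-1 * (lambda `^ p)^-1 * sigma *
      \sum_(i < m) r ^+ i * (c (m - i).+1 + c (m - i).-1 - 2 * c (m - i)%N).
    rewrite big_distrr /=; apply: eq_bigr => i _.
    have im : (i < m)%N by [].
    rewrite fBm_grid_inner ?(ltnW im)// !cE.
    have -> : `|((m - i)%:R - 1) * h| = (m - i).-1%:R * h.
      rewrite -{1}(prednK (_ : (0 < m - i)%N)) ?subn_gt0//.
      by rewrite -natr1 addrK ger0_norm// mulr_ge0// ltW.
    by field; rewrite gt_eqF.
  by move: (\sum_(i < m) _) => W; field; rewrite !gt_eqF.
Qed.

(** Weights and nodes of the truncated geometric law of [geom_abel], with the leftover mass stored
    at index [m], so that one sum of [m + 1] terms describes the whole average. *)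
Let abel_weight (r : R) m i : R := (if (i < m)%N then 1 - r else 1) * r ^+ i.
Let abel_node m i : nat := if (i < m)%N then i.+1 else m.

Let sum_abel (r : R) m (F : R -> nat -> R) :
  \sum_(i < m.+1) F (abel_weight r m i) (abel_node m i) =
  F (r ^+ m) m + \sum_(i < m) F ((1 - r) * r ^+ i) i.+1.
Proof.
rewrite big_ord_recr /= addrC /abel_weight /abel_node ltnn mul1r; congr (_ + _).
by apply: eq_bigr => i _; rewrite ltn_ord.
Qed.

Let fOU_sum_abel t h m w : S t h m w = \sum_(i < m.+1)
  (sigma * abel_weight (expR (- (lambda * h))) m i) * (B t w - B (t - (abel_node m i)%:R * h) w).
Proof.
set r := expR _.
rewrite (@sum_abel r m (fun x j => sigma * x * (B t w - B (t - j%:R * h) w))).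
have := geom_abel r (fun i => B (t - i%:R * h) w) m; rewrite mul0r subr0 => E.
rewrite /fOU_sum -/r; under eq_bigr do rewrite mulrAC.
rewrite -big_distrl /= E mulrDl big_distrl /=; congr (_ + _); first by ring.
by apply: eq_bigr => i _; ring.
Qed.

(** Averaging the bound [C (x^2 + y^2) / 2] on the covariances of the increments leaves two second
    moments of truncated geometric laws, each at most [2 h^2 / (1 - r)^2]. The outcome does not
    depend on the numbers of terms. *)
Lemma fOU_sum_covariance_le s t h m m' C : 0 < h -> s < t -> 0 <= C ->
  (forall x y, 0 <= x -> 0 <= y ->
    `| `|t - s + x| `^ p + `|t - s - y| `^ p - `|t - s| `^ p - `|t - s + x - y| `^ p |
    <= C * (x ^+ 2 + y ^+ 2)) ->
  `|inner (S s h m) (S t h m')| <= 2 * sigma ^+ 2 * C * ((1 + lambda * h) / lambda) ^+ 2.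
Proof.
move=> h0 st C0 hC; set r := expR (- (lambda * h)).
have lh0 : 0 < lambda * h by rewrite mulr_gt0.
have r0 : 0 < r by exact: expR_gt0.
have r1 : r < 1 by rewrite expR_lt1 oppr_lt0.
have w0 k i : 0 <= abel_weight r k i.
  by rewrite /abel_weight mulr_ge0 ?exprn_ge0 ?(ltW r0)//; case: ifP => // _; rewrite subr_ge0 ltW.
have w1 k : \sum_(i < k.+1) abel_weight r k i = 1.
  by rewrite (@sum_abel r k (fun x _ => x)) geom_weights_sum1.
have w2 k : \sum_(i < k.+1) abel_weight r k i * ((abel_node k i)%:R * h) ^+ 2 <=
    h ^+ 2 * (2 / (1 - r) ^+ 2).
  rewrite (@sum_abel r k (fun x j => x * (j%:R * h) ^+ 2)).
  have -> : r ^+ k * (k%:R * h) ^+ 2 + \sum_(i < k) (1 - r) * r ^+ i * (i.+1%:R * h) ^+ 2 =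
      h ^+ 2 * (r ^+ k * k%:R ^+ 2 + \sum_(i < k) (1 - r) * r ^+ i * i.+1%:R ^+ 2).
    rewrite mulrDr big_distrr /=; congr (_ + _); first by ring.
    by apply: eq_bigr => i _; ring.
  by rewrite ler_wpM2l ?sqr_ge0// geom_second_moment// r0.
pose D t k i w := B t w - B (t - (abel_node k i)%:R * h) w.
have sD u k i : square_integrable (D u k i).
  by apply: square_integrableB; exact: fBm_square_integrable.
have E : inner (S s h m) (S t h m') = \sum_(i < m.+1) \sum_(j < m'.+1)
    sigma ^+ 2 * (abel_weight r m i * abel_weight r m' j) * inner (D s m i) (D t m' j).
  have -> : S s h m = fun w => \sum_(i < m.+1) (sigma * abel_weight r m i) * D s m i w.
    by apply/funext => w; exact: fOU_sum_abel.
  have -> : S t h m' = fun w => \sum_(i < m'.+1) (sigma * abel_weight r m' i) * D t m' i w.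
    by apply/funext => w; exact: fOU_sum_abel.
  rewrite (@inner_suml _ _ _ P m.+1 (fun i w => (sigma * abel_weight r m i) * D s m i w)).
  - apply: eq_bigr => i _.
    rewrite (@inner_sumr _ _ _ P m'.+1 (fun i w => (sigma * abel_weight r m' i) * D t m' i w)).
    + apply: eq_bigr => j _; rewrite innerZl ?innerZr//; first by ring.
      exact: square_integrableZ.
    + by move=> j _; exact: square_integrableZ.
    + exact: square_integrableZ.
  - by move=> i _; exact: square_integrableZ.
  - apply: (@square_integrable_sum _ _ _ P m'.+1 (fun i w => (sigma * abel_weight r m' i) * D t m' i w)).
    by move=> i _; exact: square_integrableZ.
pose x k i : R := (abel_node k i)%:R * h.
have x0 k i : 0 <= x k i by rewrite mulr_ge0// ltW.
have bD i j : `|inner (D s m i) (D t m' j)| <= 2^-1 * (C * (x m i ^+ 2 + x m' j ^+ 2)).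
  rewrite fBm_increment_inner normrM ger0_norm ?invr_ge0// ler_wpM2l ?invr_ge0//.
  have := hC _ _ (x0 m i) (x0 m' j); apply: le_trans.
  rewrite le_eqVlt; apply/orP; left; apply/eqP; congr (`| _ |).
  rewrite -/(x m i) -/(x m' j) (distrC s) (distrC (s - _)) (distrC s t) (distrC (s - _)).
  rewrite (_ : t - x m' j - s = t - s - x m' j); last by ring.
  rewrite (_ : t - (s - x m i) = t - s + x m i); last by ring.
  rewrite (_ : t - x m' j - (s - x m i) = t - s + x m i - x m' j); last by ring.
  by ring.
have F : \sum_(i < m.+1) \sum_(j < m'.+1)
    sigma ^+ 2 * (abel_weight r m i * abel_weight r m' j) *
      (2^-1 * (C * (x m i ^+ 2 + x m' j ^+ 2))) =
    sigma ^+ 2 * (2^-1 * C) * (\sum_(i < m.+1) abel_weight r m i * x m i ^+ 2 +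
      \sum_(j < m'.+1) abel_weight r m' j * x m' j ^+ 2).
  transitivity (\sum_(i < m.+1) sigma ^+ 2 * (2^-1 * C) * (abel_weight r m i * x m i ^+ 2 +
      abel_weight r m i * \sum_(j < m'.+1) abel_weight r m' j * x m' j ^+ 2)).
    apply: eq_bigr => i _.
    rewrite -{1}(mulr1 (abel_weight r m i * _)) -(w1 m') !mulr_sumr -big_split /= mulr_sumr.
    by apply: eq_bigr => j _; ring.
  by rewrite -mulr_sumr big_split /= -mulr_suml w1 mul1r.
have bS : `|inner (S s h m) (S t h m')| <= sigma ^+ 2 * (2^-1 * C) *
    (h ^+ 2 * (2 / (1 - r) ^+ 2) + h ^+ 2 * (2 / (1 - r) ^+ 2)).
  apply: (@le_trans _ _ (sigma ^+ 2 * (2^-1 * C) * (\sum_(i < m.+1) abel_weight r m i * x m i ^+ 2 +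
      \sum_(j < m'.+1) abel_weight r m' j * x m' j ^+ 2))).
    rewrite -F E; apply: (le_trans (ler_norm_sum _ _ _)); apply: ler_sum => i _.
    apply: (le_trans (ler_norm_sum _ _ _)); apply: ler_sum => j _.
    have q0 : 0 <= sigma ^+ 2 * (abel_weight r m i * abel_weight r m' j).
      by rewrite mulr_ge0 ?sqr_ge0// mulr_ge0.
    by rewrite normrM (ger0_norm q0) ler_wpM2l.
  apply: ler_wpM2l; first by apply: mulr_ge0; [exact: sqr_ge0|exact: mulr_ge0].
  by rewrite lerD// w2.
apply: (le_trans bS).
have r2 : 0 < 1 - r by rewrite subr_gt0.
(* Equivalent to [1 - exp (- u) >= u / (1 + u)] at [u = lambda h]. *)
have hr : h / (1 - r) <= (1 + lambda * h) / lambda.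
  rewrite ler_pdivrMr// mulrAC ler_pdivlMr//.
  have u1 : 0 < 1 + lambda * h by rewrite addr_gt0.
  have : r * (1 + lambda * h) <= 1.
    by rewrite /r expRN mulrC ler_pdivrMr ?expR_gt0// mul1r expR_ge1Dx.
  by lra.
have : (h / (1 - r)) ^+ 2 <= ((1 + lambda * h) / lambda) ^+ 2.
  by rewrite lerXn2r ?nnegrE ?divr_ge0// ltW// addr_gt0.
have -> : sigma ^+ 2 * (2^-1 * C) * (h ^+ 2 * (2 / (1 - r) ^+ 2) + h ^+ 2 * (2 / (1 - r) ^+ 2)) =
    2 * sigma ^+ 2 * C * (h / (1 - r)) ^+ 2.
  by field; rewrite gt_eqF.
by move=> hh; apply: ler_wpM2l => //; apply: mulr_ge0 => //; apply: mulr_ge0 => //; exact: sqr_ge0.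
Qed.

End fBm_moments.

(** * Moments of limits of Gaussian variables *)

Section gaussian_moments.
Context d {T : measurableType d} {R : realType} (P : probability T R).
Implicit Types (X Y Z : T -> R).
Local Notation inner := (inner P).
Local Notation square_integrable := (square_integrable P).
Local Notation N01 := (@normal_prob R 0 1).

(** The formula also covers the degenerate case: for [s = 0] the law is a Dirac mass and the
    integrand on the right is constant. *)
Lemma ge0_integral_gaussian X : measurable_fun setT X -> is_gaussian P X ->
  exists m s : R, 0 <= s /\ forall f : R -> R, continuous f -> (forall x, 0 <= f x) ->
    (\int[P]_w (f (X w))%:E = \int[N01]_x (f (m + s * x)%R)%:E)%E.
Proof.
move=> mX [m [s [s0 law]]]; exists m, s; split => // f cf f0.
have mf : measurable_fun setT (EFin \o f).
  by apply/measurable_EFinP; exact: continuous_measurable_fun.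
have E : (\int[P]_w (f (X w))%:E =
    \int[pushforward P (X : T -> measurableTypeR R)]_y (f y)%:E)%E.
  rewrite (@ge0_integral_pushforward _ _ T (measurableTypeR R) R X mX P setT (EFin \o f))//.
  by move=> x _; rewrite lee_fin.
rewrite E; move: s0; rewrite le_eqVlt => /predU1P[s0|s0].
- have -> : (\int[pushforward P (X : T -> measurableTypeR R)]_y (f y)%:E =
      \int[@dirac _ (measurableTypeR R) m R]_y (f y)%:E)%E.
    by apply: eq_measure_integral => A mA _; rewrite -[LHS]/(P (X @^-1` A)) law// -s0 eqxx.
  rewrite integral_dirac// diracT mul1e -s0.
  under eq_integral do rewrite mul0r addr0.
  by rewrite integral_cst// [X in (_ * X)%E]probability_setT mule1.
- rewrite -ge0_integral_normal_scale//.
  by apply: eq_measure_integral => A mA _; rewrite -[LHS]/(P (X @^-1` A)) law// gt_eqF.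
Qed.

Lemma normal_second_moment (b s : R) :
  (\int[N01]_x ((b + s * x) ^+ 2)%:E = (b ^+ 2 + s ^+ 2)%:E)%E.
Proof.
have i k c := integrableZl_EFin measurableT c (@integrable_expr_normal R k).
have iC := finite_measure_integrable_cst N01 (b ^+ 2).
have i1 := integrableD_EFin measurableT (i 1%N (2 * b * s)) (i 2%N (s ^+ 2)).
have i2 := integrableD_EFin measurableT (iC _ measurableT) i1.
transitivity ((\int[N01]_x (b ^+ 2 + (2 * b * s * x ^+ 1 + s ^+ 2 * x ^+ 2)))%:E)%E.
  rewrite /Rintegral fineK; last exact: (integrable_fin_num measurableT i2).
  by apply: eq_integral => x _; congr EFin; ring.
congr EFin; rewrite RintegralD//; last exact: iC.
rewrite RintegralD// !(RintegralZl _ measurableT (integrable_expr_normal _)).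
rewrite -!/(normal_moment _) normal_moment1 normal_moment2 Rintegral_cst1; ring.
Qed.

Lemma gaussian_centered X : is_gaussian P X -> square_integrable X -> \int[P]_w X w = 0 ->
  forall f : R -> R, continuous f -> (forall x, 0 <= f x) ->
  (\int[P]_w (f (X w))%:E = \int[N01]_x (f (Num.sqrt (inner X X) * x)%R)%:E)%E.
Proof.
move=> gX sX X0; have [mX iX] := sX.
have [m [s [s0 law]]] := ge0_integral_gaussian mX gX.
(* Only integrals of nonnegative functions are available: the mean [m] is shown
   to vanish by comparing the second moments of [X] and [X + 1]. *)
have q c : \int[P]_w ((X w + c) ^+ 2) = (m + c) ^+ 2 + s ^+ 2.
  rewrite /Rintegral (law (fun x => (x + c) ^+ 2)); last 2 first.
  - move=> x; apply: (@cvg_comp _ _ _ (fun x => x + c) (fun x => x ^+ 2)); last exact: exprn_continuous.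
    by apply: cvgD; [exact: cvg_id|exact: cvg_cst].
  - by move=> x; exact: sqr_ge0.
  under eq_integral do rewrite addrAC.
  by rewrite normal_second_moment.
have q0 : inner X X = m ^+ 2 + s ^+ 2.
  by have := q 0; rewrite addr0 => <-; apply: eq_Rintegral => w _; rewrite addr0 expr2.
have q1 : \int[P]_w ((X w + 1) ^+ 2) = inner X X + 1.
  transitivity (\int[P]_w (X w ^+ 2 + (2 * X w + 1))).
    by apply: eq_Rintegral => w _; ring.
  have iX1 := integrable_sqr_expr1 mX iX.
  have i2X := integrableZl_EFin measurableT 2 iX1.
  have i1 := finite_measure_integrable_cst P (1 : R) measurableT.
  rewrite RintegralD//; last exact: integrableD_EFin.
  rewrite RintegralD// RintegralZl// X0 mulr0 add0r Rintegral_cst1; congr (_ + _).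
have m0 : m = 0 by move: q1; rewrite q q0; lra.
move=> f cf f0; rewrite law// q0 m0 expr0n add0r sqrtr_sqr ger0_norm//.
by apply: eq_integral => x _; rewrite add0r.
Qed.

Lemma gaussian_even_moment X j : is_gaussian P X -> square_integrable X -> \int[P]_w X w = 0 ->
  (\int[P]_w (X w ^+ (2 * j))%:E = (inner X X ^+ j * @normal_moment R (2 * j))%:E)%E.
Proof.
move=> gX sX X0; rewrite (gaussian_centered gX sX X0 (f := fun x => x ^+ (2 * j))); last 2 first.
- exact: exprn_continuous.
- by move=> x; rewrite exprM exprn_ge0// sqr_ge0.
transitivity ((\int[N01]_x ((inner X X ^+ j) * x ^+ (2 * j)))%:E)%E.
  rewrite /Rintegral fineK.
    apply: eq_integral => x _; congr EFin; rewrite exprMn; congr (_ * _).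
    by rewrite exprM sqr_sqrtr// inner_ge0.
  have iZ := integrableZl_EFin measurableT (inner X X ^+ j) (@integrable_expr_normal R (2 * j)).
  exact: (integrable_fin_num measurableT iZ).
by rewrite (RintegralZl _ measurableT (integrable_expr_normal _)).
Qed.

Lemma gaussian_moment4 X : is_gaussian P X -> square_integrable X -> \int[P]_w X w = 0 ->
  (\int[P]_w (X w ^+ 4)%:E = (3 * inner X X ^+ 2)%:E)%E.
Proof.
move=> gX sX X0; rewrite (_ : 4 = 2 * 2)%N// gaussian_even_moment//.
by rewrite normal_moment4 mulrC.
Qed.

Lemma gaussian_moment6 X : is_gaussian P X -> square_integrable X -> \int[P]_w X w = 0 ->
  (\int[P]_w (X w ^+ 6)%:E = (15 * inner X X ^+ 3)%:E)%E.
Proof.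
move=> gX sX X0; rewrite (_ : 6 = 2 * 3)%N// gaussian_even_moment//.
by rewrite normal_moment6 mulrC.
Qed.

Lemma integrable_even_powers X : measurable_fun setT X ->
  (\int[P]_w (X w ^+ 6)%:E < +oo)%E ->
  square_integrable X /\ P.-integrable setT (EFin \o (fun w => X w ^+ 4)) /\
  P.-integrable setT (EFin \o (fun w => X w ^+ 6)).
Proof.
move=> mX fi.
have i6 : P.-integrable setT (EFin \o (fun w => X w ^+ 6)).
  apply/integrableP; split; first exact/measurable_EFinP/measurable_funX.
  apply: le_lt_trans fi; rewrite le_eqVlt; apply/orP; left; apply/eqP.
  by apply: eq_integral => w _; rewrite /= ger0_norm// (exprM _ 2 3) exprn_ge0// sqr_ge0.
have i1 := integrableD_EFin measurableT (finite_measure_integrable_cst P (1 : R) measurableT) i6.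
have h (x : R) : x ^+ 2 <= 1 + x ^+ 6 /\ x ^+ 4 <= 1 + x ^+ 6.
  rewrite (exprM x 2 2) (exprM x 2 3); have := sqr_ge0 x; move: (x ^+ 2) => y y0.
  have [y1|y1] := leP y 1; split.
  - by apply: (le_trans y1); rewrite lerDl exprn_ge0.
  - apply: (@le_trans _ _ 1); first by rewrite exprn_ile1.
    by rewrite lerDl exprn_ge0.
  - have : y <= y ^+ 3 by rewrite ler_eXnr// ltW.
    lra.
  - have : y ^+ 2 <= y ^+ 3 by rewrite ler_weXn2l// ltW.
    lra.
split; [split => //|split => //].
- apply: (le_integrable _ _ _ i1) => //; first exact/measurable_EFinP/measurable_funX.
  move=> w _; rewrite /= lee_fin ger0_norm ?sqr_ge0// ger0_norm; first by have [] := h (X w).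
  by rewrite addr_ge0// (exprM _ 2 3) exprn_ge0// sqr_ge0.
- apply: (le_integrable _ _ _ i1) => //; first exact/measurable_EFinP/measurable_funX.
  move=> w _; rewrite /= lee_fin ger0_norm; last by rewrite (exprM _ 2 2) sqr_ge0.
  rewrite ger0_norm; first by have [] := h (X w).
  by rewrite addr_ge0// (exprM _ 2 3) exprn_ge0// sqr_ge0.
Qed.

(** Mean square convergence alone does not control fourth moments. The sixth moments, bounded
    through Fatou's lemma, make the difference of the fourth powers tend to 0 in mean. *)
Lemma gaussian_limit_moments (X : nat -> T -> R) Z :
  (forall j, is_gaussian P (X j)) -> (forall j, square_integrable (X j)) ->
  (forall j, \int[P]_w X j w = 0) -> square_integrable Z ->
  (fun j => inner (fun w => X j w - Z w) (fun w => X j w - Z w)) @ \oo --> (0 : R) ->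
  {ae P, forall w, X j w @[j --> \oo] --> Z w} ->
  [/\ (\int[P]_w (Z w ^+ 6)%:E <= (15 * inner Z Z ^+ 3)%:E)%E,
      P.-integrable setT (EFin \o (fun w => Z w ^+ 6)),
      P.-integrable setT (EFin \o (fun w => Z w ^+ 4)) &
      \int[P]_w (Z w ^+ 4) = 3 * inner Z Z ^+ 2].
Proof.
move=> gX sX X0 sZ cXZ aeX; have [mZ iZ] := sZ.
have vcvg : (fun j => inner (X j) (X j)) @ \oo --> inner Z Z by exact: inner_cvg.
have mX j : measurable_fun setT (X j) by have [] := sX j.
have m6 : (\int[P]_w (Z w ^+ 6)%:E <= (15 * inner Z Z ^+ 3)%:E)%E.
  have mE j : measurable_fun setT (fun w => (X j w ^+ 6)%:E).
    exact/measurable_EFinP/measurable_funX.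
  have E0 j w : setT w -> (0 <= (X j w ^+ 6)%:E)%E.
    by move=> _; rewrite lee_fin (exprM _ 2 3) exprn_ge0// sqr_ge0.
  (* The lower limit inside the integral is identified by the almost sure convergence. *)
  have := fatou P measurableT mE E0.
  have -> : (fun j => \int[P]_w (X j w ^+ 6)%:E)%E = (fun j => (15 * inner (X j) (X j) ^+ 3)%:E)%E.
    by apply/funext => j; rewrite gaussian_moment6.
  have c15 : (15 * inner (X j) (X j) ^+ 3)%:E @[j --> \oo] --> (15 * inner Z Z ^+ 3)%:E.
    apply: cvg_EFin; first by near=> j.
    apply: cvgM; first exact: cvg_cst.
    exact: (cvg_comp (fun j => inner (X j) (X j)) (fun x => x ^+ 3) vcvg (@exprn_continuous R 3 _)).
  rewrite (cvg_limn_einf_sup c15).1; apply: le_trans.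
  rewrite le_eqVlt; apply/orP; left; apply/eqP.
  apply: ae_eq_integral => //.
  - exact/measurable_EFinP/measurable_funX.
  - rewrite /limn_einf; apply: measurableT_comp => //.
    by apply: measurable_fun_limn_esup => j; exact: measurableT_comp.
  - apply: filterS aeX => w hw _.
    have cw : (X j w ^+ 6)%:E @[j --> \oo] --> (Z w ^+ 6)%:E.
      apply: cvg_EFin; first by near=> j.
      exact: (cvg_comp (fun j => X j w) (fun x => x ^+ 6) hw (@exprn_continuous R 6 _)).
    by rewrite (cvg_limn_einf_sup cw).1.
have [_ [i4 i6]] := integrable_even_powers mZ (le_lt_trans m6 (ltry _)).
split => //.
pose v j := inner (X j) (X j).
(* The factorization [X^4 - Z^4 = (X - Z) * Q] prepares for the Cauchy-Schwarz inequality. *)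
pose Q j w := (X j w + Z w) * (X j w ^+ 2 + Z w ^+ 2).
have mQ j : measurable_fun setT (Q j).
  apply: measurable_funM; first exact: measurable_funD.
  by apply: measurable_funD; exact: measurable_funX.
have iX6 j : P.-integrable setT (EFin \o (fun w => X j w ^+ 6)).
  have fi : (\int[P]_w (X j w ^+ 6)%:E < +oo)%E by rewrite gaussian_moment6// ltry.
  by have [_ []] := integrable_even_powers (mX j) fi.
have iX4 j : P.-integrable setT (EFin \o (fun w => X j w ^+ 4)).
  have fi : (\int[P]_w (X j w ^+ 6)%:E < +oo)%E by rewrite gaussian_moment6// ltry.
  by have [_ []] := integrable_even_powers (mX j) fi.
have i66 j := integrableZl_EFin measurableT 8 (integrableD_EFin measurableT (iX6 j) i6).
(* With [x = X^2] and [y = Z^2]: [Q^2 <= 2 (x + y)^3 <= 8 (x^3 + y^3)]. *)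
have le_Q j w : Q j w ^+ 2 <= 8 * (X j w ^+ 6 + Z w ^+ 6).
  rewrite /Q exprMn (exprM _ 2 3) (exprM (Z w) 2 3).
  have h1 : (X j w + Z w) ^+ 2 <= 2 * (X j w ^+ 2 + Z w ^+ 2).
    by have := sqr_ge0 (X j w - Z w); lra.
  have := sqr_ge0 (X j w); have := sqr_ge0 (Z w).
  move: h1; move: (X j w ^+ 2) (Z w ^+ 2) => x y h1 y0 x0.
  apply: (@le_trans _ _ (2 * (x + y) * (x + y) ^+ 2)); first by rewrite ler_wpM2r ?sqr_ge0.
  have : 0 <= (x + y) * (x - y) ^+ 2 by rewrite mulr_ge0 ?addr_ge0 ?sqr_ge0.
  by lra.
have sQ j : square_integrable (Q j).
  split=> //; apply: (le_integrable _ _ _ (i66 j)) => //; first exact/measurable_EFinP/measurable_funX.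
  move=> w _; rewrite /= lee_fin ger0_norm ?sqr_ge0// ger0_norm ?le_Q//.
  exact: le_trans (sqr_ge0 _) (le_Q j w).
have QQ j : inner (Q j) (Q j) <= 8 * (15 * v j ^+ 3 + 15 * inner Z Z ^+ 3).
  apply: (@le_trans _ _ (\int[P]_w (8 * (X j w ^+ 6 + Z w ^+ 6)))).
    apply: le_Rintegral => //.
    - exact: integrable_inner.
    - by move=> w _; rewrite -expr2 le_Q.
  rewrite RintegralZl//; last exact: integrableD_EFin.
  rewrite RintegralD// ler_wpM2l// lerD//.
    by rewrite /Rintegral gaussian_moment6.
  rewrite -lee_fin /Rintegral fineK//.
  exact: (integrable_fin_num measurableT i6).
have sXZ j := square_integrableB (sX j) sZ.
have E4 j : \int[P]_w (Z w ^+ 4) = 3 * v j ^+ 2 - inner (fun w => X j w - Z w) (Q j).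
  have -> : 3 * v j ^+ 2 = \int[P]_w (X j w ^+ 4) by rewrite /Rintegral gaussian_moment4.
  rewrite /inner -RintegralB//; last exact: integrable_inner.
  by apply: eq_Rintegral => w _; rewrite /Q; ring.
have c1 : (fun j => inner (fun w => X j w - Z w) (Q j)) @ \oo --> (0 : R).
  apply/norm_cvg0P; apply: (@squeeze_cvgr _ _ _ _ (cst 0)
    (fun j => Num.sqrt (inner (fun w => X j w - Z w) (fun w => X j w - Z w)) *
      Num.sqrt (8 * (15 * v j ^+ 3 + 15 * inner Z Z ^+ 3)))).
  - near=> j; rewrite normr_ge0 (le_trans (inner_norm_le (sXZ j) (sQ j)))//.
    by rewrite ler_wpM2l ?sqrtr_ge0// ler_wsqrtr.
  - exact: cvg_cst.
  - rewrite -[X in _ --> X](mul0r (Num.sqrt (8 * (15 * inner Z Z ^+ 3 + 15 * inner Z Z ^+ 3)))).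
    apply: cvgM.
      rewrite -[X in _ --> X]sqrtr0.
      exact: (cvg_comp (fun j => inner (fun w => X j w - Z w) (fun w => X j w - Z w)) Num.sqrt
        cXZ (@sqrt_continuous R 0)).
    apply: (cvg_comp (fun j => 8 * (15 * v j ^+ 3 + 15 * inner Z Z ^+ 3)) Num.sqrt);
      last exact: sqrt_continuous.
    apply: cvgM; first exact: cvg_cst.
    apply: cvgD; last exact: cvg_cst.
    apply: cvgM; first exact: cvg_cst.
    exact: (cvg_comp (fun j => inner (X j) (X j)) (fun x => x ^+ 3) vcvg (@exprn_continuous R 3 _)).
have c2 : (fun j => 3 * v j ^+ 2 - inner (fun w => X j w - Z w) (Q j)) @ \oo --> 3 * inner Z Z ^+ 2.
  rewrite -[X in _ --> X]subr0; apply: cvgB => //; apply: cvgM; first exact: cvg_cst.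
  exact: (cvg_comp (fun j => inner (X j) (X j)) (fun x => x ^+ 2) vcvg (@exprn_continuous R 2 _)).
have c3 : (fun j => 3 * v j ^+ 2 - inner (fun w => X j w - Z w) (Q j)) @ \oo -->
    \int[P]_w (Z w ^+ 4).
  by under eq_fun do rewrite -E4; exact: cvg_cst.
exact: (cvg_unique _ c3 c2).
Unshelve. all: end_near. Qed.

End gaussian_moments.

Section linear_combinations.
Context d {T : measurableType d} {R : realType} (P : probability T R).

(** Lists of pairs of a coefficient and a time make closure under addition a concatenation, with no
    alignment of index types. *)
Definition linear_combination (X : R -> T -> R) (Y : T -> R) :=
  exists s : seq (R * R), Y = fun w => \sum_(u <- s) u.1 * X u.2 w.

Lemma linear_combination0 X : linear_combination X (fun=> 0).
Proof. by exists [::]; apply/funext => w; rewrite big_nil. Qed.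

Lemma linear_combinationD X Y Z : linear_combination X Y -> linear_combination X Z ->
  linear_combination X (fun w => Y w + Z w).
Proof.
by move=> [s ->] [t ->]; exists (s ++ t); apply/funext => w; rewrite big_cat.
Qed.

Lemma linear_combinationZ X Y c : linear_combination X Y ->
  linear_combination X (fun w => c * Y w).
Proof.
move=> [s ->]; exists [seq (c * u.1, u.2) | u <- s]; apply/funext => w.
by rewrite big_map mulr_sumr; apply: eq_bigr => u _; rewrite /= mulrA.
Qed.

Lemma linear_combination_id X t : linear_combination X (X t).
Proof. by exists [:: (1, t)]; apply/funext => w; rewrite big_seq1 mul1r. Qed.

Lemma linear_combination_sum X m (Y : nat -> T -> R) :
  (forall i, linear_combination X (Y i)) -> linear_combination X (fun w => \sum_(i < m) Y i w).
Proof.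
move=> h; elim: m => [|m IH].
  by under eq_fun do rewrite big_ord0; exact: linear_combination0.
by under eq_fun do rewrite big_ord_recr /=; exact: linear_combinationD.
Qed.

Lemma linear_combination_fOU_sum lambda sigma X t h m :
  linear_combination X (fOU_sum lambda sigma X t h m).
Proof.
apply: (@linear_combination_sum X m (fun i w => expR (- (lambda * h)) ^+ i * sigma *
    (X (t - i%:R * h) w - X (t - i.+1%:R * h) w))) => i.
apply: linear_combinationZ.
rewrite (_ : (fun w => _) =
    fun w => X (t - i%:R * h) w + (-1) * X (t - i.+1%:R * h) w); last first.
  by apply/funext => w; rewrite mulN1r.
by apply: linear_combinationD; [|apply: linear_combinationZ]; exact: linear_combination_id.
Qed.

Lemma is_gaussian_linear_combination X Y : gaussian_process P X ->
  linear_combination X Y -> is_gaussian P Y.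
Proof.
move=> gX [s ->].
have := gX (size s) (fun i => (tnth (in_tuple s) i).1) (fun i => (tnth (in_tuple s) i).2).
by congr is_gaussian; apply/funext => w; rewrite [RHS]big_tnth.
Qed.

Lemma square_integrable_linear_combination X Y : (forall t, square_integrable P (X t)) ->
  linear_combination X Y -> square_integrable P Y.
Proof.
move=> sX [s ->]; elim: s => [|u s IH].
  by under eq_fun do rewrite big_nil; exact: square_integrable0.
under eq_fun do rewrite big_cons.
by apply: square_integrableD => //; exact: square_integrableZ.
Qed.

Lemma Rintegral_linear_combination X Y : (forall t, P.-integrable setT (EFin \o X t)) ->
  (forall t, \int[P]_w X t w = 0) -> linear_combination X Y -> \int[P]_w Y w = 0.
Proof.
move=> iX X0 [s ->]; rewrite Rintegral_sum//; last first.
  by move=> u _; exact: integrableZl_EFin.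
by rewrite big1// => u _; rewrite RintegralZl// X0 mulr0.
Qed.

(** The measurable structure on the domain is left free: it will be the one generated by the process
    itself. *)
Lemma measurable_linear_combination d' (T' : measurableType d') (X : R -> T' -> R) (s : seq (R * R)) :
  (forall t, measurable_fun setT (X t)) ->
  measurable_fun setT (fun w => \sum_(u <- s) u.1 * X u.2 w).
Proof. by move=> mX; apply: measurable_sum => u; exact: measurable_funM. Qed.

End linear_combinations.

(** * Passage from the sums to the process *)

Section fOU_moments.
Context d {T : measurableType d} {R : realType} (P : probability T R).
Variables (H : R) (B : R -> {RV P >-> R}).
Hypotheses (H0 : 0 < H) (H1 : H < 1) (hB : fractional_brownian_motion H B).
Local Notation p := (2 * H).
Local Notation inner := (inner P).
Local Notation square_integrable := (square_integrable P).
Variables (lambda sigma : R).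
Hypotheses (l0 : 0 < lambda) (s0 : 0 < sigma).
Variable z : R -> {RV P >-> R}.
Hypothesis hz : stationary_fOU lambda sigma B z.
Variable n : nat.

Let sB t : square_integrable (B t).
Proof. exact: fBm_square_integrable hB t. Qed.

Let B0 t : \int[P]_w B t w = 0.
Proof. by have [_ + _] := hB; rewrite /Rintegral => /(_ t); rewrite expectation.unlock => ->. Qed.

(** The tolerance [(j+1)^-2] is summable, which upgrades mean square convergence to almost sure
    convergence. *)
Let ex_approx : exists Lq : nat -> nat * nat, forall j,
  [/\ (j <= (Lq j).1)%N, (j < (Lq j).2)%N & forall t, (t <= n)%N ->
    (mean_square_dist P (z t%:R)
      (fOU_sum lambda sigma B t%:R (Lq j).2%:R^-1 (((Lq j).1 + t) * (Lq j).2)) <=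
     (j.+1%:R ^- 2)%:E)%E].
Proof.
suff h j : exists Lq : nat * nat, [/\ (j <= Lq.1)%N, (j < Lq.2)%N & forall t, (t <= n)%N ->
    (mean_square_dist P (z t%:R)
      (fOU_sum lambda sigma B t%:R Lq.2%:R^-1 ((Lq.1 + t) * Lq.2)) <= (j.+1%:R ^- 2)%:E)%E].
  by have [Lq hLq] := choice h; exists Lq.
have e0 : 0 < j.+1%:R ^- 2 :> R by rewrite invr_gt0 exprn_gt0.
have [L [q [h1 h2 h3]]] := stationary_fOU_approx l0 hz n j e0.
by exists (L, q).
Qed.

Let Lq := projT1 (cid ex_approx).
Let L j := (Lq j).1.
Let q j := (Lq j).2.
Let S j t := fOU_sum lambda sigma B t%:R (q j)%:R^-1 ((L j + t) * q j).

Let L_ge j : (j <= L j)%N.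
Proof. by have [] := projT2 (cid ex_approx) j. Qed.

Let q_gt j : (j < q j)%N.
Proof. by have [] := projT2 (cid ex_approx) j. Qed.

Let S_near j t : (t <= n)%N ->
  (\int[P]_w ((z t%:R w - S j t w) ^+ 2)%:E <= (j.+1%:R ^- 2)%:E)%E.
Proof.
by have [_ _ h] := projT2 (cid ex_approx) j => tn; rewrite -mean_square_distE; exact: h.
Qed.

Let sS j t : square_integrable (S j t).
Proof. exact: square_integrable_fOU_sum hB lambda sigma _ _ _. Qed.

Lemma square_integrable_fOU t : (t <= n)%N -> square_integrable (z t%:R).
Proof.
move=> tn; apply: (square_integrable_near _ (sS 0 t)) => //.
exact: le_lt_trans (S_near 0 tn) (ltry _).
Qed.

Let S_inner t : (t <= n)%N ->
  (fun j => inner (fun w => S j t w - z t%:R w) (fun w => S j t w - z t%:R w)) @ \oo --> (0 : R).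
Proof.
move=> tn; apply: (@squeeze_cvgr _ _ _ _ (cst 0) (fun j => j.+1%:R^-1)).
- near=> j; rewrite inner_ge0/=.
  have sSz := square_integrableB (sS j t) (square_integrable_fOU tn).
  apply: (@le_trans _ _ (j.+1%:R ^- 2)).
    rewrite -lee_fin -integral_sqr_inner//; apply: le_trans (S_near j tn).
    rewrite le_eqVlt; apply/orP; left; apply/eqP; apply: eq_integral => w _.
    by rewrite -sqrrN opprB.
  rewrite lef_pV2 ?posrE ?exprn_gt0// ler_eXnr// ler1n//.
- exact: cvg_cst.
- exact: cvg_harmonic.
Unshelve. all: end_near. Qed.

Let S_ae t : (t <= n)%N -> {ae P, forall w, S j t w @[j --> \oo] --> z t%:R w}.
Proof.
move=> tn.
have : {ae P, forall w, z t%:R w - S j t w @[j --> \oo] --> (0 : R)}.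
  apply: ae_cvg0_of_summable.
    by move=> j; apply: measurable_funB => //; have [] := sS j t.
  apply: (@le_lt_trans _ _ (\sum_(0 <= j <oo) ((j.+1)%:R ^- 2)%:E)%E).
    by apply: lee_nneseries => [k _ *|k _]; [apply: integral_ge0 => w _; rewrite lee_fin sqr_ge0|exact: S_near].
  apply: (@le_lt_trans _ _ 2%:E); last by rewrite ltry.
  apply: lime_le; first by apply: is_cvg_nneseries => j _ _; rewrite lee_fin invr_ge0 exprn_ge0.
  by apply: nearW => k; rewrite sumEFin lee_fin sum_inv_sqr_le2.
apply: filterS => w hw.
rewrite -[X in _ --> X]subr0 (_ : (fun j => S j t w) = fun j => z t%:R w - (z t%:R w - S j t w)).
  by apply: cvgB => //; exact: cvg_cst.
by apply/funext => j; rewrite subKr.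
Qed.

Let q_oo : (q j)%:R @[j --> \oo] --> (+oo : set_system R).
Proof.
apply/cvgryPge => A; have [k _ hk] := nbhs_infty_ger A.
exists k => // j /= kj; apply: (le_trans (hk k (leqnn k))).
by rewrite ler_nat (leq_trans kj)// ltnW.
Qed.

Let h_cvg : (q j)%:R^-1 @[j --> \oo] --> (0 : R).
Proof.
by apply/gtr0_cvgV0 => //; apply: nearW => j; rewrite ltr0n (leq_ltn_trans (leq0n j)).
Qed.

Let q0 j : 0 < (q j)%:R :> R.
Proof. by rewrite ltr0n (leq_ltn_trans (leq0n j)). Qed.

(** In the variable [lambda s] the step is [lambda / q], tending to 0, and the horizon is
    [(L + t) lambda], tending to infinity; the two limits of the scaled variance must coincide. *)
Lemma fOU_variance t : (t <= n)%N ->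
  inner (z t%:R) (z t%:R) = sigma ^+ 2 * lambda `^ (- p) * (H * Gamma p).
Proof.
move=> tn.
have c1 : (fun j => inner (S j t) (S j t)) @ \oo --> inner (z t%:R) (z t%:R).
  by apply: inner_cvg => //; try exact: S_inner; exact: square_integrable_fOU.
have c2 : (fun j => lambda `^ p / sigma ^+ 2 * inner (S j t) (S j t)) @ \oo --> p / 2 * Gamma p.
  apply: (@gamma_variance_cvg R p _ _ (fun j => lambda * (q j)%:R^-1)
    (fun j => ((L j + t) * q j)%N)).
  - by rewrite mulr_gt0.
  - by rewrite -[leRHS]mulr1 ler_pM2l// ltW.
  - by move=> j; rewrite mulr_gt0// invr_gt0.
  - by rewrite -[X in _ --> X](mulr0 lambda); apply: cvgM => //; exact: cvg_cst.
  - apply/cvgryPge => A; have [k _ hk] := nbhs_infty_ger (A / lambda).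
    exists k => // j /= kj; 
    have -> : ((L j + t) * q j)%:R * (lambda * (q j)%:R^-1) = (L j + t)%:R * lambda.
      by rewrite natrM -mulrA (mulrCA _ lambda) divff ?mulr1// gt_eqF.
    rewrite -ler_pdivrMr//; apply: (le_trans (hk k (leqnn k))).
    by rewrite ler_nat (leq_trans kj)// (leq_trans (L_ge j))// leq_addr.
  - by move=> j; apply: fOU_sum_variance_bounds => //; rewrite invr_gt0.
have c3 : (fun j => lambda `^ p / sigma ^+ 2 * inner (S j t) (S j t)) @ \oo -->
    lambda `^ p / sigma ^+ 2 * inner (z t%:R) (z t%:R).
  by apply: cvgM => //; exact: cvg_cst.
have E : p / 2 * Gamma p = lambda `^ p / sigma ^+ 2 * inner (z t%:R) (z t%:R).
  exact: (cvg_unique _ c2 c3).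
have lp : lambda `^ p != 0 by rewrite gt_eqF// powR_gt0.
rewrite powRN (_ : H * Gamma p = p / 2 * Gamma p); last by field.
by rewrite E; field; rewrite lp gt_eqF.
Qed.

Lemma fOU_covariance_le s t C : (s < t)%N -> (t <= n)%N -> 0 <= C ->
  (forall x y, 0 <= x -> 0 <= y ->
    `| `|t%:R - s%:R + x| `^ p + `|t%:R - s%:R - y| `^ p
       - `|t%:R - s%:R| `^ p - `|t%:R - s%:R + x - y| `^ p |
    <= C * (x ^+ 2 + y ^+ 2)) ->
  `|inner (z s%:R) (z t%:R)| <= 2 * sigma ^+ 2 * C / lambda ^+ 2.
Proof.
move=> st tn C0 hC; have sn : (s <= n)%N by exact: leq_trans (ltnW st) tn.
have c1 : (fun j => `|inner (S j s) (S j t)|) @ \oo --> `|inner (z s%:R) (z t%:R)|.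
  apply: cvg_norm.
  by apply: inner_cvg => //; try exact: S_inner; exact: square_integrable_fOU.
have c2 : (fun j => 2 * sigma ^+ 2 * C * ((1 + lambda * (q j)%:R^-1) / lambda) ^+ 2) @ \oo -->
    2 * sigma ^+ 2 * C / lambda ^+ 2.
  have -> : 2 * sigma ^+ 2 * C / lambda ^+ 2 = 2 * sigma ^+ 2 * C * ((1 + lambda * 0) / lambda) ^+ 2.
    by rewrite mulr0 addr0 expr_div_n expr1n mul1r.
  apply: cvgM; first exact: cvg_cst.
  apply: (cvg_comp (fun j => (1 + lambda * (q j)%:R^-1) / lambda) (fun x => x ^+ 2));
    last exact: exprn_continuous.
  apply: cvgM; last exact: cvg_cst.
  by apply: cvgD; [exact: cvg_cst|apply: cvgM => //; exact: cvg_cst].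
apply: (ler_cvg_to c1 c2); near=> j.
by apply: (fOU_sum_covariance_le hB) => //; rewrite ?invr_gt0// ltr_nat.
Unshelve. all: end_near. Qed.

(** The same combination of the sums is a linear combination of values of [B], hence centered
    Gaussian. The case [c = 0] gives one time, [c = 1] and [c = -1] serve the polarization. *)
Lemma fOU_combination_moments s t c : (s <= n)%N -> (t <= n)%N ->
  let Z w := z s%:R w + c * z t%:R w in
  [/\ (\int[P]_w (Z w ^+ 6)%:E <= (15 * inner Z Z ^+ 3)%:E)%E,
      P.-integrable setT (EFin \o (fun w => Z w ^+ 6)),
      P.-integrable setT (EFin \o (fun w => Z w ^+ 4)) &
      \int[P]_w (Z w ^+ 4) = 3 * inner Z Z ^+ 2].
Proof.
move=> sn tn Z; have [gB _ _] := hB.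
pose X j w := S j s w + c * S j t w.
have lX j : linear_combination (fun t => B t) (X j).
  by apply: linear_combinationD; [|apply: linear_combinationZ]; exact: linear_combination_fOU_sum.
have iB u : P.-integrable setT (EFin \o B u).
  by have [mB iB] := sB u; exact: integrable_sqr_expr1.
have ss := square_integrable_fOU sn; have st := square_integrable_fOU tn.
apply: (@gaussian_limit_moments _ _ _ P X).
- by move=> j; exact: is_gaussian_linear_combination gB (lX j).
- by move=> j; exact: square_integrable_linear_combination (lX j).
- by move=> j; exact: Rintegral_linear_combination (lX j).
- by apply: square_integrableD => //; exact: square_integrableZ.
- pose D j u w := S j u w - z u%:R w.
  have sD j u : (u <= n)%N -> square_integrable (D j u).
    by move=> un; apply: square_integrableB => //; exact: square_integrable_fOU.
  have E j : (fun w => X j w - Z w) = fun w => D j s w + c * D j t w.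
    by apply/funext => w; rewrite /X /Z /D; ring.
  have -> : (fun j => inner (fun w => X j w - Z w) (fun w => X j w - Z w)) =
    fun j => inner (D j s) (D j s) + (2 * c) * inner (D j s) (D j t) + c ^+ 2 * inner (D j t) (D j t).
    apply/funext => j; rewrite E.
    have s1 := sD j s sn; have s2 := sD j t tn; have s3 := square_integrableZ c s2.
    move: (D j s) (D j t) s1 s2 s3 => U V s1 s2 s3.
    rewrite innerDl ?innerDr//; last exact: square_integrableD.
    by rewrite !innerZl// !innerZr// (innerC P V U); ring.
  rewrite -[X in _ --> X](_ : 0 + (2 * c) * 0 + c ^+ 2 * 0 = 0); last by rewrite !mulr0 !addr0.
  apply: cvgD; last by apply: cvgM; [exact: cvg_cst|exact: S_inner].
  apply: cvgD; first exact: S_inner.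
  apply: cvgM; first exact: cvg_cst.
  have := @inner_cvg _ _ _ P (fun j => D j s) (fun j => D j t) (fun=> 0) (fun=> 0).
  rewrite inner0l; apply.
  + by move=> j; exact: sD.
  + by move=> j; exact: sD.
  + exact: square_integrable0.
  + exact: square_integrable0.
  + by under eq_fun do under [X in inner X _]eq_fun do rewrite subr0;
      under eq_fun do under [X in inner _ X]eq_fun do rewrite subr0; exact: S_inner.
  + by under eq_fun do under [X in inner X _]eq_fun do rewrite subr0;
      under eq_fun do under [X in inner _ X]eq_fun do rewrite subr0; exact: S_inner.
- apply: filterS2 (S_ae sn) (S_ae tn) => w hs ht.
  by apply: cvgD => //; apply: cvgM => //; exact: cvg_cst.
Qed.

Lemma fOU_moments t : (t <= n)%N ->
  let v := inner (z t%:R) (z t%:R) in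
  [/\ (\int[P]_w (z t%:R w ^+ 6)%:E <= (15 * v ^+ 3)%:E)%E,
      P.-integrable setT (EFin \o (fun w => z t%:R w ^+ 6)),
      P.-integrable setT (EFin \o (fun w => z t%:R w ^+ 4)) &
      \int[P]_w (z t%:R w ^+ 4) = 3 * v ^+ 2].
Proof.
move=> tn; have := fOU_combination_moments 0 tn tn.
by rewrite (_ : (fun w => z t%:R w + 0 * z t%:R w) = z t%:R)//; apply/funext => w; rewrite mul0r addr0.
Qed.

(* Polarization of the fourth moments of [z s + z t] and [z s - z t]. *)
Lemma fOU_product_moment s t : (s <= n)%N -> (t <= n)%N ->
  P.-integrable setT (EFin \o (fun w => z s%:R w ^+ 2 * z t%:R w ^+ 2)) /\
  \int[P]_w (z s%:R w ^+ 2 * z t%:R w ^+ 2) =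
    inner (z s%:R) (z s%:R) * inner (z t%:R) (z t%:R) + 2 * inner (z s%:R) (z t%:R) ^+ 2.
Proof.
move=> sn tn.
have [_ _ is4 Es] := fOU_moments sn; have [_ _ it4 Et] := fOU_moments tn.
have [_ _ ip4 Ep] := fOU_combination_moments 1 sn tn.
have [_ _ im4 Em] := fOU_combination_moments (-1) sn tn.
have ss := square_integrable_fOU sn; have st := square_integrable_fOU tn.
have EZ c : inner (fun w => z s%:R w + c * z t%:R w) (fun w => z s%:R w + c * z t%:R w) =
    inner (z s%:R) (z s%:R) + 2 * c * inner (z s%:R) (z t%:R) + c ^+ 2 * inner (z t%:R) (z t%:R).
  have st' := square_integrableZ c st.
  rewrite innerDl ?innerDr//; last exact: square_integrableD.
  by rewrite !innerZl// !innerZr// (innerC P (z t%:R) (z s%:R)); ring.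
have i1 := integrableD_EFin measurableT ip4 im4.
have i2 := integrableZl_EFin measurableT 2 (integrableD_EFin measurableT is4 it4).
have i3 := integrableZl_EFin measurableT 12^-1 (integrableB_EFin measurableT i1 i2).
have E : (fun w => z s%:R w ^+ 2 * z t%:R w ^+ 2) = fun w => 12^-1 *
    ((z s%:R w + 1 * z t%:R w) ^+ 4 + (z s%:R w + -1 * z t%:R w) ^+ 4
     - 2 * (z s%:R w ^+ 4 + z t%:R w ^+ 4)).
  by apply/funext => w; field.
rewrite E; split; first exact: i3.
rewrite RintegralZl//; last exact: integrableB_EFin.
rewrite RintegralB// RintegralD// Ep Em RintegralZl//; last exact: integrableD_EFin.
by rewrite RintegralD// Es Et !EZ; field.
Qed.

(** Independence is assumed for the sigma-algebras of the motions, while [z] is determined by its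
    motion only up to a null set. The upper limit of the sums is an exactly measurable version. *)
Lemma fOU_adapted_version t : (t <= n)%N -> exists z' : T -> R,
  (forall A : set R, measurable A -> process_sigma_algebra (fun t => B t) (z' @^-1` A)) /\
  {ae P, forall w, z t%:R w = z' w}.
Proof.
move=> tn.
pose G := [set A : set T | exists t, exists2 D : set R, measurable D & A = B t @^-1` D].
exists (fun w => fine (limn_esup (fun j => (S j t w)%:E))); split; last first.
  apply: filterS (S_ae tn) => w hw.
  have cw : (S j t w)%:E @[j --> \oo] --> (z t%:R w)%:E.
    by apply: cvg_EFin => //; near=> j.
  by rewrite (cvg_limn_einf_sup cw).2.
pose T' : measurableType _ := g_sigma_algebraType G.
have mB u : measurable_fun [set: T'] (B u : T' -> R).
  move=> _ A mA; rewrite setTI; apply: sub_sigma_algebra; exists u.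
  by exists A.
have mS j : measurable_fun [set: T'] (fun w : T' => (S j t w)%:E).
  apply/measurable_EFinP; rewrite /S.
  have [s ->] := linear_combination_fOU_sum lambda sigma (fun t => B t) t%:R (q j)%:R^-1 ((L j + t) * q j).
  exact: (@measurable_linear_combination R _ T' _ s mB).
have mz : measurable_fun [set: T'] (fun w : T' => fine (limn_esup (fun j => (S j t w)%:E))).
  by apply: measurableT_comp => //; exact: measurable_fun_limn_esup.
by move=> A mA; have := mz measurableT A mA; rewrite setTI.
Unshelve. all: end_near. Qed.

End fOU_moments.

(** * The normalized time averages *)

Section average_of_squares.
Context d {T : measurableType d} {R : realType} (P : probability T R).
Local Notation inner := (inner P).
Local Notation square_integrable := (square_integrable P).

(** Each step uses [(S + y)^3 <= 4 (S^3 + y^3)]; a constant depending on [n] alone is all that is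
    needed. *)
Lemma expr3_sum_le (x : nat -> R) n : (forall i, 0 <= x i) ->
  (\sum_(i < n) x i) ^+ 3 <= 4 ^+ n * \sum_(i < n) x i ^+ 3.
Proof.
move=> x0; elim: n => [|n IH]; first by rewrite !big_ord0 expr0n mulr0.
rewrite !big_ord_recr /= (exprS 4 n) -mulrA.
have S0 : 0 <= \sum_(i < n) x i by exact: sumr_ge0.
have Q0 : 0 <= \sum_(i < n) x i ^+ 3 by apply: sumr_ge0 => i _; rewrite exprn_ge0.
have := x0 n; move: (x n) (\sum_(i < n) x i) (\sum_(i < n) x i ^+ 3) IH S0 Q0 => y S Q IH S0 Q0 y0.
apply: (@le_trans _ _ (4 * (S ^+ 3 + y ^+ 3))).
  have : 0 <= (S + y) * (S - y) ^+ 2 by rewrite mulr_ge0 ?addr_ge0 ?sqr_ge0.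
  by lra.
rewrite ler_wpM2l// mulrDr lerD// ler_peMl ?exprn_ge0// exprn_ege1//; lra.
Qed.

Variables (n : nat) (Z : nat -> T -> R) (v mu : R).
Hypotheses (n0 : (0 < n)%N) (v0 : 0 < v) (mu0 : 0 < mu).
Hypothesis sZ : forall i, (i < n)%N -> square_integrable (Z i).
Hypothesis vZ : forall i, (i < n)%N -> inner (Z i) (Z i) = v.
Hypothesis Z6 : forall i, (i < n)%N -> (\int[P]_w (Z i w ^+ 6)%:E <= (15 * v ^+ 3)%:E)%E.
Hypothesis Z22 : forall i j, (i < n)%N -> (j < n)%N ->
  P.-integrable setT (EFin \o (fun w => Z i w ^+ 2 * Z j w ^+ 2)) /\
  \int[P]_w (Z i w ^+ 2 * Z j w ^+ 2) = v ^+ 2 + 2 * inner (Z i) (Z j) ^+ 2.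

Definition mean_of_squares w := mu / v * (n%:R^-1 * \sum_(i < n) Z i w ^+ 2).
Local Notation W := mean_of_squares.

Let nR : 0 < n%:R :> R. Proof. by rewrite ltr0n. Qed.
Let nN0 : n%:R != 0 :> R. Proof. by rewrite gt_eqF. Qed.
Let vN0 : v != 0. Proof. by rewrite gt_eqF. Qed.

Let WE w : W w = mu / v / n%:R * \sum_(i < n) Z i w ^+ 2.
Proof. by rewrite /mean_of_squares mulrA. Qed.

Lemma measurable_mean_of_squares : measurable_fun setT W.
Proof.
apply: measurable_funM => //; apply: measurable_funM => //.
by apply: measurable_sum => i; apply: measurable_funX; have [] := sZ (ltn_ord i).
Qed.

Lemma mean_of_squares_ge0 w : 0 <= W w.
Proof.
rewrite mulr_ge0 ?divr_ge0 ?(ltW v0) ?(ltW mu0)// mulr_ge0 ?invr_ge0//.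
by apply: sumr_ge0 => i _; exact: sqr_ge0.
Qed.

Lemma integrable_mean_of_squares : P.-integrable setT (EFin \o W).
Proof.
apply: integrableZl_EFin => //; apply: integrableZl_EFin => //.
by apply: integrable_sum_EFin => // i _; have [] := sZ (ltn_ord i).
Qed.

Lemma Rintegral_mean_of_squares : \int[P]_w W w = mu.
Proof.
have iZ (i : 'I_n) : P.-integrable setT (EFin \o (fun w => Z i w ^+ 2)).
  by have [] := sZ (ltn_ord i).
have iS : P.-integrable setT (EFin \o (fun w => \sum_(i < n) Z i w ^+ 2)).
  by apply: integrable_sum_EFin.
rewrite RintegralZl//; last exact: integrableZl_EFin.
rewrite RintegralZl// Rintegral_sum//.
rewrite (eq_bigr (fun=> v)); last first.
  move=> i _; rewrite -(vZ (ltn_ord i)); apply: eq_Rintegral => w _; exact: expr2.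
by rewrite sumr_const card_ord -mulr_natr; field; rewrite nN0.
Qed.

(** For centered Gaussian pairs the covariance of [Z i ^ 2] and [Z j ^ 2] is [2 (E Z i Z j)^2]; the
    summands are squared correlations. *)
Definition mean_of_squares_variance :=
  2 * mu ^+ 2 / n%:R ^+ 2 * \sum_(i < n) \sum_(j < n) (inner (Z i) (Z j) / v) ^+ 2.

Let sqrE : (fun w => W w ^+ 2) = fun w => (mu / v / n%:R) ^+ 2 *
  \sum_(i < n) \sum_(j < n) Z i w ^+ 2 * Z j w ^+ 2.
Proof.
apply/funext => w.
have -> : \sum_(i < n) \sum_(j < n) Z i w ^+ 2 * Z j w ^+ 2 = (\sum_(i < n) Z i w ^+ 2) ^+ 2.
  by rewrite expr2 mulr_suml; apply: eq_bigr => i _; rewrite mulr_sumr.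
by rewrite WE exprMn.
Qed.

Let iSS : P.-integrable setT (EFin \o (fun w => \sum_(i < n) \sum_(j < n) Z i w ^+ 2 * Z j w ^+ 2)).
Proof.
apply: integrable_sum_EFin => // i _; apply: integrable_sum_EFin => // j _.
by have [] := Z22 (ltn_ord i) (ltn_ord j).
Qed.

Lemma integrable_sqr_mean_of_squares : P.-integrable setT (EFin \o (fun w => W w ^+ 2)).
Proof. by rewrite sqrE; exact: integrableZl_EFin. Qed.

Let EW2 : \int[P]_w (W w ^+ 2) = mu ^+ 2 + mean_of_squares_variance.
Proof.
rewrite sqrE RintegralZl//.
rewrite Rintegral_sum//; last first.
  move=> i _; apply: integrable_sum_EFin => // j _.
  by have [] := Z22 (ltn_ord i) (ltn_ord j).
rewrite (eq_bigr (fun i : 'I_n => n%:R * v ^+ 2 +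
    2 * \sum_(j < n) inner (Z i) (Z j) ^+ 2)); last first.
  move=> i _; rewrite Rintegral_sum//; last first.
    by move=> j _; have [] := Z22 (ltn_ord i) (ltn_ord j).
  rewrite (eq_bigr (fun j : 'I_n => v ^+ 2 + 2 * inner (Z i) (Z j) ^+ 2)); last first.
    by move=> j _; have [] := Z22 (ltn_ord i) (ltn_ord j).
  by rewrite big_split /= sumr_const card_ord -mulr_sumr (mulr_natl (v ^+ 2) n).
rewrite big_split /= sumr_const card_ord -mulr_sumr /mean_of_squares_variance.
have -> : \sum_(i < n) \sum_(j < n) (inner (Z i) (Z j) / v) ^+ 2 =
    v ^- 2 * \sum_(i < n) \sum_(j < n) inner (Z i) (Z j) ^+ 2.
  rewrite mulr_sumr; apply: eq_bigr => i _; rewrite mulr_sumr; apply: eq_bigr => j _.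
  by rewrite exprMn mulrC exprVn.
move: (\sum_(i < n) _) => Q; rewrite -mulr_natr; field; rewrite nN0 vN0//.
Qed.

Lemma variance_mean_of_squares :
  \int[P]_w ((W w - mu) ^+ 2) = mean_of_squares_variance.
Proof.
have i1 := finite_measure_integrable_cst P (mu ^+ 2) measurableT.
have i2 := integrableZl_EFin measurableT (- 2 * mu) integrable_mean_of_squares.
have i3 := integrable_sqr_mean_of_squares.
transitivity (\int[P]_w (W w ^+ 2 + (- 2 * mu * W w + mu ^+ 2))).
  by apply: eq_Rintegral => w _; ring.
rewrite RintegralD//; last exact: integrableD_EFin.
rewrite RintegralD//; rewrite [X in _ + (X + _)]RintegralZl//; last exact: integrable_mean_of_squares.
by rewrite EW2 Rintegral_mean_of_squares Rintegral_cst1; ring.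
Qed.

(** The [n] diagonal correlations equal 1 and the other squares are nonnegative; by Cauchy-Schwarz
    all [n^2] of them are at most 1. *)
Lemma mean_of_squares_variance_bounds :
  2 * mu ^+ 2 / n%:R <= mean_of_squares_variance <= 2 * mu ^+ 2.
Proof.
have c0 : 0 < 2 * mu ^+ 2 / n%:R ^+ 2 by rewrite !(mulr_gt0, invr_gt0, exprn_gt0).
rewrite /mean_of_squares_variance; apply/andP; split.
- have -> : 2 * mu ^+ 2 / n%:R = 2 * mu ^+ 2 / n%:R ^+ 2 * n%:R by field; rewrite nN0.
  rewrite ler_pM2l//.
  have {1}-> : n%:R = \sum_(i < n) (1 : R) by rewrite sumr_const card_ord.
  apply: ler_sum => i _; rewrite (bigD1 i)//= vZ// divff// expr1n lerDl.
  by apply: sumr_ge0 => j _; exact: sqr_ge0.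
- have {2}-> : 2 * mu ^+ 2 = 2 * mu ^+ 2 / n%:R ^+ 2 * (n%:R * n%:R) by field; rewrite nN0.
  rewrite ler_pM2l//.
  apply: (@le_trans _ _ (\sum_(i < n) \sum_(j < n) (1 : R))); last first.
    rewrite (eq_bigr (fun=> n%:R)); last by move=> i _; rewrite sumr_const card_ord.
    by rewrite sumr_const card_ord mulr_natr.
  apply: ler_sum => i _; apply: ler_sum => j _.
  rewrite expr_div_n ler_pdivrMr ?exprn_gt0// mul1r.
  have := inner_cauchy_schwarz (sZ (ltn_ord i)) (sZ (ltn_ord j)).
  by rewrite !vZ// -expr2.
Qed.

Definition mean_of_squares_moment3_bound := (mu / v / n%:R) ^+ 3 * 4 ^+ n * (n%:R * (15 * v ^+ 3)) + mu ^+ 3.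

(** As [W] and [mu] are nonnegative, [|W - mu|^3 <= W^3 + mu^3], and [W^3] is bounded by sixth
    powers of the [Z i]. *)
Lemma mean_of_squares_moment3 :
  P.-integrable setT (EFin \o (fun w => `|W w - mu| ^+ 3)) /\
  \int[P]_w (`|W w - mu| ^+ 3) <= mean_of_squares_moment3_bound.
Proof.
have i6 (i : 'I_n) : P.-integrable setT (EFin \o (fun w => Z i w ^+ 6)).
  have [mZ _] := sZ (ltn_ord i).
  by have [_ []] := integrable_even_powers mZ (le_lt_trans (Z6 (ltn_ord i)) (ltry _)).
have iS : P.-integrable setT (EFin \o (fun w => \sum_(i < n) Z i w ^+ 6)).
  by apply: integrable_sum_EFin.
have iC := finite_measure_integrable_cst P (mu ^+ 3) measurableT.
have iK := integrableZl_EFin measurableT ((mu / v / n%:R) ^+ 3 * 4 ^+ n) iS.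
have iB := integrableD_EFin measurableT iK iC.
have le w : `|W w - mu| ^+ 3 <= (mu / v / n%:R) ^+ 3 * 4 ^+ n * \sum_(i < n) Z i w ^+ 6 + mu ^+ 3.
  have W0 := mean_of_squares_ge0 w.
  apply: (@le_trans _ _ (W w ^+ 3 + mu ^+ 3)).
    move: (W w) W0 => y y0; have [h|h] := leP mu y.
      rewrite ger0_norm ?subr_ge0//; apply: (@le_trans _ _ (y ^+ 3)).
        by rewrite lerXn2r ?nnegrE ?subr_ge0// gerBl ltW.
      by rewrite lerDl exprn_ge0// ltW.
    rewrite ltr0_norm ?subr_lt0// opprB; apply: (@le_trans _ _ (mu ^+ 3)).
      by rewrite lerXn2r ?nnegrE ?subr_ge0 ?(ltW h) ?(ltW mu0)// gerBl.
    by rewrite lerDr exprn_ge0.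
  rewrite lerD2r WE exprMn -(mulrA _ (4 ^+ n)) ler_wpM2l//.
    by rewrite exprn_ge0// divr_ge0 ?divr_ge0 ?(ltW v0) ?(ltW mu0).
  apply: (le_trans (@expr3_sum_le (fun i => Z i w ^+ 2) n (fun i => sqr_ge0 _))).
  rewrite ler_wpM2l ?exprn_ge0//; apply: ler_sum => i _.
  by rewrite -exprM.
have i3 : P.-integrable setT (EFin \o (fun w => `|W w - mu| ^+ 3)).
  apply: (le_integrable _ _ _ iB) => //.
    apply/measurable_EFinP/measurable_funX; apply: measurableT_comp => //.
    by apply: measurable_funB => //; exact: measurable_mean_of_squares.
  move=> w _; rewrite /= lee_fin [leLHS]ger0_norm ?exprn_ge0//.
  exact: le_trans (le w) (ler_norm _).
split => //.
apply: (@le_trans _ _ (\int[P]_w ((mu / v / n%:R) ^+ 3 * 4 ^+ n * \sum_(i < n) Z i w ^+ 6 + mu ^+ 3))).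
  by apply: le_Rintegral => // w _; exact: le.
rewrite RintegralD// RintegralZl// Rintegral_cst1 lerD2r ler_wpM2l//.
  rewrite mulr_ge0 ?exprn_ge0// divr_ge0 ?divr_ge0 ?(ltW v0) ?(ltW mu0)//.
rewrite Rintegral_sum// mulr_natl -[X in _ <= _ *+ X]card_ord -sumr_const.
apply: ler_sum => i _; rewrite -lee_fin /Rintegral fineK; first exact: Z6.
exact: (integrable_fin_num measurableT (i6 i)).
Qed.

End average_of_squares.

(** * Independence of the coordinates *)

Section independence.
Context d {T : measurableType d} {R : realType} (P : probability T R).

Lemma measure_ae_eq (A B : set T) : measurable A -> measurable B ->
  {ae P, forall w, A w <-> B w} -> P A = P B.
Proof.
move=> mA mB AB; rewrite -(setIT A) -(setIT B) -!integral_indic//.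
apply: ae_eq_integral => //.
- exact/measurable_EFinP.
- exact/measurable_EFinP.
- apply: filterS AB => w AB _; rewrite !indicE; congr ((_ : bool)%:R%:E).
  by apply/idP/idP; rewrite !inE => /AB.
Qed.

Lemma process_sigma_algebra_measurable (X : R -> T -> R) : (forall t, measurable_fun setT (X t)) ->
  process_sigma_algebra X `<=` measurable.
Proof.
move=> mX; apply: smallest_sub; first exact: sigma_algebra_measurable.
by move=> _ [t [D mD ->]]; rewrite -[X in measurable X]setTI; exact: mX.
Qed.

(** Outside one null set all the variables coincide with their adapted versions, so every event in
    the product formula can be exchanged for one of the independent sigma-algebras. *)
Lemma independent_seq_processes (X : nat -> R -> T -> R) (W W' : nat -> T -> R) :
  (forall k t, measurable_fun setT (X k t)) -> independent_processes P X ->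
  (forall k, measurable_fun setT (W k)) ->
  (forall k (A : set R), measurable A -> process_sigma_algebra (X k) (W' k @^-1` A)) ->
  (forall k, {ae P, forall w, W k w = W' k w}) ->
  independent_seq P W.
Proof.
move=> mX iX mW W'X WW' N A mA.
have mWA i : measurable (W i @^-1` A i).
  by rewrite -[X in measurable X]setTI; exact: mW.
have mWA' i : measurable (W' i @^-1` A i).
  by apply: process_sigma_algebra_measurable (W'X i _ (mA i)) => t; exact: mX.
have PE i : P (W i @^-1` A i) = P (W' i @^-1` A i).
  apply: measure_ae_eq => //; apply: filterS (WW' i) => w /= ->.
  by [].
have IE : P (\bigcap_(i < N) (W i @^-1` A i)) = P (\bigcap_(i < N) (W' i @^-1` A i)).
  apply: measure_ae_eq.
  - by rewrite bigcap_mkord; apply: bigsetI_measurable.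
  - by rewrite bigcap_mkord; apply: bigsetI_measurable.
  - have /ae_foralln := WW'; apply: filterS => w hw.
    by split => h i iN; have := h i iN; rewrite /= hw.
rewrite IE.
have := iX (index_iota 0 N) (fun k => W' k @^-1` A k) (iota_uniq _ _) (fun k _ => W'X k _ (mA k)).
have -> : [set` index_iota 0 N] = `I_N.
  by apply/seteqP; split => x /=; rewrite mem_index_iota.
move=> E; rewrite [LHS]E big_mkord; congr EFin.
by apply: eq_bigr => i _; rewrite PE.
Qed.

End independence.

Section components.
Context d {T : measurableType d} {R : realType} (P : probability T R).
Variables (alpha H : R) (theta sigma : nat -> R) (B z : nat -> R -> {RV P >-> R}) (n : nat).
Hypotheses (alpha0 : 0 < alpha) (H0 : 0 < H) (H1 : H < 1).
Hypotheses (theta0 : forall k, 0 < theta k) (sigma0 : forall k, 0 < sigma k).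
Hypothesis hB : forall k, fractional_brownian_motion H (B k).
Hypothesis iB : independent_processes P (fun k t => B k t).
Hypothesis hz : forall k, stationary_fOU (alpha * theta k) (sigma k) (B k) (z k).
Hypothesis n0 : (0 < n)%N.
Local Notation p := (2 * H).

Definition stationary_variance k := sigma k ^+ 2 * (alpha * theta k) `^ (- p) * (H * Gamma p).
Local Notation v := stationary_variance.
(* The index [i < n] stands for the observation time [i + 1]. *)
Definition scaled_mean k :=
  mean_of_squares n (fun i => z k i.+1%:R) (v k) (alpha `^ (- p)).
Local Notation W := scaled_mean.
Local Notation mu := (alpha `^ (- p)).

Let l0 k : 0 < alpha * theta k. Proof. exact: mulr_gt0. Qed.

Lemma HGamma_gt0 : 0 < H * Gamma p.
Proof.
by rewrite mulr_gt0// Gamma_gt0 ?mulr_gt0// -[leRHS]mulr1 ler_pM2l// ltW.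
Qed.

Lemma stationary_variance_gt0 k : 0 < v k.
Proof.
apply: mulr_gt0; last exact: HGamma_gt0.
by apply: mulr_gt0; [exact: exprn_gt0|exact: powR_gt0].
Qed.

Let mu0 : 0 < mu. Proof. exact: powR_gt0. Qed.

Let sZ k i : (i < n)%N -> square_integrable P (z k i.+1%:R).
Proof. exact: (square_integrable_fOU (hB k) (l0 k) (hz k)). Qed.

Let vZ k i : (i < n)%N -> inner P (z k i.+1%:R) (z k i.+1%:R) = v k.
Proof. exact: (fOU_variance H0 H1 (hB k) (l0 k) (sigma0 k) (hz k)). Qed.

Let Z6 k i : (i < n)%N -> (\int[P]_w (z k i.+1%:R w ^+ 6)%:E <= (15 * v k ^+ 3)%:E)%E.
Proof.
by move=> i_n; rewrite -(vZ k i_n); have [] := fOU_moments (hB k) (l0 k) (hz k) i_n.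
Qed.

Let Z22 k i j : (i < n)%N -> (j < n)%N ->
  P.-integrable setT (EFin \o (fun w => z k i.+1%:R w ^+ 2 * z k j.+1%:R w ^+ 2)) /\
  \int[P]_w (z k i.+1%:R w ^+ 2 * z k j.+1%:R w ^+ 2) =
    v k ^+ 2 + 2 * inner P (z k i.+1%:R) (z k j.+1%:R) ^+ 2.
Proof.
move=> i_n j_n; have := fOU_product_moment (hB k) (l0 k) (hz k) i_n j_n.
by rewrite !vZ// -expr2.
Qed.

Lemma measurable_scaled_mean k : measurable_fun setT (W k).
Proof. exact: measurable_mean_of_squares (sZ k). Qed.

Lemma scaled_mean_ge0 k w : 0 <= W k w.
Proof. exact: mean_of_squares_ge0 (stationary_variance_gt0 k) mu0 w. Qed.

Lemma integrable_sqr_scaled_mean k : P.-integrable setT (EFin \o (fun w => W k w ^+ 2)).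
Proof. exact: integrable_sqr_mean_of_squares (Z22 k). Qed.

Lemma Rintegral_scaled_mean k : \int[P]_w W k w = mu.
Proof. exact: Rintegral_mean_of_squares n0 (stationary_variance_gt0 k) (sZ k) (vZ k). Qed.

Definition scaled_variance k :=
  mean_of_squares_variance P n (fun i => z k i.+1%:R) (v k) mu.

Lemma variance_scaled_mean k : \int[P]_w ((W k w - mu) ^+ 2) = scaled_variance k.
Proof.
exact: variance_mean_of_squares n0 (stationary_variance_gt0 k) (sZ k) (vZ k) (Z22 k).
Qed.

Lemma scaled_variance_bounds k : 2 * mu ^+ 2 / n%:R <= scaled_variance k <= 2 * mu ^+ 2.
Proof.
exact: mean_of_squares_variance_bounds n0 (stationary_variance_gt0 k) mu0 (sZ k) (vZ k).
Qed.

(** The variance [v k] cancels, so the bound is uniform in [k]. *)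
Lemma scaled_mean_moment3 k :
  P.-integrable setT (EFin \o (fun w => `|W k w - mu| ^+ 3)) /\
  \int[P]_w (`|W k w - mu| ^+ 3) <= (mu / n%:R) ^+ 3 * 4 ^+ n * (n%:R * 15) + mu ^+ 3.
Proof.
have [i3 E3] := mean_of_squares_moment3 (stationary_variance_gt0 k) mu0 (sZ k) (Z6 k).
split => //; apply: (le_trans E3); rewrite /mean_of_squares_moment3_bound lerD2r le_eqVlt.
apply/orP; left; apply/eqP.
have nN0 : n%:R != 0 :> R by rewrite pnatr_eq0 -lt0n.
have vN0 : v k != 0 by rewrite gt_eqF// stationary_variance_gt0.
by field; rewrite nN0 vN0.
Qed.

Lemma independent_seq_scaled_mean : independent_seq P W.
Proof.
have exz k (i : nat) : exists z' : T -> R, (i < n)%N ->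
    (forall A : set R, measurable A -> process_sigma_algebra (fun t => B k t) (z' @^-1` A)) /\
    {ae P, forall w, z k i.+1%:R w = z' w}.
  have [i_n|] := ltnP i n; last by exists (fun=> 0).
  by have [z' h] := fOU_adapted_version (hB k) (l0 k) (hz k) i_n; exists z'.
have exz' k : exists z' : nat -> T -> R, forall i, (i < n)%N ->
    (forall A : set R, measurable A -> process_sigma_algebra (fun t => B k t) (z' i @^-1` A)) /\
    {ae P, forall w, z k i.+1%:R w = z' i w}.
  by have [z' h] := choice (exz k); exists z'.
have [z' hz'] := choice exz'.
apply: (@independent_seq_processes _ _ _ P (fun k t => B k t) W
  (fun k => mean_of_squares n (z' k) (v k) mu)) => //.
- exact: measurable_scaled_mean.
- move=> k A mA.
  pose G := [set A : set T | exists t, exists2 D : set R, measurable D & A = B k t @^-1` D].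
  pose T' : measurableType _ := g_sigma_algebraType G.
  have mW' : measurable_fun [set: T'] (mean_of_squares n (z' k) (v k) mu : T' -> R).
    apply: measurable_funM => //; apply: measurable_funM => //.
    apply: measurable_sum => i; apply: measurable_funX => _ D mD.
    by rewrite setTI; have [h _] := hz' k i (ltn_ord i); exact: h.
  by have := mW' measurableT A mA; rewrite setTI.
- move=> k.
  have : {ae P, forall w (i : nat), (i < n)%N -> z k i.+1%:R w = z' k i w}.
    apply/ae_foralln => i; have [i_n|_] := ltnP i n; last exact: aeW.
    by have [_] := hz' k i i_n; apply: filterS.
  apply: filterS => w hw; rewrite /scaled_mean /mean_of_squares; congr (_ * (_ * _)).
  by apply: eq_bigr => i _; rewrite hw.
Qed.

(** The weight [theta^p / (sigma^2 H Gamma(p))] equals [mu / v k]: the powers of [alpha] cancel, as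
    they must in a statistic that does not know [alpha]. *)
Lemma Y_statE N w : Y_stat H theta sigma (fun k t => z k t) n N w = (\sum_(k < N) W k w) / N%:R.
Proof.
rewrite /Y_stat -(mulrA N%:R) invfM mulrA mulrAC; congr (_ * _).
rewrite big_distrl /=; apply: eq_bigr => k _.
rewrite /scaled_mean /mean_of_squares mulrAC; congr (_ * (_ * _)).
  have G0 := HGamma_gt0; rewrite /stationary_variance powRM ?(ltW alpha0)// ?(ltW (theta0 k))//.
  rewrite powRN powRN.
  have a0 : alpha `^ p != 0 by rewrite gt_eqF// powR_gt0.
  have t0 : theta k `^ p != 0 by rewrite gt_eqF// powR_gt0.
  have s0 : sigma k != 0 by rewrite gt_eqF.
  have {}G0 : H * Gamma p != 0 by rewrite gt_eqF.
  move: (alpha `^ p) (theta k `^ p) (H * Gamma p) a0 t0 G0 => a t G a0 t0 G0.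
  by field; rewrite a0 t0 s0 G0.
by rewrite big_add1 /= big_mkord.
Qed.

(** The covariance is of order [lambda^-2] and the variance of order [lambda^-p], so the correlation
    is [O(lambda^(p - 2))], where [p < 2]. *)
Let correlation_cvg0 i j : theta k @[k --> \oo] --> +oo -> (i < j)%N -> (j < n)%N ->
  inner P (z k i.+1%:R) (z k j.+1%:R) / v k @[k --> \oo] --> (0 : R).
Proof.
move=> thetaoo ij jn.
have p0 : 0 < p by rewrite mulr_gt0.
have p2 : p < 2 by rewrite -[ltRHS]mulr1 ltr_pM2l.
have tau0 : 0 < j.+1%:R - i.+1%:R :> R by rewrite subr_gt0 ltr_nat.
have [C C0 hC] := powR_mixed_difference p0 p2 tau0.
pose l k := alpha * theta k.
have le_corr k : `|inner P (z k i.+1%:R) (z k j.+1%:R) / v k| <=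
    2 * C / (H * Gamma p) * (l k `^ (2 - p))^-1.
  have v0 := stationary_variance_gt0 k.
  rewrite normrM normfV (gtr0_norm v0) ler_pdivrMr//.
  have ij1 : (i.+1 < j.+1)%N by [].
  have := fOU_covariance_le (hB k) (l0 k) (hz k) ij1 jn (ltW C0) hC.
  move=> /le_trans; apply; rewrite le_eqVlt; apply/orP; left; apply/eqP.
  have lp : l k `^ p != 0 by rewrite gt_eqF// powR_gt0// l0.
  rewrite /stationary_variance powRD; last by apply/implyP => _; rewrite gt_eqF// l0.
  rewrite !powRN (powR_mulrn 2 (ltW (l0 k))) -/(l k).
  have lN0 : l k != 0 by rewrite gt_eqF// l0.
  have GN0 : H * Gamma p != 0 by rewrite gt_eqF// HGamma_gt0.
  move: (H * Gamma p) (l k `^ p) GN0 lp => G t GN0 tN0.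
  by field; rewrite lN0 tN0 GN0.
have lcvg : (l k `^ (2 - p))^-1 @[k --> \oo] --> (0 : R).
  apply/gtr0_cvgV0; first by apply: nearW => k; rewrite powR_gt0// l0.
  apply/cvgryPge => A.
  (* A positive threshold, of which the root of order [2 - p] can be taken. *)
  pose A1 := Num.max A 1; have A10 : 0 < A1 by rewrite lt_max ltr01 orbT.
  near=> k; apply: (@le_trans _ _ A1); first by rewrite le_max lexx.
  have -> : A1 = (A1 `^ (2 - p)^-1) `^ (2 - p).
    by rewrite -powRrM mulVf ?powRr1 ?(ltW A10)// gt_eqF// subr_gt0.
  rewrite ge0_ler_powR ?nnegrE ?powR_ge0 ?(ltW (l0 k))// ?subr_ge0 ?(ltW p2)//.
  rewrite /l -ler_pdivrMl//; near: k; move/cvgryPge : thetaoo; exact.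
apply/norm_cvg0P; apply: (@squeeze_cvgr _ _ _ _ (cst 0)
  (fun k => 2 * C / (H * Gamma p) * (l k `^ (2 - p))^-1)).
- by near=> k; rewrite normr_ge0 le_corr.
- exact: cvg_cst.
- rewrite -[X in _ --> X](mulr0 (2 * C / (H * Gamma p))).
  by apply: cvgM => //; exact: cvg_cst.
Unshelve. all: end_near. Qed.

Lemma scaled_variance_cvg : theta k @[k --> \oo] --> +oo ->
  scaled_variance k @[k --> \oo] --> 2 * mu ^+ 2 / n%:R.
Proof.
move=> thetaoo.
have -> : 2 * mu ^+ 2 / n%:R = 2 * mu ^+ 2 / n%:R ^+ 2 * \sum_(i < n) \sum_(j < n) (i == j)%:R.
  rewrite (eq_bigr (fun=> 1)); last first.
    move=> i _; rewrite (bigD1 i)//= eqxx big1 ?addr0// => j ji.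
    by rewrite eq_sym (negbTE ji).
  by rewrite sumr_const card_ord; field; rewrite pnatr_eq0 -lt0n.
apply: cvgM; first exact: cvg_cst.
apply: cvg_big => [|i _]; first exact: add_continuous.
apply: cvg_big => [|j _]; first exact: add_continuous.
rewrite [X in _ --> X](_ : _ = (i == j)%:R ^+ 2); last by case: (i == j); rewrite ?expr1n ?expr0n.
apply: (cvg_comp (fun k => inner P (z k i.+1%:R) (z k j.+1%:R) / v k) (fun x => x ^+ 2));
  last exact: exprn_continuous.
have [<-|ij] := eqVneq i j.
  rewrite (_ : (fun k => _) = cst (1 : R)); first exact: (cvg_cst (1 : R)).
  by apply/funext => k; rewrite vZ// divff// gt_eqF// stationary_variance_gt0.
have [ji|ji|ji] := ltngtP i j.
- exact: correlation_cvg0.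
- under eq_fun do rewrite innerC; exact: correlation_cvg0.
- by move: ij; rewrite (_ : i = j) ?eqxx//; exact: val_inj.
Qed.

End components.

(** * The delta method *)

Section delta_method.
Context d {T : measurableType d} {R : realType} (P : probability T R).
Variables (W : nat -> T -> R) (v : nat -> R) (alpha p c C M : R).
Hypotheses (alpha0 : 0 < alpha) (p0 : 0 < p).
Local Notation mu := (alpha `^ (- p)).
Hypothesis mW : forall k, measurable_fun setT (W k).
Hypothesis W0 : forall k w, 0 <= W k w.
Hypothesis iW2 : forall k, P.-integrable setT (EFin \o (fun w => W k w ^+ 2)).
Hypothesis EW : forall k, \int[P]_w W k w = mu.
Hypothesis VW : forall k, \int[P]_w ((W k w - mu) ^+ 2) = v k.
Hypothesis c0 : 0 < c.
Hypothesis vcC : forall k, c <= v k <= C.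
Hypothesis iW3 : forall k, P.-integrable setT (EFin \o (fun w => `|W k w - mu| ^+ 3)).
Hypothesis EW3 : forall k, \int[P]_w (`|W k w - mu| ^+ 3) <= M.
Hypothesis indepW : independent_seq P W.

Definition mean N w := (\sum_(k < N) W k w) / N%:R.
Definition mean_sd N := Num.sqrt (\sum_(k < N) v k) / N%:R.
Definition estimator N w := mean N w `^ (- p^-1).

Let mu0 : 0 < mu. Proof. exact: powR_gt0. Qed.

Lemma powR_opp_invK : mu `^ (- p^-1) = alpha.
Proof. by rewrite -powRrM mulrNN divff ?gt_eqF// powRr1// ltW. Qed.

Lemma measurable_mean N : measurable_fun setT (mean N).
Proof. by apply: measurable_funM => //; exact: measurable_sum. Qed.

Lemma mean_ge0 N w : 0 <= mean N w.
Proof. by rewrite divr_ge0// sumr_ge0. Qed.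

Lemma measurable_estimator N : measurable_fun setT (estimator N).
Proof.
apply: (@measurableT_comp _ _ _ _ _ _ (fun x : R => x `^ (- p^-1))); last exact: measurable_mean.
exact: measurable_powR_fun.
Qed.

Lemma ae_estimator_cvg : {ae P, forall w, estimator N w @[N --> \oo] --> alpha}.
Proof.
have vC k : v k <= C by have /andP[] := vcC k.
have := strong_law mW W0 iW2 EW VW vC indepW; apply: filterS => w hw.
rewrite -[X in _ --> X]powR_opp_invK.
exact: (cvg_comp (fun N => mean N w) (fun x => x `^ (- p^-1)) hw (continuous_powR_gt0 mu0)).
Qed.

Let v0 k : 0 < v k.
Proof. by have /andP[+ _] := vcC k; exact: lt_le_trans. Qed.

Let sum_v_bounds N : N%:R * c <= \sum_(k < N) v k <= N%:R * C.
Proof.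
have sE (x : R) : N%:R * x = \sum_(k < N) x by rewrite sumr_const card_ord mulr_natl.
by rewrite !sE; apply/andP; split; apply: ler_sum => i _; have /andP[] := vcC i.
Qed.

Let sum_v_ge0 N : 0 <= \sum_(k < N) v k.
Proof. by apply: sumr_ge0 => k _; exact: ltW. Qed.

Lemma mean_sd_sqr N : mean_sd N ^+ 2 = (\sum_(k < N) v k) / N%:R ^+ 2.
Proof. by rewrite /mean_sd expr_div_n sqr_sqrtr. Qed.

Lemma mean_sd_gt0 N : (0 < N)%N -> 0 < mean_sd N.
Proof.
move=> N0; rewrite divr_gt0 ?ltr0n// sqrtr_gt0.
have /andP[+ _] := sum_v_bounds N; apply: lt_le_trans.
by rewrite mulr_gt0 ?ltr0n.
Qed.

Lemma mean_sd_sqr_bounds N : (0 < N)%N -> c / N%:R <= mean_sd N ^+ 2 <= C / N%:R.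
Proof.
move=> N0; have N1 : 0 < N%:R :> R by rewrite ltr0n.
rewrite mean_sd_sqr; have /andP[h1 h2] := sum_v_bounds N.
rewrite ler_pdivlMr ?exprn_gt0// ler_pdivrMr ?exprn_gt0//.
have E (x : R) : x / N%:R * N%:R ^+ 2 = N%:R * x by field; rewrite gt_eqF.
by rewrite !E h1.
Qed.

Lemma mean_variance N : (0 < N)%N ->
  P.-integrable setT (EFin \o (fun w => (mean N w - mu) ^+ 2)) /\
  \int[P]_w ((mean N w - mu) ^+ 2) = mean_sd N ^+ 2.
Proof.
move=> N0; have N1 : N%:R != 0 :> R by rewrite pnatr_eq0 -lt0n.
have [i E] := variance_sum mW W0 iW2 EW VW indepW N.
have -> : (fun w => (mean N w - mu) ^+ 2) =
    fun w => N%:R ^- 2 * (\sum_(i < N) W i w - N%:R * mu) ^+ 2.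
  by apply/funext => w; rewrite /mean; move: (\sum_(i < N) _) => S; field.
split; first exact: integrableZl_EFin.
by rewrite RintegralZl// E mean_sd_sqr mulrC.
Qed.

Lemma mean_expectation N : (0 < N)%N ->
  P.-integrable setT (EFin \o mean N) /\ \int[P]_w mean N w = mu.
Proof.
move=> N0; have N1 : N%:R != 0 :> R by rewrite pnatr_eq0 -lt0n.
have iW k : P.-integrable setT (EFin \o W k) by exact: integrable_sqr_expr1.
have iS : P.-integrable setT (EFin \o (fun w => \sum_(k < N) W k w)).
  exact: integrable_sum_EFin.
have -> : mean N = fun w => N%:R^-1 * \sum_(k < N) W k w.
  by apply/funext => w; rewrite mulrC.
split; first exact: integrableZl_EFin.
rewrite RintegralZl// Rintegral_sum// (eq_bigr (fun=> mu))//.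
by rewrite sumr_const card_ord -mulr_natr; field; rewrite N1.
Qed.

Lemma variance_mean N : (0 < N)%N -> ('V_P[mean N] = (mean_sd N ^+ 2)%:E)%E.
Proof.
move=> N0; have [i1 E1] := mean_expectation N0; have [i2 E2] := mean_variance N0.
rewrite /variance covariance.unlock expectation.unlock.
have -> : fine (\int[P]_w (mean N w)%:E)%E = mu by rewrite -E1.
rewrite -E2 /Rintegral fineK; last exact: (integrable_fin_num measurableT i2).
by apply: eq_integral => w _; rewrite expr2.
Qed.

(** Chebyshev's argument: [mu^2] times the indicator of the event is at most [(mean - mu)^2]. *)
Lemma mean_eq0_le N : (0 < N)%N ->
  fine (P [set w | mean N w = 0]) <= mean_sd N ^+ 2 / mu ^+ 2.
Proof.
move=> N0; have [i2 E2] := mean_variance N0.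
have mA : measurable [set w | mean N w = 0].
  rewrite (_ : [set w | _] = mean N @^-1` [set 0])//.
  by rewrite -[X in measurable X]setTI; exact: measurable_mean.
rewrite ler_pdivlMr ?exprn_gt0// -lee_fin EFinM fine_probabilityK//.
rewrite -E2 /Rintegral fineK; last exact: (integrable_fin_num measurableT i2).
rewrite muleC -[X in (_ * P X)%E]setIT -integral_indic// -ge0_integralZl//; last 2 first.
- exact/measurable_EFinP.
- by rewrite lee_fin sqr_ge0.
apply: ge0_le_integral => //.
- by move=> w _; rewrite -EFinM lee_fin mulr_ge0// sqr_ge0.
- by apply: measurable_funeM; exact/measurable_EFinP.
- by case/integrableP: i2.
- move=> w _; rewrite -EFinM lee_fin indicE.
  have [h|h] := boolP (w \in _); last by rewrite mulr0 sqr_ge0.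
  by move: h; rewrite inE /= => ->; rewrite sub0r sqrrN mulr1.
Qed.

Lemma mean_sd_cvg0 : mean_sd N @[N --> \oo] --> (0 : R).
Proof.
have C0 : 0 <= C by have /andP[h1 h2] := vcC 0; rewrite ltW// (lt_le_trans c0)// (le_trans h1).
apply/cvgrPdist_le => e e0.
have [k _ hk] := nbhs_infty_ger (C / e ^+ 2).
near=> N; have N0 : (0 < N)%N by near: N; exists 1%N.
rewrite sub0r normrN ger0_norm ?(ltW (mean_sd_gt0 N0))//.
rewrite -(@ler_pXn2r _ 2)// ?nnegrE ?(ltW (mean_sd_gt0 N0)) ?(ltW e0)//.
have /andP[_ h] := mean_sd_sqr_bounds N0; apply: (le_trans h).
rewrite ler_pdivrMr ?ltr0n// mulrC -ler_pdivrMr ?exprn_gt0//.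
by apply: hk => /=; near: N; exists k.
Unshelve. all: end_near. Qed.

(** The deviation is taken with reversed sign, because the estimator is small when the mean is
    large. *)
Lemma mean_clt (eps : R) : 0 < eps -> exists N0 : nat, forall N, (N0 <= N)%N -> forall x : R,
  `|fine (P [set w | (mu - mean N w) / mean_sd N <= x]) -
    fine (normal_prob 0 1 `]-oo, x])| <= eps.
Proof.
move=> eps0; pose X k w := mu - W k w.
have iW k : P.-integrable setT (EFin \o W k) by exact: integrable_sqr_expr1.
have mX k : measurable_fun setT (X k) by apply: measurable_funB.
have EX k : \int[P]_w X k w = 0.
  rewrite RintegralB//; last exact: (finite_measure_integrable_cst P mu measurableT).
  by rewrite EW Rintegral_cst1 subrr.
have EX2 k : \int[P]_w (X k w ^+ 2) = v k.
  by rewrite -VW; apply: eq_Rintegral => w _; rewrite -sqrrN opprB.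
have E3 k : (fun w => `|X k w| ^+ 3) = fun w => `|W k w - mu| ^+ 3.
  by apply/funext => w; rewrite distrC.
have iX3 k : P.-integrable setT (EFin \o (fun w => `|X k w| ^+ 3)) by rewrite E3.
have EX3 k : \int[P]_w (`|X k w| ^+ 3) <= M by rewrite E3.
have iX : independent_seq P X.
  apply: (independent_seq_comp (g := fun k x => mu - x)) => // k.
  exact: measurable_funB.
have [N0 h] := clt mX c0 vcC EX EX2 iX3 EX3 (independent_seq_sum mX iX) eps0.
exists (maxn N0 1) => N; rewrite geq_max => /andP[N0N N1] x.
have -> : [set w | (mu - mean N w) / mean_sd N <= x] =
    [set w | (\sum_(i < N) X i w) / Num.sqrt (\sum_(i < N) v i) <= x].
  apply/funext => w /=; congr (is_true (_ <= _)); rewrite /mean /mean_sd /X sumrB.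
  rewrite sumr_const card_ord -(mulr_natl mu).
  have s0 : Num.sqrt (\sum_(i < N) v i) != 0.
    have := mean_sd_gt0 N1; rewrite /mean_sd; apply: contraTneq => ->.
    by rewrite mul0r ltxx.
  have n0 : N%:R != 0 :> R by rewrite pnatr_eq0 -lt0n.
  move: (Num.sqrt _) s0 (\sum_(i < N) W i w) => s s0 S.
  by field; rewrite s0 n0.
exact: h.
Qed.

Let powRN_le (a x y : R) : 0 <= a -> 0 < x -> x <= y -> y `^ (- a) <= x `^ (- a).
Proof.
move=> a0 x0 xy; have y0 := lt_le_trans x0 xy.
by rewrite !powRN lef_pV2 ?posrE ?powR_gt0// ge0_ler_powR// nnegrE ltW.
Qed.

(** The intermediate point is located by its distance to [x], the form in which its convergence is
    deduced. *)
Let powR_MVT2 (a x y : R) : 0 < x -> 0 < y ->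
  exists z, `|z - x| <= `|y - x| /\ y `^ a - x `^ a = (y - x) * (a * z `^ (a - 1)).
Proof.
move=> x0 y0; have [xy|yx] := leP x y.
- have yx : 0 <= y - x by rewrite subr_ge0.
  have [z /andP[h1 h2]] := powR_MVT a x0 yx; rewrite subrKC => E.
  exists z; split => //; rewrite !ger0_norm ?subr_ge0//.
  by rewrite lerD2r; move: h2; rewrite subrKC.
- have xy : 0 <= x - y by rewrite subr_ge0 ltW.
  have [z /andP[h1 h2]] := powR_MVT a y0 xy; rewrite subrKC => E.
  rewrite subrKC in h2; exists z; split.
    by rewrite distrC (distrC y) !ger0_norm ?subr_ge0// ?(ltW yx)// lerD2l lerN2.
  by rewrite -(opprB (x `^ a)) E; ring.
Qed.

(** Minus the derivative of [y ^ (- 1/p)] at [y = mu]. *)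
Definition delta_scale := alpha `^ (1 + p) / p.
Local Notation K := delta_scale.

Lemma delta_scale_gt0 : 0 < K. Proof. by rewrite divr_gt0// powR_gt0. Qed.

Lemma estimator_le b N w : 0 < b -> 0 < mean N w ->
  (estimator N w <= b) = (b `^ (- p) <= mean N w).
Proof.
move=> b0 m0; apply/idP/idP => h.
- have e0 : 0 < estimator N w by exact: powR_gt0.
  have := powRN_le (ltW p0) e0 h.
  by rewrite /estimator -powRrM mulrNN mulVf ?gt_eqF// powRr1// ltW.
- have b1 : 0 < b `^ (- p) by exact: powR_gt0.
  have ip : 0 <= p^-1 by rewrite invr_ge0 ltW.
  have := powRN_le ip b1 h.
  by rewrite -powRrM mulrNN divff ?gt_eqF// powRr1// ltW.
Qed.

(* Where [mean N] vanishes, so does [estimator N], as [0 `^ (- p^-1) = 0]; the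
   monotonicity argument fails there, which costs the last term. *)
Let estimator_event N (y : R) : (0 < N)%N -> 0 < alpha + K * mean_sd N * y ->
  fine (P [set w | (mu - mean N w) / mean_sd N <=
    (mu - (alpha + K * mean_sd N * y) `^ (- p)) / mean_sd N]) <=
  fine (P [set w | (estimator N w - alpha) / (K * mean_sd N) <= y]) <=
  fine (P [set w | (mu - mean N w) / mean_sd N <=
    (mu - (alpha + K * mean_sd N * y) `^ (- p)) / mean_sd N]) + mean_sd N ^+ 2 / mu ^+ 2.
Proof.
move=> N0; set b := alpha + _ => b0; set D := [set w | (mu - _) / _ <= _].
set A := [set w | _].
have s0 := mean_sd_gt0 N0; have K0 := delta_scale_gt0.
have AE w : A w = (estimator N w <= b) :> Prop.
  by rewrite /A /mkset (ler_pdivrMr _ _ (mulr_gt0 K0 s0)) lerBlDl /b (mulrC y).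
have DE w : D w = (b `^ (- p) <= mean N w) :> Prop.
  by rewrite /D /= ler_pM2r ?invr_gt0// lerD2l lerN2.
have mA : measurable A.
  rewrite (_ : A = estimator N @^-1` `]-oo, b]); last first.
    by apply/funext => w; rewrite AE /= in_itv.
  by rewrite -[X in measurable X]setTI; exact: measurable_estimator.
have mD : measurable D.
  rewrite (_ : D = mean N @^-1` `[b `^ (- p), +oo[); last first.
    by apply/funext => w; rewrite DE /= in_itv/= andbT.
  by rewrite -[X in measurable X]setTI; exact: measurable_mean.
have mZ : measurable [set w | mean N w = 0].
  rewrite (_ : [set w | _] = mean N @^-1` [set 0])//.
  by rewrite -[X in measurable X]setTI; exact: measurable_mean.
have b1 : 0 < b `^ (- p) by exact: powR_gt0.
apply/andP; split.
- rewrite -lee_fin !fine_probabilityK//; apply: le_measure; rewrite ?inE//.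
  move=> w; rewrite AE DE => h; rewrite estimator_le//.
  exact: lt_le_trans h.
- apply: (@le_trans _ _ (fine (P D) + fine (P [set w | mean N w = 0]))); last first.
    by rewrite lerD2l mean_eq0_le.
  rewrite -lee_fin EFinD !fine_probabilityK//.
  apply: (@le_trans _ _ (P (D `|` [set w | mean N w = 0]))); last exact: measureU2.
  apply: le_measure; rewrite ?inE//; first exact: measurableU.
  move=> w; rewrite AE => h; have := mean_ge0 N w; rewrite le_eqVlt => /predU1P[m0|m0].
    by right.
  by left; rewrite DE -estimator_le.
Qed.

(** A constant [y] handles the normalization by the exact standard deviation; a convergent [y]
    absorbs the change to the scale [sqrt N]. *)
Lemma estimator_clt (y : nat -> R) (l : R) : y @ \oo --> l ->
  (fun N => fine (P [set w | (estimator N w - alpha) / (K * mean_sd N) <= y N])) @ \oo -->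
  fine (normal_prob 0 1 `]-oo, l]).
Proof.
move=> yl; pose b N := alpha + K * mean_sd N * y N.
have bcvg : b @ \oo --> alpha.
  rewrite -[X in _ --> X]addr0; apply: cvgD; first exact: cvg_cst.
  rewrite -[X in _ --> X](mul0r l); apply: cvgM => //.
  rewrite -[X in _ --> X](mulr0 K); apply: cvgM; first exact: cvg_cst.
  exact: mean_sd_cvg0.
(* The mean value point is meaningful only where [b N] is positive, which holds from some [N] on;
   the value 0 elsewhere is a placeholder. *)
have ex_zeta N : exists zeta, 0 < b N -> `|zeta - alpha| <= `|b N - alpha| /\
    b N `^ (- p) - alpha `^ (- p) = (b N - alpha) * (- p * zeta `^ (- p - 1)).
  have [b0|_] := ltP 0 (b N); last by exists 0.
  by have [zeta h] := powR_MVT2 (- p) alpha0 b0; exists zeta.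
have [zeta hzeta] := choice ex_zeta.
have b_gt0 : \forall N \near \oo, 0 < b N.
  by move/cvgrPdist_lt : bcvg => /(_ alpha alpha0); apply: filterS => N;
    rewrite ltr_distlC subrr => /andP[].
have zcvg : zeta @ \oo --> alpha.
  apply/cvgrPdist_le => e e0; move/cvgrPdist_le : bcvg => /(_ e e0) be.
  near=> N; have b0 : 0 < b N by near: N.
  rewrite distrC; have [h _] := hzeta N b0; apply: (le_trans h); rewrite distrC.
  by near: N.
(* By the mean value theorem this is exactly the threshold for the normalized mean; the slope at
   [zeta N] tends to the one at [alpha], which [K] compensates. *)
pose x N := K * y N * (p * zeta N `^ (- p - 1)).
have xcvg : x @ \oo --> l.
  have -> : l = K * l * (p * alpha `^ (- p - 1)).
    rewrite /delta_scale; have -> : - p - 1 = - (1 + p) by ring.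
    rewrite powRN; have : alpha `^ (1 + p) != 0 by rewrite gt_eqF// powR_gt0.
    by move: (alpha `^ (1 + p)) => u u0; field; rewrite u0 gt_eqF.
  apply: cvgM; first by apply: cvgM => //; exact: cvg_cst.
  apply: cvgM; first exact: cvg_cst.
  exact: (cvg_comp zeta (fun u => u `^ (- p - 1)) zcvg (continuous_powR_gt0 alpha0)).
have scvg : mean_sd N ^+ 2 / mu ^+ 2 @[N --> \oo] --> (0 : R).
  rewrite -[X in _ --> X](mul0r (mu ^+ 2)^-1); apply: cvgM; last exact: cvg_cst.
  rewrite -[X in _ --> X](_ : 0 ^+ 2 = 0); last by rewrite expr0n.
  exact: (cvg_comp mean_sd (fun u => u ^+ 2) mean_sd_cvg0 (@exprn_continuous R 2 _)).
apply/cvgrPdist_le => e e0; have e30 : 0 < e / 3 by rewrite divr_gt0.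
have [N1 hclt] := mean_clt e30.
(* A positive Lipschitz constant for the normal distribution function. *)
pose L := @normal_peak R 1 + 1.
have L0 : 0 < L by rewrite ltr_wpDl// normal_peak_ge0.
have eL : 0 < e / 3 / L by rewrite divr_gt0.
near=> N.
have N0 : (0 < N)%N by near: N; exists 1%N.
have b0 : 0 < b N by near: N.
have s0 := mean_sd_gt0 N0.
have xE : (mu - b N `^ (- p)) / mean_sd N = x N.
  have [_ h] := hzeta N b0; rewrite -(opprB (b N `^ (- p))) h /b /x.
  by rewrite addrAC subrr add0r; field; rewrite gt_eqF.
have /andP[h1 h2] := estimator_event N0 b0.
rewrite -/(b N) xE in h1 h2.
have N1N : (N1 <= N)%N by near: N; exists N1.
have h3 := hclt N N1N (x N).
have h4 : `|x N - l| <= e / 3 / L.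
  by rewrite distrC; near: N; move/cvgrPdist_le : xcvg; exact.
have h5 : mean_sd N ^+ 2 / mu ^+ 2 <= e / 3.
  have : `|0 - mean_sd N ^+ 2 / mu ^+ 2| <= e / 3.
    by near: N; move/cvgrPdist_le : scvg; exact.
  by rewrite sub0r normrN; apply: le_trans; exact: ler_norm.
have lip (u w : R) : u <= w -> `|w - u| <= e / 3 / L ->
    fine (normal_prob 0 1 `]-oo, w]) <= fine (normal_prob 0 1 `]-oo, u]) + e / 3.
  move=> uw; rewrite ger0_norm ?subr_ge0// ler_pdivlMr// => h.
  have wu0 : 0 <= w - u by rewrite subr_ge0.
  have := cdf_normal_lipschitz u wu0; rewrite subrKC => /le_trans; apply.
  by rewrite lerD2l; apply: le_trans h; rewrite mulrC ler_wpM2l// /L lerDl ler01.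
have mono (u w : R) : u <= w ->
    fine (normal_prob 0 1 `]-oo, u]) <= fine (normal_prob 0 1 `]-oo, w]).
  move=> uw; apply: fine_le; [exact: fin_num_measure|exact: fin_num_measure|].
  apply: le_measure; rewrite ?inE//= => t /=; rewrite !in_itv/= => /le_trans; exact.
have h6 : `|fine (normal_prob 0 1 `]-oo, x N]) - fine (normal_prob 0 1 `]-oo, l])| <= e / 3.
  have [xl|lx] := leP (x N) l.
    have := lip _ _ xl; rewrite distrC => /(_ h4); have := mono _ _ xl.
    move: (fine _) (fine _) => f g h7 h8.
    rewrite distrC ger0_norm ?subr_ge0// lerBlDl//.
  have := lip _ _ (ltW lx) h4; have := mono _ _ (ltW lx).
  move: (fine _) (fine _) => f g h7 h8.
  by rewrite ger0_norm ?subr_ge0// lerBlDl.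
move: h1 h2 h3 h5 h6; move: (fine _) (fine _) (fine _) (fine _) => f1 f2 f3 f4.
move: (mean_sd N ^+ 2 / mu ^+ 2) => q h1 h2 h3 h5 h6.
move: h3 h6; rewrite !ler_norml => /andP[h3 h3'] /andP[h6 h6'].
by apply/andP; split; lra.
Unshelve. all: end_near. Qed.

End delta_method.

(** * Rescaling of the limit law *)

Section normal_scaling.
Context {R : realType}.
Local Notation N01 := (@normal_prob R 0 1).

(** The change of variables was shown for continuous integrands, so the indicator is enclosed
    between splines of width [h]; letting [h] decrease, the Lipschitz bounds on both distribution
    functions give the two inequalities. *)
Lemma cdf_normal_scale (s x : R) : 0 < s ->
  fine (normal_prob 0 s `]-oo, x]) = fine (N01 `]-oo, x / s]).
Proof.
move=> s0; pose g h u := spline (3 / h * (x + h) - 3 / h * u) : R.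
have mid : measurable_fun (setT : set (measurableTypeR R)) (fun u : R => u) by [].
have ms : measurable_fun (setT : set (measurableTypeR R)) (fun u : R => s * u).
  exact: measurable_funM.
have EE h : (\int[normal_prob 0 s]_u (g h u)%:E = \int[N01]_u (g h (s * u)%R)%:E)%E.
  rewrite (ge0_integral_normal_scale 0 s0); last 2 first.
  - move=> u; apply: (@cvg_comp _ _ _ (fun u => 3 / h * (x + h) - 3 / h * u) spline).
      apply: cvgB; first exact: cvg_cst.
      by apply: cvgM; [exact: cvg_cst|exact: cvg_id].
    exact: continuous_spline.
  - by move=> u; have /andP[] := spline_ge0_le1 (3 / h * (x + h) - 3 / h * u).
  by apply: eq_integral => u _; rewrite add0r.
have E h : \int[normal_prob 0 s]_u g h u = \int[N01]_u g h (s * u) by rewrite /Rintegral EE.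
have S1 h (h0 : 0 < h) := @Rintegral_spline_sandwich _ _ _ (@normal_prob R 0 s) (fun u => u) h x mid h0.
have S2 h (h0 : 0 < h) := @Rintegral_spline_sandwich _ _ _ N01 (fun u => s * u) h x ms h0.
have setE y : [set u : R | u <= y] = `]-oo, y]%classic.
  by apply/funext => u; rewrite /= in_itv.
have setE2 y : [set u : R | s * u <= y] = `]-oo, y / s]%classic.
  by apply/funext => u; rewrite /= in_itv/= ler_pdivlMr// mulrC.
have lipS h : 0 < h -> fine (normal_prob 0 s `]-oo, x + h]) <= fine (normal_prob 0 s `]-oo, x]) + normal_peak s * h.
  move=> h0; have xh : x <= x + h by rewrite lerDl ltW.
  have := @normal_prob_itv_le R 0 s x (x + h) s0 xh.
  rewrite -(fine_probabilityK (@normal_prob R 0 s))// lee_fin (addrAC x) subrr add0r => le.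
  have -> : normal_prob 0 s `]-oo, x + h] = (normal_prob 0 s `]-oo, x] + normal_prob 0 s `]x, (x + h)%R])%E.
    rewrite -measureU//.
      by congr (normal_prob 0 s _); rewrite -itv_bndbnd_setU// bnd_simp.
    apply/seteqP; split => // y [] /=; rewrite !in_itv /= => yx /andP[xy _].
    by move: (le_lt_trans yx xy); rewrite ltxx.
  by rewrite fineD ?fin_num_measure// lerD2l.
apply/eqP; rewrite eq_le; apply/andP; split.
- apply/ler_addgt0Pr => e e0.
  pose h := e * s / (@normal_peak R 1 + 1).
  have k0 : 0 < @normal_peak R 1 + 1 by rewrite ltr_wpDl// normal_peak_ge0.
  have h0 : 0 < h by rewrite divr_gt0// mulr_gt0.
  have /andP[l1 _] := S1 h h0; have /andP[_ l2] := S2 h h0.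
  rewrite setE in l1; rewrite setE2 in l2.
  apply: (le_trans l1); rewrite -/(g h _) E; apply: (le_trans l2).
  rewrite mulrDl.
  have hs0 : 0 <= h / s by rewrite divr_ge0// ltW.
  apply: (le_trans (cdf_normal_lipschitz _ hs0)); rewrite lerD2l /h.
  have -> : normal_peak 1 * (e * s / (normal_peak 1 + 1) / s) =
      e * (@normal_peak R 1 / (normal_peak 1 + 1)).
    by field; rewrite !gt_eqF.
  by rewrite ler_piMr ?(ltW e0)// ler_pdivrMr// mul1r lerDl ler01.
- apply/ler_addgt0Pr => e e0.
  pose h := e / (@normal_peak R s + 1).
  have k0 : 0 < @normal_peak R s + 1 by rewrite ltr_wpDl// normal_peak_ge0.
  have h0 : 0 < h by rewrite divr_gt0.
  have /andP[_ l1] := S1 h h0; have /andP[l2 _] := S2 h h0.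
  rewrite setE in l1; rewrite setE2 in l2.
  apply: (le_trans l2); rewrite -/(g h _) -E; apply: (le_trans l1).
  apply: (le_trans (lipS _ h0)); rewrite lerD2l /h mulrC -mulrA.
  by rewrite ler_piMr ?(ltW e0)// mulrC ler_pdivrMr// mul1r lerDl ler01.
Qed.

End normal_scaling.

Section asymptotic_scale.
Context {R : realType}.

Lemma delta_scaleE (alpha H : R) n : 0 < alpha -> 0 < H -> (0 < n)%N ->
  Num.sqrt (alpha ^+ 2 / (2 * n%:R * H ^+ 2)) =
  delta_scale alpha (2 * H) * Num.sqrt (2 * (alpha `^ (- (2 * H))) ^+ 2 / n%:R).
Proof.
move=> alpha0 H0; rewrite -(ltr0n R) => n0.
have K0 : 0 <= delta_scale alpha (2 * H).
  by apply/ltW; apply: delta_scale_gt0 => //; rewrite mulr_gt0.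
have -> : alpha ^+ 2 / (2 * n%:R * H ^+ 2) =
    delta_scale alpha (2 * H) ^+ 2 * (2 * (alpha `^ (- (2 * H))) ^+ 2 / n%:R).
  rewrite /delta_scale powRN powRD; last by apply/implyP => _; rewrite gt_eqF.
  rewrite powRr1 ?(ltW alpha0)//.
  have : alpha `^ (2 * H) != 0 by rewrite gt_eqF// powR_gt0.
  move: (alpha `^ (2 * H)) => u u0.
  by field; rewrite u0 !gt_eqF.
by rewrite sqrtrM ?sqr_ge0// sqrtr_sqr ger0_norm.
Qed.

(** [arithmetic_mean v N] averages the first [N + 1] terms, whence the shift; in this form Cesaro's
    theorem yields the limit of the normalization. *)
Lemma sqrt_mul_mean_sd (v : nat -> R) N :
  Num.sqrt N.+1%:R * mean_sd v N.+1 = Num.sqrt (arithmetic_mean v N).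
Proof.
rewrite /mean_sd /arithmetic_mean /= /series /= big_mkord.
set S := \sum_(k < N.+1) _.
have a0 : 0 < Num.sqrt N.+1%:R :> R by rewrite sqrtr_gt0.
rewrite sqrtrM ?invr_ge0// sqrtrV// -[X in _ * (_ / X)](sqr_sqrtr (ler0n R N.+1)).
move: (Num.sqrt N.+1%:R) (Num.sqrt S) a0 => a b a0.
by field; rewrite gt_eqF.
Qed.

End asymptotic_scale.

Theorem theorem3p1 (R : realType) (d : measure_display) (T : measurableType d)
    (P : probability T R)
    (V : completeNormedModType R) (dot : {dot V for idfun})
    (hV : hilbert dot)
    (e : nat -> V) (he : orthonormal_basis dot e)
    (alpha H : R) (halpha : 0 < alpha) (hH : 0 < H < 1)
    (theta sigma : nat -> R)
    (htheta : forall k, 0 < theta k) (hsigma : forall k, 0 < sigma k)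
    (DA : set V) (A : V -> V) (hA : self_adjoint dot DA A)
    (hAe : forall k, eigenvector DA A (- theta k) (e k))
    (DPhi : set V) (Phi : V -> V) (hPhi : self_adjoint dot DPhi Phi)
    (hPhie : forall k, eigenvector DPhi Phi (sigma k) (e k))
    (B : R -> V -> {RV P >-> R}) (hB : cylindrical_fBm dot e H B)
    (z : nat -> R -> {RV P >-> R})
    (hz : forall k, stationary_fOU (alpha * theta k) (sigma k)
                      (fun t => B t (e k)) (z k))
    (hsum : exists gamma : R,
      (\sum_(0 <= k <oo)
         (sigma k ^+ 2 / (1 + theta k) `^ gamma
          * (1 + (theta k)^-1) `^ (2 * H))%:E < +oo)%E)
    (n : nat) (hn : (0 < n)%N) :
  let Y := fun N : nat => Y_stat H theta sigma z n N in
  let alphas := fun N : nat => alpha_star H theta sigma z n N in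
  [/\ {ae P, forall w, alphas N w @[N --> \oo] --> alpha},
      cvg_in_distribution P
        (fun N w => (alphas N w - alpha)
           / (alpha `^ (1 + 2 * H) / (2 * H) * Num.sqrt (fine 'V_P[Y N])))
        (normal_prob 0 1),
      exists c C : R, 0 < c <= C /\ forall N : nat, (0 < N)%N ->
        ((c / N%:R)%:E <= 'V_P[Y N] <= (C / N%:R)%:E)%E &
      theta k @[k --> \oo] --> +oo ->
      cvg_in_distribution P
        (fun N w => Num.sqrt N%:R * (alphas N w - alpha))
        (normal_prob 0 (Num.sqrt (alpha ^+ 2 / (2 * n%:R * H ^+ 2))))].
Proof.
have /andP[H0 H1] := hH; have [fB iB _] := hB.
pose Bk k t := B t (e k).
have hBk k : fractional_brownian_motion H (Bk k) by exact: fB.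
have iBk : independent_processes P (fun k t => Bk k t) by exact: iB.
have hzk k : stationary_fOU (alpha * theta k) (sigma k) (Bk k) (z k) by exact: hz.
pose p := 2 * H; have p0 : 0 < p by rewrite mulr_gt0.
pose W := scaled_mean alpha H theta sigma z n.
pose v := scaled_variance alpha H theta sigma z n.
pose mu := alpha `^ (- p); have mu0 : 0 < mu by exact: powR_gt0.
pose c := 2 * mu ^+ 2 / n%:R; pose C := 2 * mu ^+ 2.
have n0 : 0 < n%:R :> R by rewrite ltr0n.
have c0 : 0 < c by rewrite divr_gt0// mulr_gt0// exprn_gt0.
have mW k : measurable_fun setT (W k) := measurable_scaled_mean n halpha htheta hBk hzk k.
have W0 k w : 0 <= W k w := scaled_mean_ge0 z n halpha H0 H1 htheta hsigma k w.
have iW2 k := integrable_sqr_scaled_mean n halpha H0 H1 htheta hsigma hBk hzk k.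
have EW k := Rintegral_scaled_mean halpha H0 H1 htheta hsigma hBk hzk hn k.
have VW k := variance_scaled_mean halpha H0 H1 htheta hsigma hBk hzk hn k.
have vcC k : c <= v k <= C := scaled_variance_bounds halpha H0 H1 htheta hsigma hBk hzk hn k.
have iW3 k := (scaled_mean_moment3 halpha H0 H1 htheta hsigma hBk hzk hn k).1.
have EW3 k := (scaled_mean_moment3 halpha H0 H1 htheta hsigma hBk hzk hn k).2.
have iW := independent_seq_scaled_mean n halpha htheta hBk iBk hzk.
move=> Y alphas.
have YE N : Y N = mean W N.
  by apply/funext => w; exact: (Y_statE z n halpha H0 H1 htheta hsigma N w).
have aE N w : alphas N w = estimator W p N w.
  by rewrite /alphas /alpha_star -/(Y N) YE.
have VE N : (0 < N)%N -> ('V_P[Y N] = (mean_sd v N ^+ 2)%:E)%E.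
  by move=> N0; rewrite YE; exact: (variance_mean mW W0 iW2 EW VW c0 vcC iW).
have K0 : 0 < delta_scale alpha p by exact: delta_scale_gt0.
have sd0 N : (0 < N)%N -> 0 < mean_sd v N by exact: (mean_sd_gt0 c0 vcC).
have mE N (x : R) : measurable [set w | estimator W p N w <= x].
  rewrite (_ : [set w | _] = estimator W p N @^-1` `]-oo, x]); last first.
    by apply/funext => w; rewrite /= in_itv.
  by rewrite -[X in measurable X]setTI; exact: measurable_estimator.
(* The event is written without division, a form to which both normalizations of the statement
   reduce. *)
have clt_estimator (y : nat -> R) (l : R) : y @ \oo --> l ->
    P [set w | estimator W p N w <= alpha + delta_scale alpha p * mean_sd v N * y N]
      @[N --> \oo] --> normal_prob 0 1 `]-oo, l].
  move=> yl.
  have h := estimator_clt halpha p0 mW W0 iW2 EW VW c0 vcC iW3 EW3 iW yl.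
  rewrite -(fine_probabilityK (normal_prob 0 1))//.
  have -> : (fun N => P [set w | estimator W p N w <= alpha + delta_scale alpha p * mean_sd v N * y N]) =
      fun N => (fine (P [set w | estimator W p N w <= alpha + delta_scale alpha p * mean_sd v N * y N]))%:E.
    by apply/funext => N; rewrite fine_probabilityK.
  apply: cvg_EFin; first by near=> N.
  apply: cvg_trans h; apply: near_eq_cvg; near=> N.
  have N0 : (0 < N)%N by near: N; exists 1%N.
  congr (fine (P _)); apply/funext => w /=.
  have ks : 0 < delta_scale alpha p * mean_sd v N by rewrite mulr_gt0// sd0.
  by rewrite ler_pdivrMr// lerBlDl (mulrC (y N)).
split.
- have := ae_estimator_cvg halpha p0 mW W0 iW2 EW VW vcC iW.
  apply: filterS => w; rewrite (_ : (fun N => alphas N w) = fun N => estimator W p N w)//.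
  by apply/funext => N.
- move=> x _; apply: cvg_trans (clt_estimator (cst x) x (cvg_cst x)).
  apply: near_eq_cvg; near=> N; have N0 : (0 < N)%N by near: N; exists 1%N.
  congr (P _); apply/funext => w /=.
  rewrite VE//= sqrtr_sqr gtr0_norm ?sd0// -/p -/(delta_scale alpha p) aE.
  have ks : 0 < delta_scale alpha p * mean_sd v N by rewrite mulr_gt0// sd0.
  by rewrite ler_pdivrMr// lerBlDl (mulrC x).
- exists c, C; split.
    by rewrite c0; have /andP[+ ] := vcC 0%N; exact: le_trans.
  by move=> N N0; rewrite VE// !lee_fin; exact: (mean_sd_sqr_bounds c0 vcC).
- move=> thetaoo x _.
  pose s := Num.sqrt (alpha ^+ 2 / (2 * n%:R * H ^+ 2)).
  have s0 : 0 < s.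
    by rewrite sqrtr_gt0 divr_gt0 ?exprn_gt0// mulr_gt0 ?exprn_gt0// mulr_gt0.
  have Es : normal_prob 0 s `]-oo, x] = normal_prob 0 1 `]-oo, x / s].
    by rewrite -[LHS]fineK ?fin_num_measure// cdf_normal_scale// fineK// fin_num_measure.
  suff : P [set w | Num.sqrt N%:R * (alphas N w - alpha) <= x] @[N --> \oo] -->
      normal_prob 0 1 `]-oo, x / s] by rewrite -Es.
  (* Chosen so that [delta_scale * mean_sd * y N = x / sqrt N], which turns the event on the scale
     [sqrt N] into that of [clt_estimator]. *)
  pose y N := x / (delta_scale alpha p * (Num.sqrt N%:R * mean_sd v N)).
  have ycvg : y @ \oo --> x / s.
    rewrite /s delta_scaleE//; apply: cvgM; first exact: cvg_cst.
    apply: cvgV; first by rewrite mulf_neq0// gt_eqF// sqrtr_gt0.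
    apply: cvgM; first exact: cvg_cst.
    have vcvg := scaled_variance_cvg halpha H0 H1 htheta hsigma hBk hzk hn thetaoo.
    (* The variances [v k] tend to [c], hence so do their averages, and [delta_scale * sqrt c] is
       the deviation [s] by [delta_scaleE]. *)
    have ces := cesaro vcvg.
    have sq : Num.sqrt (arithmetic_mean v N) @[N --> \oo] --> Num.sqrt c.
      exact: (cvg_comp (arithmetic_mean v) Num.sqrt ces (@sqrt_continuous R c)).
    rewrite -cvg_shiftS; apply: cvg_trans sq; apply: near_eq_cvg; near=> N.
    by rewrite -sqrt_mul_mean_sd.
  apply: cvg_trans (clt_estimator y (x / s) ycvg).
  apply: near_eq_cvg; near=> N; have N0 : (0 < N)%N by near: N; exists 1%N.
  congr (P _); apply/funext => w /=; rewrite aE.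
  have q0 : 0 < Num.sqrt N%:R :> R by rewrite sqrtr_gt0 ltr0n.
  rewrite [in RHS]mulrC -(ler_pdivlMr _ _ q0) lerBlDl /y.
  have := sd0 N N0; have := K0.
  move: (delta_scale alpha p) (mean_sd v N) => K sd K1 sd1.
  congr (is_true (_ <= _ + _)); field; rewrite ?gt_eqF//.
Unshelve. all: end_near. Qed.
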